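(* Let $\Omega=\mathbb{R}^3/\mathbb{Z}^3$, $T>0$, let $K(\varrho)=\overline{K}$ be a positive constant (so $\chi(\varrho)=\overline{K}\varrho$), and let $p\in C^1[0,\infty)\cap C^2(0,\infty)$ with $p(0)=0$. Let $(\varrho,\mathbf{J})$ be a dissipative weak solution (defined in the context) of the Euler-Korteweg-Poisson system in $(0,T)\times\Omega$ with initial data $(\varrho_0,\mathbf{J}_0)$ such that, for some constant $\underline{\varrho}$, $$\varrho(t,x)\ge\underline{\varrho}>0\quad\text{for a.a. }(t,x)\in(0,T)\times\Omega.$$ Suppose that the Euler-Korteweg-Poisson system admits a classical (strong) solution $(\tilde\varrho,\tilde{\mathbf{J}})$ in $(0,T)\times\Omega$, emanating from the same initial data $(\varrho_0,\mathbf{J}_0)$. Then $$\varrho\equiv\tilde\varrho,\qquad\mathbf{J}\equiv\tilde{\mathbf{J}}.$$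
   Context: The Euler-Korteweg-Poisson system on $(0,T)\times\Omega$, $\Omega=\mathbb{R}^3/\mathbb{Z}^3$ (space periodic boundary conditions), for the density $\varrho=\varrho(t,x)\ge 0$ and the momentum $\mathbf{J}=\mathbf{J}(t,x)\in\mathbb{R}^3$, with damping coefficient equal to $1$, is $$\partial_t\varrho+\operatorname{div}_x\mathbf{J}=0,$$ $$\partial_t\mathbf{J}+\operatorname{div}_x\Big(\frac{\mathbf{J}\otimes\mathbf{J}}{\varrho}\Big)+\nabla_x p(\varrho)=-\mathbf{J}+\varrho\nabla_x\Big(K(\varrho)\Delta_x\varrho+\tfrac12K'(\varrho)|\nabla_x\varrho|^2\Big)+\varrho\nabla_xV,$$ $$\Delta_xV=\varrho-\overline{\varrho},$$ and $\chi(\varrho)=\varrho K(\varrho)$. A classical (strong) solution means a smooth solution $(\tilde\varrho,\tilde{\mathbf{J}})$ on $[0,T]\times\Omega$ with $\tilde\varrho>0$ (with $\overline\varrho=\frac1{|\Omega|}\int_\Omega\varrho_0\,dx$ and $\int_\Omega V\,dx=0$). Energy density: $$E(\varrho,\nabla_x\varrho,\mathbf{J})=\frac12\frac{|\mathbf{J}|^2}{\varrho}+P(\varrho)+2\chi(\varrho)|\nabla_x\sqrt{\varrho}|^2+\frac12|\nabla_xV|^2,\qquad P(\varrho)=\varrho\int_1^{\varrho}\frac{p(z)}{z^2}\,dz,$$ where $2\chi(\varrho)|\nabla_x\sqrt\varrho|^2=\tfrac12K(\varrho)|\nabla_x\varrho|^2$ (so $\nabla_x\sqrt\varrho=\nabla_x\varrho/(2\sqrt\varrho)$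 where $\varrho>0$). Definition (bounded energy weak solution). A pair $$\varrho\in C_{\rm weak}([0,T];L^2(\Omega))\cap L^\infty((0,T)\times\Omega),\quad \mathbf{J}\in C_{\rm weak}([0,T];L^2(\Omega;\mathbb{R}^3))\cap L^\infty((0,T)\times\Omega;\mathbb{R}^3)$$ is a bounded energy weak solution with initial data $(\varrho_0,\mathbf{J}_0)$ if: (i) $\varrho(t,\cdot)>0$ a.e. in $\Omega$ for any $t\in(0,T)$, and $\nabla_x\varrho\in L^\infty((0,T)\times\Omega)$; (ii) there is a constant $\overline{E}$ with $E(\varrho,\nabla_x\varrho,\mathbf{J})(t,\cdot)\le\overline{E}$ (a.e. in $\Omega$) for a.a. $t\in(0,T)$; (iii) $\varrho(0,\cdot)=\varrho_0$, $\mathbf{J}(0,\cdot)=\mathbf{J}_0$; (iv) for any $0\le\tau_1<\tau_2\le T$ and any scalar test function $\varphi\in C^\infty_c([0,T]\times\Omega)$, $$-\int_\Omega\varrho\varphi\,dx\Big|_{t=\tau_1}^{t=\tau_2}+\int_{\tau_1}^{\tau_2}\int_\Omega\big(\varrho\,\partial_t\varphi+\mathbf{J}\cdot\nabla_x\varphi\big)\,dx\,dt=0;$$ (v) for any $0\le\tau_1<\tau_2\le T$ and any vector test function $\varphi\in C^\infty_c([0,T]\times\Omega;\mathbb{R}^3)$, $$-\int_\Omega\mathbf{J}\cdot\varphi\,dx\Big|_{t=\tau_1}^{t=\tau_2}+\int_{\tau_1}^{\tau_2}\int_\Omega\Big(\mathbf{J}\cdot\partial_t\varphi+\frac{\mathbf{J}\otimes\mathbf{J}}{\varrho}:\nabla_x\varphi+p(\varrho)\operatorname{div}_x\varphi\Big)dx\,dt$$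 $$=\int_{\tau_1}^{\tau_2}\int_\Omega\Big(-\nabla_x\varrho\cdot\nabla_x(\chi(\varrho)\operatorname{div}_x\varphi)+\tfrac12\chi'(\varrho)|\nabla_x\varrho|^2\operatorname{div}_x\varphi-4\chi(\varrho)\nabla_x\sqrt\varrho\otimes\nabla_x\sqrt\varrho:\nabla_x\varphi\Big)dx\,dt$$ $$+\int_{\tau_1}^{\tau_2}\int_\Omega\big(\mathbf{J}\cdot\varphi-\varrho\nabla_xV\cdot\varphi\big)dx\,dt,$$ where $V$ is the unique solution of $\Delta_xV(t,\cdot)=\varrho(t,\cdot)-\overline\varrho$, $\int_\Omega V(t,\cdot)\,dx=0$, $t\in[0,T]$, with $\overline\varrho=\frac1{|\Omega|}\int_\Omega\varrho_0\,dx$. Here $C_{\rm weak}([0,T];L^2)$ denotes functions continuous in time with values in $L^2$ equipped with the weak topology. Since $\Omega$ is compact without boundary, $C^\infty_c([0,T]\times\Omega)$ is the space of smooth functions on $[0,T]\times\Omega$. Definition (dissipative weak solution). A bounded energy weak solution is called a dissipative weak solution if, in addition, $$\int_\Omega E(\varrho,\nabla_x\varrho,\mathbf{J})(\tau,\cdot)\,dx+\int_0^\tau\int_\Omega\frac{|\mathbf{J}|^2}{\varrho}\,dx\,dt\le\int_\Omega E(\varrho_0,\nabla_x\varrho_0,\mathbf{J}_0)\,dx\quad\text{for a.a. }\tau\in(0,T).$$ *)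

(* Defs.v *)
From HB Require Import structures.
From mathcomp Require Import all_boot all_order all_algebra.
From mathcomp Require Import all_classical all_reals all_analysis.

Set Implicit Arguments.
Unset Strict Implicit.
Unset Printing Implicit Defensive.

Import Order.TTheory GRing.Theory Num.Theory.
Import numFieldTopology.Exports numFieldNormedType.Exports.

Local Open Scope classical_set_scope.
Local Open Scope ring_scope.

(* The torus R^3/Z^3 is represented as follows: smooth functions on it are
   Z^3-periodic functions on R * R * R; elements of its L^p spaces are functions
   on R * R * R seen only through [torus_measure], which is Lebesgue measure
   concentrated on the unit cube (so the values off the cube are irrelevant).
   Space-time functions take an argument (t, x) : R * (R * R * R). *)
Section Measures.
Context {R : realType}.

Lemma lebesgue_itv_lty (a b : R) :
  (lebesgue_measure (`]a, b[%classic : set R) < +oo)%E.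
Proof. by rewrite lebesgue_measure_itv/=; case: ifP => _; rewrite -?EFinD ltry. Qed.

Definition itv_measure (a b : R) : set (measurableTypeR R) -> \bar R :=
  @mfrestr _ (measurableTypeR R) R _ lebesgue_measure
    (measurable_itv `]a, b[) (lebesgue_itv_lty a b).

HB.instance Definition _ (a b : R) := Measure.on (itv_measure a b).
HB.instance Definition _ (a b : R) := FiniteMeasure.on (itv_measure a b).

Lemma fin_num_product d1 d2 (X : measurableType d1) (Y : measurableType d2)
    (m1 : {measure set X -> \bar R}) (m2 : {finite_measure set Y -> \bar R}) :
  fin_num_fun m1 -> fin_num_fun (m1 \x m2)%E.
Proof.
move=> m1fin; apply: lty_fin_num_fun.
by rewrite -setXTT [ltLHS]product_measure1E// ltey_eq fin_numM// ?m1fin// fin_num_measure.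
Qed.

Definition torus_measure :
    set (measurableTypeR R * measurableTypeR R * measurableTypeR R) -> \bar R :=
  ((itv_measure 0 1 \x itv_measure 0 1) \x itv_measure 0 1)%E.

HB.instance Definition _ := Measure.on torus_measure.

Lemma fin_num_torus : fin_num_fun torus_measure.
Proof. by do 2!apply: fin_num_product; apply: fin_num_measure. Qed.

HB.instance Definition _ :=
  Measure_isFinite.Build _ _ _ torus_measure fin_num_torus.

Definition spacetime_measure (T : R) :
    set (measurableTypeR R *
         (measurableTypeR R * measurableTypeR R * measurableTypeR R)) -> \bar R :=
  (itv_measure 0 T \x torus_measure)%E.

HB.instance Definition _ (T : R) := Measure.on (spacetime_measure T).

Lemma fin_num_spacetime (T : R) : fin_num_fun (spacetime_measure T).
Proof. by apply: fin_num_product; apply: fin_num_measure. Qed.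

HB.instance Definition _ (T : R) :=
  Measure_isFinite.Build _ _ _ (spacetime_measure T) (fin_num_spacetime T).

End Measures.

Section Calculus.
Context {R : realType}.
Notation R3 := (R * R * R)%type.
Notation torus := (@torus_measure R).

Definition dot (a b : 'rV[R]_3) : R := \sum_i a 0 i * b 0 i.

Definition basis (i : 'I_3) : R3 :=
  (((i == 0 :> nat)%:R, (i == 1 :> nat)%:R), (i == 2 :> nat)%:R).

Definition dx (i : 'I_3) (u : R * R3 -> R) : R * R3 -> R :=
  'D_((0 : R), basis i) u.
Definition dt (u : R * R3 -> R) : R * R3 -> R := 'D_((1 : R), (0 : R3)) u.
Definition gradx (u : R * R3 -> R) (z : R * R3) : 'rV[R]_3 := \row_i dx i u z.
Definition divx (w : R * R3 -> 'rV[R]_3) (z : R * R3) : R :=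
  \sum_i dx i (fun y => w y 0 i) z.
Definition laplx (u : R * R3 -> R) (z : R * R3) : R := \sum_i dx i (dx i u) z.

(* C^k functions on E: all derivatives of order at most k exist in the interior
   of E and extend continuously to E. *)
Fixpoint Ck (V : normedModType R) (E : set V) (k : nat) (u : V -> R) : Prop :=
  {within E, continuous u} /\
  if k is k'.+1 then
    forall v : V, exists g : V -> R,
      Ck E k' g /\ forall z, E^° z -> is_derive z v u (g z)
  else True.

Definition smooth (V : normedModType R) (E : set V) (u : V -> R) : Prop :=
  forall k, Ck E k u.

Definition slab (T : R) : set (R * R3) := [set z | 0 <= z.1 <= T].

Definition smooth_spacetime (T : R) (u : R * R3 -> R) : Prop :=
  smooth (slab T) u /\
  forall i (t : R) x, 0 <= t <= T -> u (t, x + basis i) = u (t, x).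

Definition smooth_spacetime_vec (T : R) (w : R * R3 -> 'rV[R]_3) : Prop :=
  forall i, smooth_spacetime T (fun z => w z 0 i).

Definition smooth_torus (psi : R3 -> R) : Prop :=
  smooth setT psi /\ forall i x, psi (x + basis i) = psi x.

Definition Lvec d (X : measurableType d) (mu : {measure set X -> \bar R})
    (q : \bar R) (w : X -> 'rV[R]_3) : Prop :=
  forall i, (fun x => w x 0 i) \in Lfun mu q.

Definition weak_gradient (f : R3 -> R) (g : R3 -> 'rV[R]_3) : Prop :=
  [/\ f \in Lfun torus 1%E, Lvec torus 1%E g &
      forall psi, smooth_torus psi -> forall i,
        \int[torus]_x (f x * 'D_(basis i) psi x)
        = - \int[torus]_x (g x 0 i * psi x)].

Definition Cweak (T : R) (u : R * R3 -> R) : Prop :=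
  (forall t : R, 0 <= t <= T -> (fun x => u (t, x)) \in Lfun torus 2%:E) /\
  forall psi : R3 -> R, psi \in Lfun torus 2%:E ->
    {within `[0, T], continuous (fun t => \int[torus]_x (u (t, x) * psi x))}.

End Calculus.

Section EulerKortewegPoisson.
Context {R : realType}.
Notation R3 := (R * R * R)%type.
Notation torus := (@torus_measure R).
Notation lebesgue := (@lebesgue_measure R).
Variables (K p : R -> R) (T : R).

(* p \in C^1[0,oo) \cap C^2(0,oo) *)
Definition pressure_regular : Prop :=
  {within `[0, +oo[, continuous p} /\
  exists dp : R -> R,
    [/\ {within `[0, +oo[, continuous dp},
        forall r : R, 0 < r -> is_derive r 1 p (dp r) &
        exists ddp : R -> R, {within `]0, +oo[, continuous ddp} /\
          forall r : R, 0 < r -> is_derive r 1 dp (ddp r)].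

Definition chi (r : R) : R := r * K r.

(* r * \int_1^r p(z)/z^2 dz, with an oriented integral *)
Definition pressure_potential (r : R) : R :=
  r * (if 1 <= r then \int[lebesgue]_(z in `[1, r]) (p z / z ^+ 2)
       else - \int[lebesgue]_(z in `[r, 1]) (p z / z ^+ 2)).

(* gradient of sqrt(rho) where rho = r > 0 and grad rho = g *)
Definition grad_sqrt (r : R) (g : 'rV[R]_3) : 'rV[R]_3 :=
  (2 * Num.sqrt r)^-1 *: g.

(* r, g, j, w stand for the values of rho, grad rho, J, grad V *)
Definition energy (r : R) (g j w : 'rV[R]_3) : R :=
  2^-1 * (dot j j / r) + pressure_potential r
  + 2 * chi r * dot (grad_sqrt r g) (grad_sqrt r g) + 2^-1 * dot w w.

(* No normalization by the volume of the torus, which is 1. *)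
Definition mean (f : R3 -> R) : R := \int[torus]_x f x.

(* The W^{1,2} weak solution V, with gradient DV, of
   lapl V = rho - rhobar, \int V = 0. *)
Definition poisson_potential (rhobar : R) (rho V : R3 -> R)
    (DV : R3 -> 'rV[R]_3) : Prop :=
  [/\ V \in Lfun torus 2%:E, Lvec torus 2%:E DV, weak_gradient V DV,
      \int[torus]_x V x = 0 &
      forall psi, smooth_torus psi ->
        \int[torus]_x (\sum_i DV x 0 i * 'D_(basis i) psi x)
        = - \int[torus]_x ((rho x - rhobar) * psi x)].

Record bounded_energy_weak_solution (rho0 : R3 -> R) (J0 : R3 -> 'rV[R]_3)
    (rho : R * R3 -> R) (J : R * R3 -> 'rV[R]_3) (Drho : R * R3 -> 'rV[R]_3)
    (V : R * R3 -> R) (DV : R * R3 -> 'rV[R]_3) : Prop := {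
  bews_rho_Cweak : Cweak T rho;
  bews_rho_Loo : rho \in Lfun (spacetime_measure T) +oo%E;
  bews_J_Cweak : forall i, Cweak T (fun z => J z 0 i);
  bews_J_Loo : Lvec (spacetime_measure T) +oo%E J;
  bews_rho_gt0 : forall t : R, 0 < t < T -> {ae torus, forall x, 0 < rho (t, x)};
  bews_Drho_Loo : Lvec (spacetime_measure T) +oo%E Drho;
  bews_Drho : {ae itv_measure 0 T, forall t : R,
    weak_gradient (fun x => rho (t, x)) (fun x => Drho (t, x))};
  bews_DV_measurable : forall i,
    measurable_fun [set: measurableTypeR R *
      (measurableTypeR R * measurableTypeR R * measurableTypeR R)]
      (fun z => DV z 0 i);
  bews_V : forall t : R, 0 <= t <= T ->
    poisson_potential (mean rho0) (fun x => rho (t, x))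
      (fun x => V (t, x)) (fun x => DV (t, x));
  bews_energy : exists Ebar : R, {ae itv_measure 0 T, forall t : R,
    {ae torus, forall x,
      energy (rho (t, x)) (Drho (t, x)) (J (t, x)) (DV (t, x)) <= Ebar}};
  bews_rho0_L2 : rho0 \in Lfun torus 2%:E;
  bews_J0_L2 : Lvec torus 2%:E J0;
  bews_rho0 : {ae torus, forall x, rho (0, x) = rho0 x};
  bews_J0 : {ae torus, forall x, J (0, x) = J0 x};
  bews_continuity : forall (tau1 tau2 : R) (phi : R * R3 -> R),
    0 <= tau1 -> tau1 < tau2 -> tau2 <= T -> smooth_spacetime T phi ->
    - (\int[torus]_x (rho (tau2, x) * phi (tau2, x))
       - \int[torus]_x (rho (tau1, x) * phi (tau1, x)))
    + \int[lebesgue]_(t in `[tau1, tau2]) \int[torus]_x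
        (rho (t, x) * dt phi (t, x) + dot (J (t, x)) (gradx phi (t, x)))
    = 0;
  (* H is the (a.e. unique) gradient of chi(rho) div phi. *)
  bews_momentum : forall (tau1 tau2 : R) (phi : R * R3 -> 'rV[R]_3)
      (H : R * R3 -> 'rV[R]_3),
    0 <= tau1 -> tau1 < tau2 -> tau2 <= T -> smooth_spacetime_vec T phi ->
    Lvec (spacetime_measure T) 1%E H ->
    {ae itv_measure 0 T, forall t : R,
      weak_gradient (fun x => chi (rho (t, x)) * divx phi (t, x))
        (fun x => H (t, x))} ->
    - (\int[torus]_x dot (J (tau2, x)) (phi (tau2, x))
       - \int[torus]_x dot (J (tau1, x)) (phi (tau1, x)))
    + \int[lebesgue]_(t in `[tau1, tau2]) \int[torus]_x
        (let z := (t, x) in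
         \sum_i J z 0 i * dt (fun y => phi y 0 i) z
         + \sum_i \sum_j
             J z 0 i * J z 0 j / rho z * dx j (fun y => phi y 0 i) z
         + p (rho z) * divx phi z)
    = \int[lebesgue]_(t in `[tau1, tau2]) \int[torus]_x
        (let z := (t, x) in
         let s := grad_sqrt (rho z) (Drho z) in
         - dot (Drho z) (H z)
         + 2^-1 * derive1 chi (rho z) * dot (Drho z) (Drho z) * divx phi z
         - 4 * chi (rho z) *
             \sum_i \sum_j s 0 i * s 0 j * dx j (fun y => phi y 0 i) z)
      + \int[lebesgue]_(t in `[tau1, tau2]) \int[torus]_x
        (dot (J (t, x)) (phi (t, x))
         - rho (t, x) * dot (DV (t, x)) (phi (t, x)))
}.

(* The initial energy is +oo when rho0 has no weak gradient, hence the
   universally quantified (a.e. unique) Drho0, V0, DV0. *)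
Definition dissipative_weak_solution (rho0 : R3 -> R) (J0 : R3 -> 'rV[R]_3)
    (rho : R * R3 -> R) (J : R * R3 -> 'rV[R]_3) : Prop :=
  exists (Drho : R * R3 -> 'rV[R]_3) (V : R * R3 -> R)
      (DV : R * R3 -> 'rV[R]_3),
    bounded_energy_weak_solution rho0 J0 rho J Drho V DV /\
    forall (Drho0 : R3 -> 'rV[R]_3) (V0 : R3 -> R) (DV0 : R3 -> 'rV[R]_3),
      weak_gradient rho0 Drho0 ->
      poisson_potential (mean rho0) rho0 V0 DV0 ->
      {ae itv_measure 0 T, forall tau : R,
        (\int[torus]_x
           (energy (rho (tau, x)) (Drho (tau, x)) (J (tau, x)) (DV (tau, x)))%:E
         + \int[lebesgue]_(t in `[0%R, tau]) \int[torus]_x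
             (dot (J (t, x)) (J (t, x)) / rho (t, x))%:E
         <= \int[torus]_x (energy (rho0 x) (Drho0 x) (J0 x) (DV0 x))%:E)%E}.

Record classical_solution_with (rho0 : R3 -> R) (J0 : R3 -> 'rV[R]_3)
    (rho : R * R3 -> R) (J : R * R3 -> 'rV[R]_3) (V : R * R3 -> R) : Prop := {
  cs_rho_smooth : smooth_spacetime T rho;
  cs_J_smooth : smooth_spacetime_vec T J;
  cs_V_smooth : smooth_spacetime T V;
  cs_rho_gt0 : forall (t : R) x, 0 <= t <= T -> 0 < rho (t, x);
  cs_rho0 : {ae torus, forall x, rho (0, x) = rho0 x};
  cs_J0 : {ae torus, forall x, J (0, x) = J0 x};
  cs_continuity : forall (t : R) x, 0 < t < T ->
    dt rho (t, x) + divx J (t, x) = 0;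
  cs_momentum : forall i (t : R) x, 0 < t < T ->
    dt (fun z => J z 0 i) (t, x)
    + \sum_j dx j (fun z => J z 0 i * J z 0 j / rho z) (t, x)
    + dx i (fun z => p (rho z)) (t, x)
    = - J (t, x) 0 i
      + rho (t, x) *
          dx i (fun z => K (rho z) * laplx rho z
                 + 2^-1 * derive1 K (rho z) * dot (gradx rho z) (gradx rho z)) (t, x)
      + rho (t, x) * dx i V (t, x);
  cs_poisson : forall (t : R) x, 0 < t < T ->
    laplx V (t, x) = rho (t, x) - mean rho0;
  cs_V_mean : forall t : R, 0 <= t <= T -> \int[torus]_x V (t, x) = 0
}.

Definition classical_solution (rho0 : R3 -> R) (J0 : R3 -> 'rV[R]_3)
    (rho : R * R3 -> R) (J : R * R3 -> 'rV[R]_3) : Prop :=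
  exists V, classical_solution_with rho0 J0 rho J V.

End EulerKortewegPoisson.

(* Main.v *)
Require Import Defs.
From HB Require Import structures.
From mathcomp Require Import all_boot all_order all_algebra.
From mathcomp Require Import finmap.
From mathcomp Require Import all_classical all_reals all_analysis.
From mathcomp Require Import measurable_realfun.
From mathcomp Require Import ring lra.
Import Order.TTheory GRing.Theory Num.Theory.
Import numFieldTopology.Exports numFieldNormedType.Exports.
Local Open Scope classical_set_scope.
Local Open Scope ring_scope.

Set Implicit Arguments.
Unset Strict Implicit.
Unset Printing Implicit Defensive.

(* With R, U, Phi the density, velocity and potential of the classical solution,
   testing the weak continuity equation with h = - |U|^2/2 - K lapl R - Phi + P'(R)
   and the weak momentum equation with U turns the energy inequality into
     e(tau) + pi(tau) <= \int_0^tau \int C (e + |rho - R|^2),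
   where e is the relative energy (quadratic in J - rho U, grad rho - grad R and
   grad V - grad Phi) and pi is the integral of P(rho) - P(R) - P'(R) (rho - R).
   As p need not be monotone, pi has no sign; only |pi| <= C |rho - R|_2^2 is
   available. That term is absorbed by the Korteweg part of e through the
   interpolation inequality
     |rho - R|_2^2(tau) <= (1 / 2 delta) \int_0^tau |J - R U|_2^2
                            + (delta tau / 2) |grad (rho - R)|_2^2(tau),
   obtained by testing the continuity equation with a mollification of rho - R,
   and Gronwall's lemma concludes. The mollifying kernels are powers of
   \prod_i (1 + cos 2 pi (x_i - y_i)) / 2. Since P'(R) is only C^2 in R, it is
   approximated in C^1 by polynomials of R in order to be used as a test function. *)

(** * Almost everywhere equality and bounded measurable functions *)

(** The classical momentum equation is used divided by the density, because it then gives [U_t]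
    explicitly. Once [r_t] and [U_t] are eliminated, the Korteweg terms that are not quadratic in
    the gaps pair a function and its gradient with the divergence of a smooth field and the field
    itself, so they integrate to zero. No time derivative of the weak potential is at hand: what is
    left of the electric terms is the flux [r U + grad (Dt Phi)], which is divergence-free and
    therefore orthogonal to gradients. As the weak solution is bounded and its density bounded
    below, all weak quantities are replaced by measurable representatives bounded everywhere, and
    integrability is never an issue again. The absorption uses one [delta], proportional to [K / T],
    for the whole time interval; only the constant in front of the time integral grows. The energy
    inequality holds at almost every time only, so Gronwall's lemma is needed in an almost
    everywhere form, and equality reaches the remaining times through weak continuity. *)

Section AeIntegral.
Context d (T : measurableType d) (R : realType).
Variable mu : {measure set T -> \bar R}.

Lemma ae_mono (P Q : T -> Prop) : (forall x, P x -> Q x) ->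
  {ae mu, forall x, P x} -> {ae mu, forall x, Q x}.
Proof. by move=> PQ; apply: filterS. Qed.

Lemma ae_mono2 (P Q S : T -> Prop) : (forall x, P x -> Q x -> S x) ->
  {ae mu, forall x, P x} -> {ae mu, forall x, Q x} -> {ae mu, forall x, S x}.
Proof. by move=> PQ; apply: filterS2. Qed.

Lemma ae_all (P : T -> Prop) : (forall x, P x) -> {ae mu, forall x, P x}.
Proof. by move=> Px; apply: filterE. Qed.

Import HBNNSimple.

(* Unlike [ae_eq_integral], no measurability is needed: the integral of a
   nonnegative function is a supremum over simple functions below it. *)
Let ge0_le_integral_ae (f g : T -> \bar R) :
  (forall x, 0 <= f x)%E -> (forall x, 0 <= g x)%E ->
  {ae mu, forall x, f x = g x} -> (\int[mu]_x f x <= \int[mu]_x g x)%E.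
Proof.
move=> f0 g0 [N [mN muN0 fgN]].
rewrite (ge0_integralTE mu f0) (ge0_integralTE mu g0).
apply: ge_ereal_sup => /= _ [h hf <-].
have mNC := measurableC mN.
(* Cutting [h] off on the null set [N] keeps its integral and puts it below [g], which is
   nonnegative on [N] and equals [f] elsewhere. *)
pose k : {nnsfun T >-> R} := mul_nnsfun h (indic_nnsfun R mNC).
have kE x : k x = h x * \1_(~` N) x by [].
have -> : sintegral mu h = sintegral mu k.
  have sE (u : {nnsfun T >-> R}) : sintegral mu u = (\int[mu]_x (u x)%:E)%E.
    by rewrite integral_nnsfun// patch_setT.
  rewrite !sE; apply: ae_eq_integral => //; [exact/measurable_EFinP|exact/measurable_EFinP|].
  exists N; split => // x /= /not_implyP[_]; apply: contra_notP => nNx.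
  by rewrite /= mindicE mem_set//= mulr1.
apply: ereal_sup_ubound => /=; exists k => // x.
rewrite kE indicE; have [nNx|Nx] := boolP (x \in ~` N); last by rewrite mulr0.
rewrite mulr1; have -> : g x = f x; last exact: hf.
by apply: contrapT => gf; move/set_mem: nNx; apply; apply: fgN => /= /esym.
Qed.

Let ge0_integral_ae (f g : T -> \bar R) :
  (forall x, 0 <= f x)%E -> (forall x, 0 <= g x)%E ->
  {ae mu, forall x, f x = g x} -> (\int[mu]_x f x = \int[mu]_x g x)%E.
Proof.
move=> f0 g0 fg; apply/eqP; rewrite eq_le !ge0_le_integral_ae//.
by apply: filterS fg => x ->.
Qed.

Lemma integral_ae (f g : T -> \bar R) :
  {ae mu, forall x, f x = g x} -> (\int[mu]_x f x = \int[mu]_x g x)%E.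
Proof.
move=> fg; rewrite integralE [RHS]integralE; congr (_ - _)%E;
  apply: ge0_integral_ae => //; apply: filterS fg => x fgx.
    by rewrite funepos.unlock fgx.
  by rewrite funeneg.unlock fgx.
Qed.

Lemma Rintegral_ae (f g : T -> R) :
  {ae mu, forall x, f x = g x} -> \int[mu]_x f x = \int[mu]_x g x.
Proof.
by move=> fg; congr fine; apply: integral_ae; apply: filterS fg => x ->.
Qed.

End AeIntegral.

Section ItvMeasure.
Context {R : realType}.
Implicit Types a b : R.

Lemma ae_itv_measure a b : {ae itv_measure a b, forall t : R, a < t < b}.
Proof.
exists (~` `]a, b[%classic); split => /=.
- exact: measurableC.
- by rewrite /itv_measure /mfrestr /mrestr setICl measure0.
- by move=> t /= + /ltac:(idtac); rewrite in_itv.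
Qed.

(** The endpoints are Lebesgue-null. The weak formulation integrates over closed intervals while
    [itv_measure] lives on open ones; [integral_ae] makes the change without any measurability of
    the integrand. *)
Lemma integral_itv_measure a b (f : R -> \bar R) :
  (\int[itv_measure a b]_t f t = \int[lebesgue_measure]_(t in `[a, b]) f t)%E.
Proof.
transitivity (\int[itv_measure a b]_(t in `]a, b[) f t)%E.
  rewrite [RHS]integral_mkcond; apply: integral_ae.
  apply: ae_mono (ae_itv_measure a b) => t abt.
  by rewrite patchE mem_set//= in_itv.
transitivity (\int[lebesgue_measure]_(t in `]a, b[) f t)%E.
  apply: eq_measure_integral => A mA Aab.
  transitivity (lebesgue_measure (A `&` `]a, b[%classic)); first by [].
  by rewrite setIidl.
rewrite [LHS]integral_mkcond [RHS]integral_mkcond; apply: integral_ae.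
exists [set a; b]; split.
- exact: measurableU.
- apply/eqP; rewrite eq_le measure_ge0 andbT.
  rewrite (le_trans (measureU2 _ _ _))//=.
  by rewrite !lebesgue_measure_set1 adde0.
- move=> t /=; apply: contra_notP => /not_orP[/eqP ta /eqP tb].
rewrite !patchE; congr (if _ then _ else _); apply/idP/idP => /set_mem /=;
  rewrite !in_itv/= => /andP[ta' tb'];
  apply/mem_set; rewrite /= in_itv/=.
  by rewrite (ltW ta') (ltW tb').
by rewrite !lt_neqAle ta' tb' eq_sym ta tb.
Qed.

Lemma Rintegral_itv_measure a b (f : R -> R) :
  \int[itv_measure a b]_t f t = \int[lebesgue_measure]_(t in `[a, b]) f t.
Proof. by rewrite /Rintegral integral_itv_measure. Qed.

Lemma itv_measureT a b : a <= b -> itv_measure a b setT = (b - a)%:E.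
Proof.
move=> ab; rewrite /itv_measure /mfrestr /mrestr setTI lebesgue_measure_itv/=.
by rewrite lte_fin; case: ltgtP ab => // -> _; rewrite subrr.
Qed.

Lemma ae_itv_measureS (a b c : R) (P : R -> Prop) : b <= c ->
  {ae itv_measure a c, forall t, P t} -> {ae itv_measure a b, forall t, P t}.
Proof.
move=> bc [N [mN N0 PN]]; exists N; split => //.
apply/eqP; rewrite eq_le measure_ge0 andbT -N0.
rewrite /itv_measure /mfrestr /mrestr le_measure ?inE//; [exact: measurableI..|].
by apply: setIS => t /=; rewrite !in_itv/= => /andP[-> /lt_le_trans -> ].
Qed.

End ItvMeasure.

Section Bmf.
Context {R : realType}.

(** The bound holds everywhere, not only almost everywhere. The class is then closed under products
    and slices and integrable for every finite measure, so linearity, monotonicity and Fubini need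
    no separate integrability argument. *)
Definition bmf d (X : measurableType d) (f : X -> R) : Prop :=
  measurable_fun setT f /\ exists C : R, forall x, `|f x| <= C.

Section closure.
Context d (X : measurableType d).
Implicit Types f g : X -> R.

Lemma bmf_cst (c : R) : bmf (fun _ : X => c).
Proof. by split; [exact: measurable_cst|exists `|c|]. Qed.

Lemma bmfD f g : bmf f -> bmf g -> bmf (fun x => f x + g x).
Proof.
move=> [mf [C fC]] [mg [C' gC]]; split; first exact: measurable_funD.
by exists (C + C') => x; rewrite (le_trans (ler_normD _ _))// lerD.
Qed.

Lemma bmfN f : bmf f -> bmf (fun x => - f x).
Proof.
move=> [mf [C fC]]; split; first exact: measurableT_comp.
by exists C => x; rewrite normrN.
Qed.

Lemma bmfB f g : bmf f -> bmf g -> bmf (fun x => f x - g x).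
Proof. by move=> bf bg; apply: bmfD => //; exact: bmfN. Qed.

Lemma bmfM f g : bmf f -> bmf g -> bmf (fun x => f x * g x).
Proof.
move=> [mf [C fC]] [mg [C' gC]]; split; first exact: measurable_funM.
by exists (C * C') => x; rewrite normrM ler_pM.
Qed.

Lemma bmfX f n : bmf f -> bmf (fun x => f x ^+ n).
Proof.
move=> bf; elim: n => [|n IHn]; first exact: bmf_cst.
under eq_fun do rewrite exprS.
exact: bmfM.
Qed.

Lemma bmf_sum (I : Type) (s : seq I) (F : I -> X -> R) :
  (forall i, bmf (F i)) -> bmf (fun x => \sum_(i <- s) F i x).
Proof.
move=> bF; elim: s => [|i s IHs].
  under eq_fun do rewrite big_nil.
  exact: bmf_cst.
under eq_fun do rewrite big_cons.
exact: bmfD.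
Qed.

Lemma bmf_abs f : bmf f -> bmf (fun x => `|f x|).
Proof.
move=> [mf [C fC]]; split; first exact: measurableT_comp.
by exists C => x; rewrite normr_id.
Qed.

Lemma bmfV f (c : R) : 0 < c -> bmf f -> (forall x, c <= f x) ->
  bmf (fun x => (f x)^-1).
Proof.
move=> c0 [mf _] cf; split.
  (* Capping the argument from below at [c] makes inversion continuous on the whole line. *)
  have -> : (fun x => (f x)^-1) = (fun r => (Num.max c r)^-1) \o f.
    by apply/funext => x /=; rewrite max_r.
  apply: measurableT_comp => //; apply: continuous_measurable_fun => r.
  apply: (@cvgV _ _ (nbhs r) _ (Num.max c)); last first.
    by apply: (@continuous_max _ _ (fun=> c) id) => //; exact: cvg_cst.
  by rewrite gt_eqF// lt_max c0.
exists c^-1 => x; rewrite normfV lef_pV2 ?posrE ?normr_gt0//.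
  by rewrite (le_trans (cf x))// ler_norm.
by rewrite gt_eqF// (lt_le_trans c0).
Qed.

Lemma bmf_comp (h : R -> R) f (C : R) : continuous h -> measurable_fun setT f ->
  (forall x, `|h (f x)| <= C) -> bmf (fun x => h (f x)).
Proof.
move=> ch mf hC; split; last by exists C.
by apply: measurableT_comp => //; exact: continuous_measurable_fun.
Qed.

End closure.

Lemma bmf_slice d d' (X : measurableType d) (Y : measurableType d')
  (f : X * Y -> R) x : bmf f -> bmf (fun y => f (x, y)).
Proof.
move=> [mf [C fC]]; split; last by exists C.
by apply: measurableT_comp.
Qed.

Lemma bmf_slice2 d d' (X : measurableType d) (Y : measurableType d')
  (f : X * Y -> R) y : bmf f -> bmf (fun x => f (x, y)).
Proof.
move=> [mf [C fC]]; split; last by exists C.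
by apply: measurableT_comp.
Qed.

Section integral.
Context d (X : measurableType d) (mu : {finite_measure set X -> \bar R}).
Implicit Types f g : X -> R.

Lemma bmf_integrable f : bmf f -> mu.-integrable setT (EFin \o f).
Proof.
move=> [mf [C fC]]; apply: (@le_integrable _ _ _ mu setT measurableT _ (cst C%:E)).
- exact/measurable_EFinP.
- move=> x _ /=; rewrite lee_fin.
  exact: le_trans (fC x) (ler_norm _).
- by apply: finite_measure_integrable_cst.
Qed.

Lemma bmf_integralE f : bmf f ->
  (\int[mu]_x (f x)%:E)%E = (\int[mu]_x f x)%:E.
Proof.
move=> bf; rewrite /Rintegral fineK//; apply: integrable_fin_num => //.
exact: bmf_integrable.
Qed.

Lemma bmf_RintegralD f g : bmf f -> bmf g ->
  \int[mu]_x (f x + g x) = \int[mu]_x f x + \int[mu]_x g x.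
Proof. by move=> bf bg; rewrite RintegralD//; exact: bmf_integrable. Qed.

Lemma bmf_RintegralZ (c : R) f : bmf f ->
  \int[mu]_x (c * f x) = c * \int[mu]_x f x.
Proof. by move=> bf; rewrite RintegralZl//; exact: bmf_integrable. Qed.

Lemma bmf_RintegralZr (c : R) f : bmf f ->
  \int[mu]_x (f x * c) = (\int[mu]_x f x) * c.
Proof. by move=> bf; rewrite RintegralZr//; exact: bmf_integrable. Qed.

Lemma bmf_RintegralN f : bmf f ->
  \int[mu]_x (- f x) = - \int[mu]_x f x.
Proof.
move=> bf; rewrite -mulN1r -bmf_RintegralZ//.
by apply: eq_Rintegral => x _; rewrite mulN1r.
Qed.

Lemma bmf_RintegralB f g : bmf f -> bmf g ->
  \int[mu]_x (f x - g x) = \int[mu]_x f x - \int[mu]_x g x.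
Proof. by move=> bf bg; rewrite RintegralB//; exact: bmf_integrable. Qed.

Lemma Rintegral0 : \int[mu]_x (0 : R) = 0.
Proof. by rewrite Rintegral_cst// mul0r. Qed.

Lemma bmf_Rintegral_sum (I : Type) (s : seq I) (F : I -> X -> R) :
  (forall i, bmf (F i)) ->
  \int[mu]_x (\sum_(i <- s) F i x) = \sum_(i <- s) \int[mu]_x F i x.
Proof.
move=> bF; elim: s => [|i s IHs].
  rewrite big_nil -[RHS]Rintegral0; apply: eq_Rintegral => x _.
  by rewrite big_nil.
rewrite big_cons -IHs -bmf_RintegralD//; last exact: bmf_sum.
by apply: eq_Rintegral => x _; rewrite big_cons.
Qed.

Lemma bmf_le_Rintegral f g : bmf f -> bmf g -> (forall x, f x <= g x) ->
  \int[mu]_x f x <= \int[mu]_x g x.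
Proof. by move=> bf bg fg; apply: le_Rintegral => //; exact: bmf_integrable. Qed.

Lemma bmf_le_Rintegral_ae f g : bmf f -> bmf g ->
  {ae mu, forall x, f x <= g x} -> \int[mu]_x f x <= \int[mu]_x g x.
Proof.
move=> bf bg fg.
(* [f + |g - f|] dominates [f] everywhere and equals [g] almost everywhere. *)
rewrite (@Rintegral_ae _ _ _ _ g (fun x => f x + `|g x - f x|)); last first.
  by apply: filterS fg => x fg; rewrite ger0_norm ?subr_ge0// addrC subrK.
have b : bmf (fun x => `|g x - f x|) by apply: bmf_abs; exact: bmfB.
by rewrite bmf_RintegralD// lerDl Rintegral_ge0.
Qed.

Lemma bmf_Rintegral_eq0 f : bmf f -> (forall x, 0 <= f x) ->
  \int[mu]_x f x <= 0 -> {ae mu, forall x, f x = 0}.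
Proof.
move=> bf f0 If; have {}If : \int[mu]_x f x = 0.
  by apply/eqP; rewrite eq_le If Rintegral_ge0.
have : (\int[mu]_(x in setT) `|(f x)%:E| = 0)%E.
  under eq_integral do rewrite /= ger0_norm//.
  by rewrite bmf_integralE// If.
have mf : measurable_fun setT (EFin \o f) by apply/measurable_EFinP; case: bf.
move/(ae_eq_integral_abs mu measurableT mf) => [N [mN N0 sN]].
exists N; split => // x /= fx; apply: sN => /= fx0; apply: fx.
apply: EFin_inj; exact: fx0.
Qed.

End integral.

Section fubini.
Context d d' (X : measurableType d) (Y : measurableType d').
Variables (m1 : {finite_measure set X -> \bar R}).
Variables (m2 : {finite_measure set Y -> \bar R}).
Variable f : X * Y -> R.
Hypothesis bf : bmf f.

Let fin : (m1 \x m2)%E.-integrable setT (EFin \o f).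
Proof.
have [mf [C fC]] := bf.
apply: (@le_integrable _ _ _ (m1 \x m2)%E setT measurableT _ (cst C%:E)).
- exact/measurable_EFinP.
- move=> x _ /=; rewrite lee_fin; exact: le_trans (fC x) (ler_norm _).
- apply/integrableP; split; first exact: measurable_cst.
  have mfin : ((m1 \x m2) setT)%E \is a fin_num.
    have m1fin : fin_num_fun m1 by move=> A mA; exact: fin_num_measure.
    exact: (fin_num_product m2 m1fin).
  rewrite (@integral_cst _ _ _ (m1 \x m2)%E setT measurableT `|C|%:E).
  by apply: lte_mul_pinfty => //; move: mfin => /fin_numPlt/andP[].
Qed.

Lemma bmf_fubini1 : bmf (fun x => \int[m2]_y f (x, y)).
Proof.
have [mf [C fC]] := bf; split.
  apply: (@measurableT_comp _ _ _ _ _ _ fine); first exact: fine_measurable.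
  exact: (measurable_fubini_F fin).
exists (C * fine (m2 setT)) => x.
have bfx : bmf (fun y => f (x, y)) by exact: bmf_slice.
rewrite (le_trans (le_normr_Rintegral _ (bmf_integrable m2 bfx)))//.
rewrite -Rintegral_cst//; apply: bmf_le_Rintegral => //; first exact: bmf_abs.
exact: bmf_cst.
Qed.

Lemma bmf_Rintegral_prod :
  \int[(m1 \x m2)%E]_z f z = \int[m1]_x \int[m2]_y f (x, y).
Proof.
rewrite /Rintegral -(integral12_prod_meas1 fin); congr fine.
by apply: eq_integral => x _; rewrite /= -bmf_integralE//; exact: bmf_slice.
Qed.

Lemma bmf_Rintegral_prod2 :
  \int[(m1 \x m2)%E]_z f z = \int[m2]_y \int[m1]_x f (x, y).
Proof.
rewrite /Rintegral -(integral21_prod_meas1 fin); congr fine.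
apply: eq_integral => y _; rewrite /= -bmf_integralE//.
exact: bmf_slice2.
Qed.

End fubini.

Lemma bmf_measurable_comp d d' (X : measurableType d) (Y : measurableType d')
  (f : Y -> R) (h : X -> Y) :
  bmf f -> measurable_fun setT h -> bmf (fun x => f (h x)).
Proof.
move=> [mf [C fC]] mh; split; last by exists C.
exact: measurableT_comp.
Qed.

Lemma bmf_dcvg d (X : measurableType d) (mu : {finite_measure set X -> \bar R})
    (f_ : (X -> R)^nat) (f : X -> R) (C : R) :
  (forall n, measurable_fun setT (f_ n)) -> measurable_fun setT f ->
  (forall n x, `|f_ n x| <= C) -> (forall x, f_ n x @[n --> \oo] --> f x) ->
  \int[mu]_x f_ n x @[n --> \oo] --> \int[mu]_x f x.
Proof.
move=> mf_ mf fC f_f.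
have fCl x : `|f x| <= C.
  have : `|f_ n x| @[n --> \oo] --> `|f x| by apply: cvg_norm.
  by move/(@cvg_lim _ _ ) <- => //; apply: limr_le; [apply/cvg_ex; eexists;
    apply: cvg_norm; exact: f_f|apply: nearW].
have [] := @dominated_convergence _ _ _ mu setT measurableT
  (fun n => EFin \o f_ n) (EFin \o f) (cst C%:E).
- by move=> n; exact/measurable_EFinP.
- exact/measurable_EFinP.
- by apply: ae_all => x _; apply: cvg_EFin; [exact: nearW|exact: f_f].
- exact: finite_measure_integrable_cst.
- by apply: ae_all => x n _; rewrite lee_fin.
move=> _ _; rewrite /= bmf_integralE; last by split => //; exists C.
move=> /fine_cvgP[_]; apply: cvg_trans.
by apply: near_eq_cvg; apply: nearW => n /=.
Qed.

End Bmf.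

(** * Smooth periodic functions on the slab *)

Section CkTheory.
Context {R : realType}.

(** The two difference quotients are the same function of [h]. Derivatives thus pass between a
    function, its restrictions to lines, its slices and its constant extensions, although the spaces
    differ. *)
Lemma is_derive_transport (V V' W : normedModType R) (f : V -> W) (g : V' -> W)
    (a v : V) (b w : V') (df : W) :
  (forall h : R, f (h *: v + a) = g (h *: w + b)) ->
  is_derive a v f df -> is_derive b w g df.
Proof.
move=> fg.
have E : (fun h : R => h^-1 *: ((f \o shift a) (h *: v) - f a)) =
         (fun h : R => h^-1 *: ((g \o shift b) (h *: w) - g b)).
  apply/funext => h /=; rewrite fg; congr (_ *: (_ - _)).
  by have := fg 0; rewrite !scale0r !add0r.
move=> [ex de]; split; first by rewrite /derivable -E.
by rewrite /derive -E.
Qed.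

Variable V : normedModType R.
Implicit Types (E : set V) (u w : V -> R).

Lemma Ck_cont E k u : Ck E k u -> {within E, continuous u}.
Proof. by case: k => [|k] []. Qed.

Lemma CkS E k u : Ck E k.+1 u -> Ck E k u.
Proof.
elim: k u => [|k IHk] u [cu du]; first by split.
split => // v; have [g [Ckg dg]] := du v; exists g; split => //; exact: IHk.
Qed.

Lemma Ck_eq E k u w : (forall z, E z -> u z = w z) -> Ck E k u -> Ck E k w.
Proof.
move=> uw; have cuw : {within E, continuous u} -> {within E, continuous w}.
  by apply: subspace_eq_continuous => z /set_mem; exact: uw.
case: k => [|k] [cu du]; split => //; [exact: cuw|exact: cuw|].
move=> v; have [g [Ckg dg]] := du v; exists g; split => // z Ez.
apply: near_eq_is_derive (dg z Ez).
by apply: filterS Ez => y /uw.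
Qed.

Lemma Ck_cst E k (c : R) : Ck E k (fun=> c).
Proof.
elim: k c => [|k IHk] c; split => //; try exact: cst_continuous.
move=> v; exists (fun=> 0); split; first exact: IHk.
by move=> z _; exact: is_derive_cst.
Qed.

Lemma CkD E k u w : Ck E k u -> Ck E k w -> Ck E k (fun z => u z + w z).
Proof.
elim: k u w => [|k IHk] u w [cu du] [cw dw]; split => //;
  try by move=> z; apply: cvgD; [exact: cu|exact: cw].
move=> v; have [g [Ckg dg]] := du v; have [h [Ckh dh]] := dw v.
exists (fun z => g z + h z); split; first exact: IHk.
by move=> z Ez; apply: is_deriveD; [exact: dg|exact: dh].
Qed.

Lemma CkM E k u w : Ck E k u -> Ck E k w -> Ck E k (fun z => u z * w z).
Proof.
elim: k u w => [|k IHk] u w uk wk; split => //;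
  try by move=> z; apply: cvgM; [exact: (Ck_cont uk)|exact: (Ck_cont wk)].
move=> v; have [g [Ckg dg]] := uk.2 v; have [h [Ckh dh]] := wk.2 v.
exists (fun z => u z * h z + w z * g z); split.
  by apply: CkD; apply: IHk => //; exact: CkS.
by move=> z Ez; apply: is_deriveM; [exact: dg|exact: dh].
Qed.

Lemma CkN E k u : Ck E k u -> Ck E k (fun z => - u z).
Proof.
move=> uk; apply: (@Ck_eq _ _ (fun z => (-1) * u z)) => [z _|].
  by rewrite mulN1r.
by apply: CkM => //; exact: Ck_cst.
Qed.

Lemma CkV E k u : (forall z, E z -> u z != 0) -> Ck E k u ->
  Ck E k (fun z => (u z)^-1).
Proof.
move=> u0; elim: k u u0 => [|k IHk] u u0 uk.
  split => //; apply/subspace_continuousP => z Ez.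
  by apply: cvgV; [exact: u0|exact: (subspace_continuousP _ _).1 (Ck_cont uk) z Ez].
split.
  apply/subspace_continuousP => z Ez.
  by apply: cvgV; [exact: u0|exact: (subspace_continuousP _ _).1 (Ck_cont uk) z Ez].
move=> v; have [g [Ckg dg]] := uk.2 v.
exists (fun z => (- ((u z)^-1 * (u z)^-1)) * g z); split.
  apply: CkM => //; apply: CkN; apply: CkM; apply: IHk => //; exact: CkS.
move=> z Ez.
have uz0 : u z != 0 by apply: u0; exact: interior_subset Ez.
have [ez dz] := dg z Ez.
split; first exact: derivableV.
by rewrite deriveV// dz; congr (_ *: _); rewrite expr2 invfM.
Qed.

End CkTheory.

Section Clamp.
Context {R : realType}.
Notation R3 := (R * R * R)%type.
Variable T : R.
Hypothesis T_gt0 : 0 < T.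

(** Nearest point of [[0, T]]. Composing with it extends a function on the slab continuously to all
    times and singles out one representative of each such function. *)
Definition clampt (t : R) : R := Num.max 0 (Num.min t T).
Definition clampz (z : R * R3) : R * R3 := (clampt z.1, z.2).

Lemma clampt_in t : 0 <= clampt t <= T.
Proof.
by rewrite /clampt le_max lexx/= ge_max (ltW T_gt0) ge_min lexx orbT.
Qed.

Lemma clampt_id t : 0 <= t <= T -> clampt t = t.
Proof. by move=> /andP[t0 tT]; rewrite /clampt min_l// max_r. Qed.

Lemma clampz_in z : slab T (clampz z).
Proof. exact: clampt_in. Qed.

Lemma clampz_id z : slab T z -> clampz z = z.
Proof. by case: z => t x /= tT; rewrite /clampz clampt_id. Qed.

Lemma clampzK z : clampz (clampz z) = clampz z.
Proof. by rewrite clampz_id//; exact: clampz_in. Qed.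

Lemma clampt_continuous : continuous clampt.
Proof.
move=> t; apply: (@continuous_max _ _ (fun=> 0) (fun s => Num.min s T)).
  exact: cvg_cst.
by apply: (@continuous_min _ _ id (fun=> T)) => //; exact: cvg_cst.
Qed.

Lemma clampz_continuous : continuous clampz.
Proof.
move=> z; apply: (@cvg_pair _ _ _ _ (nbhs (clampz z).1) (nbhs (clampz z).2)).
  apply: cvg_comp; last exact: clampt_continuous.
  exact: cvg_fst.
exact: cvg_snd.
Qed.

Lemma clamp_cont (u : R * R3 -> R) :
  {within slab T, continuous u} -> continuous (u \o clampz).
Proof.
move=> /subspace_continuousP cu z.
apply: cvg_comp (cu _ (clampz_in z)).
move=> A /= wA.
have : nbhs z (fun y => slab T (clampz y) -> A (clampz y)).
  exact: clampz_continuous wA.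
by apply: filterS => y; apply; exact: clampz_in.
Qed.

Lemma interior_slab_nbhs (z : R * R3) : 0 < z.1 < T ->
  nbhs z (fun y : R * R3 => 0 < y.1 < T).
Proof.
move=> /andP[z0 zT].
have : nbhs z.1 (fun t => 0 < t < T).
  have : nbhs z.1 `]0, T[%classic.
    by apply: open_nbhs_nbhs; split; [exact: interval_open|rewrite /= in_itv/= z0].
  by apply: filterS => t /=; rewrite in_itv.
exact: (@cvg_fst _ _ (nbhs z.1) (nbhs z.2)).
Qed.

Lemma slab_interior (z : R * R3) : 0 < z.1 < T -> (slab T)^° z.
Proof.
move=> /interior_slab_nbhs; rewrite /interior.
by apply: filterS => y /andP[y0 yT]; rewrite /slab/= (ltW y0) (ltW yT).
Qed.

(* The interior of the slab is dense in it. *)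
Lemma clamp_dense (u w : R * R3 -> R) : continuous u -> continuous w ->
  (forall z, u z = u (clampz z)) -> (forall z, w z = w (clampz z)) ->
  (forall t x, 0 < t < T -> u (t, x) = w (t, x)) -> u =1 w.
Proof.
move=> cu cw uc wc uw z; rewrite uc wc; move: (clampz_in z).
case: (clampz z) => t x; rewrite /slab/= => /andP[t0 tT].
(* A convex combination of [t] and the midpoint [T / 2]: interior even if [t] is an endpoint, and
   tending to [t]. *)
pose s (n : nat) : R := t + n.+1%:R^-1 * (T / 2 - t) / 2.
have s_in n : 0 < s n < T.
  rewrite /s; have a0 : 0 < (n.+1%:R^-1 : R) by rewrite invr_gt0.
  have a1 : (n.+1%:R^-1 : R) <= 1 by rewrite invf_le1// ler1n.
  move: a0 a1; set a := _^-1 => a0 a1.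
  have h1 : 0 < a * T by rewrite mulr_gt0.
  have h2 : 0 <= t * (1 - a / 2) by rewrite mulr_ge0//; lra.
  have h3 : 0 <= (T - t) * (1 - a / 2) by rewrite mulr_ge0//; lra.
  by apply/andP; split; lra.
have s_cvg : (s n, x) @[n --> \oo] --> (t, x).
  apply: (@cvg_pair _ _ _ _ (nbhs t) (nbhs x)); last exact: cvg_cst.
  suff : s n @[n --> \oo] --> t + 0 * (T / 2 - t) / 2 by rewrite !mul0r addr0.
  apply: cvgD; first exact: cvg_cst.
  apply: cvgM; last exact: cvg_cst.
  by apply: cvgM; [exact: cvg_harmonic|exact: cvg_cst].
have cu' := cvg_comp _ _ s_cvg (cu (t, x)).
have cw' := cvg_comp _ _ s_cvg (cw (t, x)).
apply: (cvg_unique _ cu'); rewrite // (_ : _ \o _ = w \o (fun n => (s n, x)))//.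
by apply/funext => n /=; exact: uw.
Qed.

End Clamp.

Section SmoothFunctions.
Context {R : realType}.
Notation ST := (R * (R * R * R))%type.
Variable Tp : {posnum R}.
Local Notation T := (Tp%:num).
Let T_gt0 : 0 < T. Proof. by []. Qed.

Lemma smooth_eq (u w : ST -> R) : (forall z, slab T z -> u z = w z) ->
  smooth (slab T) u -> smooth (slab T) w.
Proof. by move=> uw su k; exact: Ck_eq (su k). Qed.

Lemma smooth_spacetime_eq (u w : ST -> R) : (forall z, slab T z -> u z = w z) ->
  smooth_spacetime T u -> smooth_spacetime T w.
Proof.
move=> uw [su pu]; split; first exact: smooth_eq su.
by move=> i t x tT; rewrite -!uw//; exact: pu.
Qed.

Lemma slabW (z : ST) : 0 < z.1 < T -> slab T z.
Proof. by rewrite /slab/= => /andP[/ltW-> /ltW->]. Qed.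

(* On the interior of the slab the derivative is determined, so the derivatives
   provided by [Ck] for the various orders coincide. *)
Lemma smooth_derivative (u : ST -> R) (v : ST) : smooth_spacetime T u ->
  exists g, smooth_spacetime T g /\
    forall z, 0 < z.1 < T -> is_derive z v u (g z).
Proof.
move=> [su pu]; have [g [cg dg]] := (su 1%N).2 v.
have dgi z : 0 < z.1 < T -> is_derive z v u (g z).
  by move=> zT; apply: dg; exact: slab_interior.
have cgc := clamp_cont T_gt0 (Ck_cont (cg : Ck (slab T) 0 g)).
exists g; split=> //; split.
  move=> k; have [h [ch dh]] := (su k.+1).2 v.
  apply: (Ck_eq _ ch) => z zT.
  have := @clamp_dense _ _ T_gt0 (h \o clampz T) (g \o clampz T)
    (clamp_cont T_gt0 (Ck_cont ch)) cgc.
  move=> /(_ _ _ _ z) /=; rewrite (clampz_id zT); apply.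
  - by move=> y; rewrite clampzK.
  - by move=> y; rewrite clampzK.
  - move=> t x tT /=; rewrite clampz_id; last exact: slabW.
    have [_ <-] := dgi (t, x) tT.
    by have [_ <-] := dh (t, x) (slab_interior (z := (t, x)) tT).
(* Periodicity of [g]: at interior times [g] is a genuine derivative and inherits it from [u];
   density carries it to the times [0] and [T]. *)
move=> i t x tT.
pose sh (z : ST) : ST := (z.1, z.2 + Defs.basis i).
have csh : continuous sh.
  have -> : sh = (fun z => z + (0, Defs.basis i)).
    by apply/funext => -[a b]; rewrite /sh; congr pair; rewrite /= addr0.
  by move=> z; apply: cvgD; [exact: cvg_id|exact: cvg_cst].
have clt s : clampt T (clampt T s) = clampt T s.
  by rewrite clampt_id//; exact: clampt_in.
have := @clamp_dense _ _ T_gt0 ((g \o clampz T) \o sh) (g \o clampz T).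
move=> /(_ _ cgc _ _ _ (t, x)) /=.
rewrite /clampz/= (clampt_id tT); apply.
- by move=> z; apply: cvg_comp; [exact: csh|exact: cgc].
- by move=> z /=; rewrite clt.
- by move=> z /=; rewrite clt.
move=> s y sT /=.
have sT' : 0 <= s <= T by move/andP: sT => [/ltW-> /ltW->].
rewrite (clampt_id sT').
have [_ <-] := dgi (s, y) sT.
have [_ <-] := dgi (s, y + Defs.basis i) sT.
pose u' z := u (sh z).
have -> : 'D_v u (s, y + Defs.basis i) = 'D_v u' (s, y).
  rewrite /derive; suff -> : (fun h : R =>
      h^-1 *: ((u \o shift (s, y + Defs.basis i)) (h *: v) - u (s, y + Defs.basis i))) =
    (fun h => h^-1 *: ((u' \o shift (s, y)) (h *: v) - u' (s, y))) by [].
  apply/funext => h; rewrite /u' /sh /=; congr (_ *: (u _ - u _)).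
  by congr pair; rewrite /= addrA.
apply: near_eq_derive; have := slab_interior (z := (s, y)) sT.
by apply: filterS => -[s' y'] /= sl; exact: pu.
Qed.

(** The field [smf_clamp] makes the values off the slab redundant, so that functions agreeing at
    interior times are equal. Smooth space-time functions then form a commutative ring with total
    derivations, and long identities can be left to [ring]. *)
Record smf := Smf {
  smf_val :> ST -> R;
  smf_smooth : smooth_spacetime T smf_val;
  smf_clamp : forall z, smf_val z = smf_val (clampz T z) }.

Lemma smf_eq (u w : smf) : (forall z, u z = w z) -> u = w.
Proof.
case: u => u su cu; case: w => w sw cw /= /funext uw; subst w.
by rewrite (Prop_irrelevance su sw) (Prop_irrelevance cu cw).
Qed.

Lemma mk_smf_subproof (u : ST -> R) : smooth_spacetime T u ->
  smooth_spacetime T (u \o clampz T).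
Proof.
by move=> su; apply: smooth_spacetime_eq su => z /= /clampz_id ->.
Qed.

Definition mk_smf (u : ST -> R) (su : smooth_spacetime T u) : smf :=
  @Smf (u \o clampz T) (mk_smf_subproof su)
    (fun z => congr1 u (esym (clampzK T_gt0 z))).

Lemma mk_smfE u (su : smooth_spacetime T u) z : slab T z -> mk_smf su z = u z.
Proof. by move=> zT; rewrite /= clampz_id. Qed.

Lemma smf_continuous (u : smf) : continuous u.
Proof.
have : continuous (u \o clampz T).
  by apply: clamp_cont => //; exact: Ck_cont ((smf_smooth u).1 0%N).
suff -> : u \o clampz T = u by [].
by apply/funext => z /=; rewrite -smf_clamp.
Qed.

Lemma smf_ext (u w : smf) :
  (forall t x, 0 < t < T -> u (t, x) = w (t, x)) -> u = w.
Proof.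
move=> uw; apply: smf_eq.
apply: (clamp_dense T_gt0) => //; [exact: smf_continuous|exact: smf_continuous|
  exact: smf_clamp|exact: smf_clamp].
Qed.

(** A derivative is determined at interior times only; elsewhere this is its continuous extension,
    unique by density. It can be iterated and commuted without side conditions on time. *)
Definition smf_D (v : ST) (u : smf) : smf :=
  mk_smf (projT2 (cid (smooth_derivative v (smf_smooth u)))).1.

Lemma smf_is_derive (v : ST) (u : smf) z : 0 < z.1 < T ->
  is_derive z v u (smf_D v u z).
Proof.
move=> zT; rewrite mk_smfE; last exact: slabW.
exact: (projT2 (cid (smooth_derivative v (smf_smooth u)))).2.
Qed.

Lemma smf_DP (v : ST) (u w : smf) :
  (forall z, 0 < z.1 < T -> is_derive z v u (w z)) -> smf_D v u = w.
Proof.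
move=> uw; apply: smf_ext => t x tT.
have [_ <-] := uw (t, x) tT.
by have [_ <-] := smf_is_derive v u (z := (t, x)) tT.
Qed.

Lemma smf_periodic (u : smf) t x i : u (t, x + Defs.basis i) = u (t, x).
Proof.
rewrite smf_clamp [RHS]smf_clamp /clampz/=.
by apply: (smf_smooth u).2; exact: clampt_in.
Qed.

Lemma smf_cst_subproof (c : R) : smooth_spacetime T (fun=> c).
Proof. by split => // k; exact: Ck_cst. Qed.

Definition smf_cst (c : R) : smf := @Smf (fun=> c) (smf_cst_subproof c) (fun=> erefl).

Lemma smf_add_subproof (u w : smf) : smooth_spacetime T (fun z => u z + w z).
Proof.
split; last by move=> i t x tT; rewrite !smf_periodic.
by move=> k; apply: CkD; [exact: (smf_smooth u).1|exact: (smf_smooth w).1].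
Qed.

Definition smf_add (u w : smf) : smf := @Smf (fun z => u z + w z)
  (smf_add_subproof u w) (fun z => congr2 _ (smf_clamp u z) (smf_clamp w z)).

Lemma smf_mul_subproof (u w : smf) : smooth_spacetime T (fun z => u z * w z).
Proof.
split; last by move=> i t x tT; rewrite !smf_periodic.
by move=> k; apply: CkM; [exact: (smf_smooth u).1|exact: (smf_smooth w).1].
Qed.

Definition smf_mul (u w : smf) : smf := @Smf (fun z => u z * w z)
  (smf_mul_subproof u w) (fun z => congr2 _ (smf_clamp u z) (smf_clamp w z)).

Lemma smf_opp_subproof (u : smf) : smooth_spacetime T (fun z => - u z).
Proof.
split; last by move=> i t x tT; rewrite !smf_periodic.
by move=> k; apply: CkN; exact: (smf_smooth u).1.
Qed.

Definition smf_opp (u : smf) : smf := @Smf (fun z => - u z)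
  (smf_opp_subproof u) (fun z => congr1 _ (smf_clamp u z)).

Lemma smf_inv_subproof (u : smf) : (forall z, slab T z -> u z != 0) ->
  smooth_spacetime T (fun z => (u z)^-1).
Proof.
move=> u0; split; last by move=> i t x tT; rewrite !smf_periodic.
by move=> k; apply: CkV => //; exact: (smf_smooth u).1.
Qed.

Definition smf_inv (u : smf) (u0 : forall z, slab T z -> u z != 0) : smf :=
  @Smf (fun z => (u z)^-1) (smf_inv_subproof u0)
    (fun z => congr1 _ (smf_clamp u z)).

HB.instance Definition _ := gen_eqMixin smf.
HB.instance Definition _ := gen_choiceMixin smf.

Lemma smf_addA : associative smf_add.
Proof. by move=> u v w; apply: smf_eq => z /=; rewrite addrA. Qed.
Lemma smf_addC : commutative smf_add.
Proof. by move=> u v; apply: smf_eq => z /=; rewrite addrC. Qed.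
Lemma smf_add0 : left_id (smf_cst 0) smf_add.
Proof. by move=> u; apply: smf_eq => z /=; rewrite add0r. Qed.
Lemma smf_addN : left_inverse (smf_cst 0) smf_opp smf_add.
Proof. by move=> u; apply: smf_eq => z /=; rewrite addNr. Qed.

HB.instance Definition _ :=
  GRing.isZmodule.Build smf smf_addA smf_addC smf_add0 smf_addN.

Lemma smf_mulA : associative smf_mul.
Proof. by move=> u v w; apply: smf_eq => z /=; rewrite mulrA. Qed.
Lemma smf_mulC : commutative smf_mul.
Proof. by move=> u v; apply: smf_eq => z /=; rewrite mulrC. Qed.
Lemma smf_mul1 : left_id (smf_cst 1) smf_mul.
Proof. by move=> u; apply: smf_eq => z /=; rewrite mul1r. Qed.
Lemma smf_mulDl : left_distributive smf_mul smf_add.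
Proof. by move=> u v w; apply: smf_eq => z /=; rewrite mulrDl. Qed.
Lemma smf_1neq0 : smf_cst 1 != 0.
Proof.
apply/eqP => /(congr1 (fun u : smf => u (0, (0, 0, 0)))) /= /eqP.
by rewrite oner_eq0.
Qed.

HB.instance Definition _ := GRing.Zmodule_isComNzRing.Build smf
  smf_mulA smf_mulC smf_mul1 smf_mulDl smf_1neq0.

End SmoothFunctions.

Arguments smf_D : simpl never.

Lemma MVT_closed (R : realType) (f df : R -> R) (a b : R) : a < b ->
  (forall x, a <= x <= b -> is_derive x (1 : R) f (df x)) ->
  exists2 c, a <= c <= b & f b - f a = df c * (b - a).
Proof.
move=> ab fd.
have fd1 (x : R) : x \in `]a, b[ -> is_derive x (1 : R) f (df x).
  by rewrite in_itv/= => /andP[ax xb]; apply: fd; rewrite !ltW.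
have fd2 : {within `[a, b], continuous f}.
  apply: derivable_within_continuous => x; rewrite in_itv/= => xab.
  by have [] := fd x xab.
have [c + fc] := MVT ab fd1 fd2.
by rewrite in_itv/= => /andP[ac cb]; exists c => //; rewrite !ltW.
Qed.

(** * Differential calculus in the ring of smooth periodic functions *)

Section SmfCalculus.
Context {R : realType}.
Notation ST := (R * (R * R * R))%type.
Variable Tp : {posnum R}.
Local Notation T := (Tp%:num).
Notation smf := (smf Tp).
Notation D := (@smf_D _ Tp).
Implicit Types u w : smf.

Lemma smfDE u w z : (u + w) z = u z + w z. Proof. by []. Qed.
Lemma smfME u w z : (u * w) z = u z * w z. Proof. by []. Qed.
Lemma smfNE u z : (- u) z = - u z. Proof. by []. Qed.
Lemma smfBE u w z : (u - w) z = u z - w z. Proof. by []. Qed.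
Lemma smf0E z : (0 : smf) z = 0. Proof. by []. Qed.
Lemma smf_sumE (I : Type) (s : seq I) (F : I -> smf) z :
  (\sum_(i <- s) F i) z = \sum_(i <- s) F i z.
Proof.
elim: s => [|i s IHs]; first by rewrite !big_nil.
by rewrite !big_cons smfDE IHs.
Qed.

Lemma smfXE u n z : (u ^+ n) z = u z ^+ n.
Proof. by elim: n => [|n IHn] //; rewrite !exprS smfME IHn. Qed.

Lemma smf_DD v u w : D v (u + w) = D v u + D v w.
Proof.
apply: smf_DP => z zT.
by apply: is_deriveD; exact: smf_is_derive.
Qed.

Lemma smf_DM v u w : D v (u * w) = D v u * w + u * D v w.
Proof.
apply: smf_DP => z zT; rewrite smfDE !smfME addrC [D v u z * _]mulrC.
by apply: is_deriveM; exact: smf_is_derive.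
Qed.

Lemma smf_Dcst v c : D v (smf_cst Tp c) = 0.
Proof. by apply: smf_DP => z zT; exact: is_derive_cst. Qed.

Lemma smf_D0 v : D v 0 = 0.
Proof. exact: smf_Dcst. Qed.

Lemma smf_DN v u : D v (- u) = - D v u.
Proof. by apply/eqP; rewrite -addr_eq0 -smf_DD addNr smf_D0. Qed.

Lemma smf_DB v u w : D v (u - w) = D v u - D v w.
Proof. by rewrite smf_DD smf_DN. Qed.

Lemma smf_Dsum v (I : Type) (s : seq I) (F : I -> smf) :
  D v (\sum_(i <- s) F i) = \sum_(i <- s) D v (F i).
Proof.
elim: s => [|i s IHs]; first by rewrite !big_nil smf_D0.
by rewrite !big_cons smf_DD IHs.
Qed.

Lemma smf_DZ v c u : D v (smf_cst Tp c * u) = smf_cst Tp c * D v u.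
Proof. by rewrite smf_DM smf_Dcst mul0r add0r. Qed.

Lemma smf_D2 v u : D v (u ^+ 2) = (u * D v u) *+ 2.
Proof. by rewrite expr2 smf_DM mulr2n [D v u * _]mulrC. Qed.

Lemma smf_derive v u z : 0 < z.1 < T -> 'D_v u z = D v u z.
Proof. by move=> zT; have [_ ->] := smf_is_derive v u zT. Qed.

Lemma smf_line_is_derive v u (z0 : ST) (s : R) :
  0 < (s *: v + z0).1 < T ->
  is_derive s 1 (fun s => u (s *: v + z0)) (D v u (s *: v + z0)).
Proof.
move=> sT; have := smf_is_derive v u sT.
apply: is_derive_transport => h.
by congr (u _); rewrite scalerDl addrA [_ *: 1]mulr1.
Qed.

(* Schwarz: both mixed second differences equal the increment of u over a
   small parallelogram, by the mean value theorem. *)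
Lemma smf_mixed_difference (v w : ST) u (z : ST) (h : R) : 0 < h ->
  (forall a b : R, 0 <= a <= h -> 0 <= b <= h ->
    0 < (z + a *: v + b *: w).1 < T) ->
  exists a b, [/\ 0 <= a <= h, 0 <= b <= h &
    u (z + h *: v + h *: w) - u (z + h *: v) - u (z + h *: w) + u z =
    h ^+ 2 * D w (D v u) (z + a *: v + b *: w)].
Proof.
move=> h0 zT.
pose f (s : R) := u (s *: v + (z + h *: w)) - u (s *: v + z).
pose df (s : R) := D v u (s *: v + (z + h *: w)) - D v u (s *: v + z).
have e1 s : s *: v + (z + h *: w) = z + s *: v + h *: w.
  by rewrite addrA [s *: v + z]addrC.
have e2 s : s *: v + z = z + s *: v + 0 *: w by rewrite scale0r addr0 addrC.
have hh : 0 <= h <= h by rewrite lexx ltW.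
have h00 : 0 <= (0:R) <= h by rewrite lexx ltW.
have [s sh|a ah fa] := @MVT_closed _ f df 0 h h0.
  apply: is_deriveB; apply: smf_line_is_derive.
    by rewrite e1; exact: zT.
  by rewrite e2; exact: zT.
pose g (s : R) := D v u (s *: w + (z + a *: v)).
have e3 s : s *: w + (z + a *: v) = z + a *: v + s *: w by rewrite addrC.
have [s sh|b bh gb] := @MVT_closed _ g
    (fun s => D w (D v u) (s *: w + (z + a *: v))) 0 h h0.
  by apply: smf_line_is_derive; rewrite e3; exact: zT.
exists a, b; split => //.
move: fa gb; rewrite subr0 => fa gb.
rewrite expr2 -mulrA [h * D _ _ _]mulrC -e3 -gb.
have -> : g h - g 0 = df a.
  by rewrite /g /df !e3 e1 scale0r addr0 [a *: v + z]addrC.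
rewrite mulrC -fa /f !e1 !scale0r !add0r addr0 [h *: v + z]addrC.
by ring.
Qed.

(** The same second difference is [h ^ 2] times either mixed derivative, each taken at some point of
    a parallelogram of size [h]. Continuity of both derivatives identifies them at the corner as [h]
    shrinks. *)
Lemma smf_DC (v w : ST) u : D v (D w u) = D w (D v u).
Proof.
apply: smf_ext => // t x tT.
set z := (t, x).
suff near_eq : forall e : R, 0 < e -> `|D v (D w u) z - D w (D v u) z| < e.
  apply/eqP; rewrite -subr_eq0 -normr_le0 leNgt; apply/negP => d0.
  by have := near_eq _ d0; rewrite ltxx.
move=> e e0.
pose q (ab : R * R) : ST := z + ab.1 *: v + ab.2 *: w.
have cq : continuous q.
  move=> ab; apply: cvgD; first apply: cvgD; first exact: cvg_cst.
    by apply: cvgZ; [exact: cvg_fst|exact: cvg_cst].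
  by apply: cvgZ; [exact: cvg_snd|exact: cvg_cst].
have q0 : q (0, 0) = z by rewrite /q !scale0r !addr0.
have P1 : nbhs ((0, 0) : R * R) (fun ab => 0 < (q ab).1 < T).
  have : nbhs z (fun y : ST => 0 < y.1 < T) by exact: interior_slab_nbhs.
  rewrite -q0; exact: cq.
pose F (x y : ST) (ab : R * R) := D x (D y u) (q ab).
have P2 (v' w' : ST) : nbhs ((0, 0) : R * R) (fun ab => `|F v' w' ab - D v' (D w' u) z| < e / 2).
  have : F v' w' @ ((0, 0) : R * R) --> D v' (D w' u) z.
    rewrite -q0; apply: cvg_comp; [exact: cq|exact: smf_continuous].
  move/cvgrPdist_lt => /(_ (e / 2)); rewrite divr_gt0// => /(_ isT).
  by apply: filterS => ab; rewrite distrC.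
have [dl dl0 Pdl] : exists2 dl : R, 0 < dl & forall ab : R * R, `|ab.1| < dl -> `|ab.2| < dl ->
    [/\ 0 < (q ab).1 < T, `|F v w ab - D v (D w u) z| < e / 2 &
      `|F w v ab - D w (D v u) z| < e / 2].
  have : nbhs ((0, 0) : R * R) (fun ab => [/\ 0 < (q ab).1 < T,
      `|F v w ab - D v (D w u) z| < e / 2 & `|F w v ab - D w (D v u) z| < e / 2]).
    by apply: filterS3 P1 (P2 v w) (P2 w v).
  move=> /nbhs_ballP[dl /= dl0 Pdl]; exists dl => // -[a b] /= al bl.
  by apply: (Pdl (a, b)); split; rewrite /ball/= sub0r normrN.
have dl2 : 0 < dl / 2 by rewrite divr_gt0.
have small a : 0 <= a <= dl / 2 -> `|a| < dl.
  by move=> /andP[a0 al]; rewrite ger0_norm// (le_lt_trans al)// ltr_pdivrMr// ltr_pMr// ltr1n.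
have [a1 b1|a [b [ah bh E1]]] := @smf_mixed_difference v w u z _ dl2.
  by move=> /small a1l /small b1l; have [] := Pdl (a1, b1) a1l b1l.
have [a1 b1|a' [b' [ah' bh' E2]]] := @smf_mixed_difference w v u z _ dl2.
  move=> /small a1l /small b1l; have [] := Pdl (b1, a1) b1l a1l.
  by rewrite /q/= addrAC.
have [_ _ H1] := Pdl (a, b) (small _ ah) (small _ bh).
have [_ H2 _] := Pdl (b', a') (small _ bh') (small _ ah').
have h20 : (dl / 2) ^+ 2 != 0 by rewrite expf_eq0/= gt_eqF.
have E : F w v (a, b) = F v w (b', a').
  apply: (mulfI h20); rewrite /F /q/= -E1 [z + b' *: v + _]addrAC -E2.
  by rewrite [z + _ + dl / 2 *: v]addrAC; ring.
rewrite (_ : _ - _ = (F w v (a, b) - D w (D v u) z) - (F v w (b', a') - D v (D w u) z)).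
  by rewrite (le_lt_trans (ler_normB _ _))// [ltRHS]splitr ltrD.
by rewrite E; ring.
Qed.

Lemma smf_slice_Ck u (t : R) k : 0 < t < T -> Ck setT k (fun x => u (t, x)).
Proof.
move=> tT; elim: k u => [|k IHk] u; split => //;
  try by apply: continuous_subspaceT => x; apply: cvg_comp; [|exact: smf_continuous];
    apply: (@cvg_pair _ _ _ _ (nbhs t) (nbhs x)); [exact: cvg_cst|exact: cvg_id].
move=> v; exists (fun x => D (0, v) u (t, x)); split; first exact: IHk.
move=> x _; have := smf_is_derive (0, v) u (z := (t, x)) tT.
apply: is_derive_transport => h; congr (u _).
by congr pair; rewrite /= scaler0 add0r.
Qed.

Lemma smf_slice u (t : R) : 0 < t < T -> smooth_torus (fun x => u (t, x)).
Proof.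
by move=> tT; split; [move=> k; exact: smf_slice_Ck|move=> i x; exact: smf_periodic].
Qed.

Lemma smf_slice_derive u (t : R) v x : 0 < t < T ->
  'D_v (fun x => u (t, x)) x = D (0, v) u (t, x).
Proof.
move=> tT; have := smf_is_derive (0, v) u (z := (t, x)) tT.
move=> /(@is_derive_transport _ _ _ _ u (fun x => u (t, x)) _ _ x v).
move=> /(_ _) [|_ ->//] h; congr (u _).
by congr pair; rewrite /= scaler0 add0r.
Qed.

End SmfCalculus.

(** * Integrals over the torus *)

Section CountableBase.

(** With the measurable sets for [M], every open set is a countable union of measurable boxes. This
    links the product topology with the product sigma-algebra and makes continuous space-time
    functions measurable. *)
Definition countable_base (X : topologicalType) (M : set (set X)) : Prop :=
  exists b : nat -> set X, (forall n, M (b n)) /\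
    forall x (U : set X), nbhs x U -> exists n, b n x /\ b n `<=` U.

Lemma countable_base_prod (X Y : topologicalType) (M : set (set X)) (N : set (set Y)) :
  countable_base M -> countable_base N ->
  countable_base [set C : set (X * Y)%type | exists A B, [/\ M A, N B & C = A `*` B]].
Proof.
move=> [b [Mb bU]] [c [Nc cU]].
pose e n : nat * nat := odflt (0, 0)%N (choice.unpickle n).
exists (fun n => b (e n).1 `*` c (e n).2); split.
  by move=> n; exists (b (e n).1), (c (e n).2).
move=> [x y] U [[P Q] /= [xP yQ] PQU].
have [i [bx bP]] := bU x P xP; have [j [cy cQ]] := cU y Q yQ.
exists (choice.pickle (i, j)); rewrite /e choice.pickleK/=; split => //.
by move=> [x' y'] [/= /bP ? /cQ ?]; apply: PQU.
Qed.

Lemma countable_base_R (R : realType) :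
  countable_base (fun A : set R => measurable (A : set (measurableTypeR R))).
Proof.
pose e n : rat * rat := odflt (0, 0) (choice.unpickle n).
exists (fun n => `]ratr (e n).1, ratr (e n).2[%classic); split.
  by move=> n; exact: measurable_itv.
move=> x U /nbhs_ballP[r /= r0 xU].
have [p] := @rat_in_itvoo R (x - r) x ltac:(by rewrite ltrBlDr ltrDl).
rewrite in_itv/= => /andP[rp px].
have [q] := @rat_in_itvoo R x (x + r) ltac:(by rewrite ltrDl).
rewrite in_itv/= => /andP[xq qr].
exists (choice.pickle (p, q)); rewrite /e choice.pickleK/=; split; first by rewrite in_itv/= px.
move=> y /=; rewrite in_itv/= => /andP[py yq]; apply: xU.
rewrite /ball/= ltr_distlC; apply/andP; split.
  by rewrite (lt_trans _ py).
by rewrite (lt_trans yq).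
Qed.

End CountableBase.

Section BorelSpacetime.
Context {R : realType}.
Notation X1 := (measurableTypeR R).
Notation X3 := (X1 * X1 * X1)%type.
Notation X4 := (X1 * X3)%type.

Lemma countable_base_spacetime :
  countable_base (fun A : set (R * (R * R * R)) => measurable (A : set X4)).
Proof.
have b1 := @countable_base_R R.
have [b [Mb bU]] := countable_base_prod b1 (countable_base_prod (countable_base_prod b1 b1) b1).
exists b; split => // n.
have [A [B [mA [B1 [B2 [[C1 [C2 [mC1 mC2 ->]]] mB2 ->]]] ->]]] := Mb n.
by do 3! apply: measurableX => //.
Qed.

Lemma continuous_measurable_spacetime (f : R * (R * R * R) -> R) :
  continuous f -> measurable_fun setT (f : X4 -> X1).
Proof.
move=> cf; have [b [Mb bU]] := countable_base_spacetime.
apply: (measurability _ (RGenOInfty.measurableE R)) => //.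
move=> _ [_ [r ->] <-]; rewrite setTI.
have -> : f @^-1` `]r, +oo[%classic =
    \bigcup_n (if `[< b n `<=` f @^-1` `]r, +oo[%classic >] then b n else set0).
  apply/seteqP; split => [z fz|z [n _]]; last by case: asboolP => // + bz; apply.
  have : nbhs z (f @^-1` `]r, +oo[%classic).
    by apply: cf; apply: open_nbhs_nbhs; split => //; exact: interval_open.
  move=> /bU[n [bz bsub]]; exists n => //.
  by case: asboolP.
apply: bigcup_measurable => n _.
case: asboolP => _ //; exact: Mb.
Qed.

End BorelSpacetime.

Section SquareMeasure.
Context {R : realType}.

(** The two-dimensional factor of [torus_measure], named in order to carry a finite measure
    structure in iterated integrals. *)
Definition square_measure : set (measurableTypeR R * measurableTypeR R) -> \bar R :=
  (itv_measure 0 1 \x itv_measure 0 1)%E.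

HB.instance Definition _ := Measure.on square_measure.

Lemma fin_num_square : fin_num_fun square_measure.
Proof. by apply: fin_num_product; apply: fin_num_measure. Qed.

HB.instance Definition _ :=
  Measure_isFinite.Build _ _ _ square_measure fin_num_square.

End SquareMeasure.

Lemma Rintegral_eq0_fun (R : realType) d (X : measurableType d)
    (mu : {measure set X -> \bar R}) (f : X -> R) :
  (forall x, f x = 0) -> \int[mu]_x f x = 0.
Proof.
move=> f0; rewrite (@eq_Rintegral _ _ _ mu setT (fun=> 0)) => [|x _]; last exact: f0.
by rewrite /Rintegral integral0.
Qed.

(** * Bounds, integration by parts and time derivatives of integrals over the torus *)

Section SmfIntegral.
Context {R : realType}.
Variable Tp : {posnum R}.
Local Notation T := (Tp%:num).
Let T_gt0 : 0 < T. Proof. by []. Qed.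
Notation smf := (smf Tp).
Notation D := (@smf_D _ Tp).
Notation X1 := (measurableTypeR R).
Notation X3 := (X1 * X1 * X1)%type.
Notation X4 := (X1 * X3)%type.
Notation torus := (@torus_measure R).
Implicit Types u w : smf.

Lemma periodic_floor (f : R -> R) : (forall s, f (s + 1) = f s) ->
  forall s, f s = f (s - (Num.floor s)%:~R).
Proof.
move=> pf.
have pn (n : nat) s : f (s + n%:R) = f s.
  by elim: n s => [|n IHn] s; rewrite ?addr0// -natr1 addrA pf IHn.
have pz (k : int) s : f (s - k%:~R) = f s.
  case: k => n; first by rewrite -[in RHS](subrK n%:R s) pn.
  by rewrite NegzE mulrNz opprK pn.
by move=> s; rewrite pz.
Qed.

Lemma basisE (a b c : R) (i : 'I_3) : (a, b, c) + Defs.basis i =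
  (a + (i == 0 :> nat)%:R, b + (i == 1 :> nat)%:R, c + (i == 2 :> nat)%:R).
Proof. by []. Qed.

Lemma scale_basisE (s a b c : R) (i : 'I_3) : s *: Defs.basis i + (a, b, c) =
  (s * (i == 0 :> nat)%:R + a, s * (i == 1 :> nat)%:R + b,
   s * (i == 2 :> nat)%:R + c).
Proof. by []. Qed.

(** Clamping the time and removing the integer parts of the coordinates change no value and bring
    every point into the compact set [Q]. *)
Lemma smf_bounded u : exists C, forall z, `|u z| <= C.
Proof.
pose Q := `[0, T]%classic `*` (`[0, 1]%classic `*` `[0, 1]%classic `*` `[0, 1]%classic)
  : set (R * (R * R * R)).
have cQ : compact Q.
  have cI a b : compact (`[a, b]%classic : set R) by exact: segment_compact.
  have c2 := compact_setX (cI 0 1) (cI 0 1).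
  have c3 := compact_setX c2 (cI 0 1).
  exact: (compact_setX (cI 0 T) c3).
have Q0 : Q !=set0.
  by exists (0, (0, 0, 0)); rewrite /Q /=; rewrite !in_itv/= !lexx ltW ?ler01.
have cu : {within Q, continuous (fun z => `|u z|)}.
  apply: continuous_subspaceT => z; apply: cvg_norm; exact: smf_continuous.
have [c cQ' uc] := compact_EVT_max Q0 cQ cu.
exists `|u c| => -[t [[x1 x2] x3]].
rewrite smf_clamp /clampz/=.
set t' := clampt T t.
have h0 s1 s2 s3 : u (t', (s1 + 1, s2, s3)) = u (t', (s1, s2, s3)).
  by rewrite -[RHS](smf_periodic _ _ _ 0) basisE/= !addr0.
have h1 s1 s2 s3 : u (t', (s1, s2 + 1, s3)) = u (t', (s1, s2, s3)).
  by rewrite -[RHS](smf_periodic _ _ _ 1) basisE/= !addr0.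
have h2 s1 s2 s3 : u (t', (s1, s2, s3 + 1)) = u (t', (s1, s2, s3)).
  by rewrite -[RHS](smf_periodic _ _ _ 2) basisE/= !addr0.
rewrite (@periodic_floor (fun s => u (t', (s, x2, x3))))//.
rewrite (@periodic_floor (fun s => u (t', (_, s, x3))))//.
rewrite (@periodic_floor (fun s => u (t', (_, _, s))))//.
have fl (s : R) : 0 <= s - (Num.floor s)%:~R <= 1.
  by rewrite subr_ge0 floor_le_tmp/= lerBlDl ltW// -intrD1 floorD1_gt.
apply: uc; rewrite inE /Q/=; rewrite !in_itv/= !fl; split => //.
exact: clampt_in.
Qed.

Lemma smf_bmf u : bmf (u : X4 -> R).
Proof.
split; last exact: smf_bounded.
by apply: continuous_measurable_spacetime; exact: smf_continuous.
Qed.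

Lemma smf_bmf_slice u t : bmf (fun x : X3 => u (t, x)).
Proof. exact: (bmf_slice t (smf_bmf u)). Qed.

Lemma FTC_itv (F f : R -> R) (a b : R) : a <= b -> continuous F -> continuous f ->
  (forall s, a < s < b -> is_derive s (1 : R) F (f s)) ->
  \int[itv_measure a b]_s f s = F b - F a.
Proof.
rewrite le_eqVlt => /predU1P[-> _ _ _|ab cF cf dF].
  rewrite Rintegral_itv_measure subrr set_itv1 Rintegral_set1//.
rewrite Rintegral_itv_measure /Rintegral.
rewrite (@continuous_FTC2 _ f F a b)//.
- exact: continuous_subspaceT.
- split.
  + by move=> s; rewrite in_itv/= => /dF[].
  + exact: cvg_at_right_filter (cF a).
  + exact: cvg_at_left_filter (cF b).
- move=> s; rewrite in_itv/= => /dF[_ ds].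
  by rewrite derive1E ds.
Qed.

Notation iv := (@itv_measure R 0 1).
Notation sq := (@square_measure R).

(** The three orders of integration put each coordinate innermost once, as [smf_line_integral]
    requires. *)
Lemma torus_Fubini1 (f : X3 -> R) : bmf f -> \int[torus]_x f x =
  \int[iv]_c \int[iv]_b \int[iv]_a f (a, b, c).
Proof.
move=> bf; transitivity (\int[iv]_c \int[sq]_ab f (ab, c)).
  exact: (bmf_Rintegral_prod2 sq iv bf).
by apply: eq_Rintegral => c _; exact: (bmf_Rintegral_prod2 iv iv (bmf_slice2 c bf)).
Qed.

Lemma torus_Fubini2 (f : X3 -> R) : bmf f -> \int[torus]_x f x =
  \int[iv]_c \int[iv]_a \int[iv]_b f (a, b, c).
Proof.
move=> bf; transitivity (\int[iv]_c \int[sq]_ab f (ab, c)).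
  exact: (bmf_Rintegral_prod2 sq iv bf).
by apply: eq_Rintegral => c _; exact: (bmf_Rintegral_prod iv iv (bmf_slice2 c bf)).
Qed.

Lemma torus_Fubini3 (f : X3 -> R) : bmf f -> \int[torus]_x f x =
  \int[sq]_ab \int[iv]_c f (ab, c).
Proof. by move=> bf; exact: (bmf_Rintegral_prod sq iv bf). Qed.

(** Over one period in direction [i] the fundamental theorem of calculus leaves the difference of
    two equal values. *)
Lemma smf_line_integral u (g : R -> R * R * R) (t : R) (i : 'I_3) :
  0 < t < T -> (forall s, g s = s *: Defs.basis i + g 0) -> 
  \int[iv]_s D (0, Defs.basis i) u (t, g s) = 0.
Proof.
move=> tT gE.
have tgE s : (t, g s) = s *: (0, Defs.basis i) + (t, g 0) :> R * (R * R * R).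
  by rewrite gE; congr pair; rewrite /= scaler0 add0r.
have cg : continuous (fun s => (t, g s) : R * (R * R * R)).
  have -> : (fun s => (t, g s) : R * (R * R * R)) =
      (fun s => s *: (0, Defs.basis i) + (t, g 0)) by apply/funext => s; rewrite tgE.
  by move=> s; apply: cvgD; [apply: cvgZ; [exact: cvg_id|exact: cvg_cst]|exact: cvg_cst].
transitivity (u (t, g 1) - u (t, g 0)); first apply: (@FTC_itv (fun s => u (t, g s)))=> //.
- by move=> s; apply: cvg_comp; [exact: cg|exact: smf_continuous].
- by move=> s; apply: cvg_comp; [exact: cg|exact: smf_continuous].
- move=> s _.
  have := @smf_line_is_derive _ Tp (0, Defs.basis i) u (t, g 0) s.
  rewrite -tgE => /(_ tT); congr (is_derive _ _ _ _).
  by apply/funext => r; rewrite -tgE.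
- have -> : g 1 = g 0 + Defs.basis i by rewrite (gE 1) scale1r addrC.
  by rewrite smf_periodic subrr.
Qed.

Let smf_int_dx_interior u (i : 'I_3) t : 0 < t < T ->
  \int[torus]_x D (0, Defs.basis i) u (t, x) = 0.
Proof.
move=> tT; have bD := smf_bmf_slice (D (0, Defs.basis i) u) t.
case: i bD => -[|[|[|//]]] Hi bD.
- rewrite torus_Fubini1//; apply: Rintegral_eq0_fun => c; apply: Rintegral_eq0_fun => b.
  apply: (@smf_line_integral u (fun s => (s, b, c))) => // s.
  by rewrite scale_basisE/= mulr1 !mulr0 addr0 !add0r.
- rewrite torus_Fubini2//; apply: Rintegral_eq0_fun => c; apply: Rintegral_eq0_fun => a.
  apply: (@smf_line_integral u (fun s => (a, s, c))) => // s.
  by rewrite scale_basisE/= mulr1 !mulr0 addr0 !add0r.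
- rewrite torus_Fubini3//; apply: Rintegral_eq0_fun => -[a b].
  apply: (@smf_line_integral u (fun s => (a, b, s))) => // s.
  by rewrite scale_basisE/= mulr1 !mulr0 addr0 !add0r.
Qed.

(** Dominated convergence with [C * |f|]. Integrability of [f] is all that is asked, because [f]
    will also be an arbitrary L^2 test function from [Cweak]. *)
Lemma int_mul_continuous u (f : X3 -> R) : torus.-integrable setT (EFin \o f) ->
  continuous (fun t => \int[torus]_x (u (t, x) * f x)).
Proof.
move=> If t.
have [C uC] := smf_bounded u.
have mf : measurable_fun setT f by apply/measurable_EFinP; case/integrableP: If.
have ms s : measurable_fun setT (fun x => u (s, x) * f x).
  by apply: measurable_funM => //; case: (smf_bmf_slice u s).
have IC : torus.-integrable setT (EFin \o (fun x => C * `|f x|)).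
  rewrite (_ : EFin \o _ = (fun x => C%:E * `|(EFin \o f) x|)%E).
    by apply: integrableZl => //; exact: integrable_abse.
  by apply/funext => x /=; rewrite EFinM.
have le s x : `|u (s, x) * f x| <= C * `|f x| by rewrite normrM ler_wpM2r.
apply: (@continuity_under_integral R _ X3 torus (fun t x => u (t, x) * f x) setT
  measurableT (t - 1) (t + 1) _ _ (fun x => C * `|f x|) IC _ t).
- move=> s _; apply: (le_integrable measurableT _ _ IC); first by apply/measurable_EFinP; exact: ms.
  move=> x _ /=; rewrite lee_fin (le_trans (le s x))// ler_norm//.
- apply: ae_all => x _ s _; apply: cvgM; last exact: cvg_cst.
  apply: (@cvg_comp _ _ _ (fun s => (s, x)) u); last exact: smf_continuous.
  by apply: (@cvg_pair _ _ _ _ (nbhs s) (nbhs x)); [exact: cvg_id|exact: cvg_cst].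
- by move=> s _; apply: ae_all.
- by rewrite inE/= in_itv/= ltrBlDr !ltrDl ltr01.
Qed.

Lemma smf_int_continuous u : continuous (fun t => \int[torus]_x u (t, x)).
Proof.
have := @int_mul_continuous u (fun=> 1) (bmf_integrable torus (bmf_cst _ _)).
suff -> : (fun t => \int[torus]_x (u (t, x) * 1)) = (fun t => \int[torus]_x u (t, x)) by [].
by apply/funext => t; apply: eq_Rintegral => x _; rewrite mulr1.
Qed.

(* An identity between time-continuous quantities depending on [t] through
   [clampt] extends from interior times to all times. *)
Lemma interior_times_dense (f g : R -> R) : continuous f -> continuous g ->
  (forall t, f t = f (clampt T t)) -> (forall t, g t = g (clampt T t)) ->
  (forall t, 0 < t < T -> f t = g t) -> f =1 g.
Proof.
move=> cf cg fc gc fg t.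
have := @clamp_dense _ _ T_gt0 (fun z => f z.1) (fun z => g z.1).
move=> /(_ _ _ _ _ _ (t, (0, 0, 0))); apply.
- by move=> z; apply: cvg_comp; [exact: cvg_fst|exact: cf].
- by move=> z; apply: cvg_comp; [exact: cvg_fst|exact: cg].
- by move=> z; rewrite fc.
- by move=> z; rewrite gc.
- by move=> s x; exact: fg.
Qed.

Lemma smf_int_clamp u t : \int[torus]_x u (t, x) = \int[torus]_x u (clampt T t, x).
Proof. by apply: eq_Rintegral => x _; rewrite smf_clamp. Qed.

Lemma smf_int_dx u (i : 'I_3) t : \int[torus]_x D (0, Defs.basis i) u (t, x) = 0.
Proof.
apply: (@interior_times_dense (fun t => \int[torus]_x D (0, Defs.basis i) u (t, x)) (fun=> 0)).
- exact: smf_int_continuous.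
- by move=> s; exact: cvg_cst.
- by move=> s; exact: smf_int_clamp.
- by [].
- by move=> s sT; exact: smf_int_dx_interior.
Qed.

Lemma smf_int_parts u w (i : 'I_3) t :
  \int[torus]_x (D (0, Defs.basis i) u (t, x) * w (t, x)) =
  - \int[torus]_x (u (t, x) * D (0, Defs.basis i) w (t, x)).
Proof.
have := smf_int_dx (u * w) i t.
under eq_Rintegral do rewrite smf_DM smfDE !smfME.
rewrite bmf_RintegralD; last 2 first.
- by apply: bmfM; exact: smf_bmf_slice.
- by apply: bmfM; exact: smf_bmf_slice.
by move/eqP; rewrite addr_eq0 => /eqP.
Qed.

Lemma itv_torus_swap (f : X4 -> R) (a b : R) : bmf f ->
  \int[itv_measure a b]_t \int[torus]_x f (t, x) =
  \int[torus]_x \int[itv_measure a b]_t f (t, x).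
Proof.
move=> bf; rewrite -(bmf_Rintegral_prod _ _ bf).
exact: (bmf_Rintegral_prod2 _ _ bf).
Qed.

Lemma smf_int_dt u (tau : R) : 0 <= tau <= T ->
  \int[torus]_x u (tau, x) - \int[torus]_x u (0, x) =
  \int[itv_measure 0 tau]_t \int[torus]_x D (1, 0) u (t, x).
Proof.
move=> /andP[tau0 tauT]; rewrite itv_torus_swap; last exact: smf_bmf.
rewrite -bmf_RintegralB; [|exact: smf_bmf_slice|exact: smf_bmf_slice].
apply: eq_Rintegral => x _; apply/esym; apply: (@FTC_itv (fun s => u (s, x))) => //.
- move=> s; apply: (@cvg_comp _ _ _ (fun s => (s, x)) u); last exact: smf_continuous.
  by apply: (@cvg_pair _ _ _ _ (nbhs s) (nbhs x)); [exact: cvg_id|exact: cvg_cst].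
- move=> s; apply: (@cvg_comp _ _ _ (fun s => (s, x)) (D (1, 0) u)); last exact: smf_continuous.
  by apply: (@cvg_pair _ _ _ _ (nbhs s) (nbhs x)); [exact: cvg_id|exact: cvg_cst].
- move=> s /andP[s0 st].
  have sT : 0 < (s, x).1 < T by rewrite s0 (lt_le_trans st).
  have := smf_is_derive (1, 0) u sT.
  apply: is_derive_transport => h; congr (u _).
  by congr pair; rewrite /= ?scaler0 ?add0r.
Qed.

End SmfIntegral.

(** * Mollification *)

Section Trig.
Context {R : realType}.
Notation R3 := (R * R * R)%type.

Definition crd (i : 'I_3) (x : R3) : R := nth 0 [:: x.1.1; x.1.2; x.2] i.

Lemma crdD i x y : crd i (x + y) = crd i x + crd i y.
Proof. by case: i => -[|[|[|//]]]. Qed.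

Lemma crdZ i (h : R) x : crd i (h *: x) = h * crd i x.
Proof. by case: i => -[|[|[|//]]]. Qed.

Lemma crd_basis i j : crd i (Defs.basis j) = (i == j)%:R.
Proof. by case: i => -[|[|[|//]]] Hi; case: j => -[|[|[|//]]] Hj. Qed.

Lemma crd_continuous i : continuous (crd i).
Proof.
case: i => -[|[|[|//]]] Hi x; rewrite /crd/=.
- by apply: (@cvg_comp _ _ _ fst fst); exact: cvg_fst.
- by apply: (@cvg_comp _ _ _ fst snd); [exact: cvg_fst|exact: cvg_snd].
- exact: cvg_snd.
Qed.

Lemma is_derive_cos_line (c d s : R) :
  is_derive s 1 (fun s => cos (c * s + d)) (- c * sin (c * s + d)).
Proof.
have dl : is_derive s 1 (fun s => c * s + d) c.
  by apply: is_derive_eq; rewrite addr0 [_ *: _]mulr1.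
by apply: is_derive_eq (is_derive1_comp _ dl) _; rewrite mulrC mulrN mulNr.
Qed.

Lemma is_derive_sin_line (c d s : R) :
  is_derive s 1 (fun s => sin (c * s + d)) (c * cos (c * s + d)).
Proof.
have dl : is_derive s 1 (fun s => c * s + d) c.
  by apply: is_derive_eq; rewrite addr0 [_ *: _]mulr1.
by apply: is_derive_eq (is_derive1_comp _ dl) _; rewrite mulrC.
Qed.

Definition cs (i : 'I_3) (x : R3) : R := cos (2 * pi * crd i x).
Definition sn (i : 'I_3) (x : R3) : R := sin (2 * pi * crd i x).

Lemma cs_is_derive i (z v : R * R3) : is_derive z v (fun z : R * R3 => cs i z.2)
  (- (2 * pi * crd i v.2) * sn i z.2).
Proof.
have := is_derive_cos_line (2 * pi * crd i v.2) (2 * pi * crd i z.2) 0.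
rewrite mulr0 add0r; apply: is_derive_transport => h.
by rewrite /cs /= crdD crdZ [h *: 1]mulr1 addr0; congr cos; ring.
Qed.

Lemma sn_is_derive i (z v : R * R3) : is_derive z v (fun z : R * R3 => sn i z.2)
  ((2 * pi * crd i v.2) * cs i z.2).
Proof.
have := is_derive_sin_line (2 * pi * crd i v.2) (2 * pi * crd i z.2) 0.
rewrite mulr0 add0r; apply: is_derive_transport => h.
by rewrite /sn /= crdD crdZ [h *: 1]mulr1 addr0; congr sin; ring.
Qed.

Lemma cs_continuous i : continuous (fun z : R * R3 => cs i z.2).
Proof.
move=> z; apply: (@cvg_comp _ _ _ (fun z : R * R3 => 2 * pi * crd i z.2) cos);
  last exact: continuous_cos.
apply: cvgM; first exact: cvg_cst.
by apply: cvg_comp; [exact: cvg_snd|exact: crd_continuous].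
Qed.

Lemma sn_continuous i : continuous (fun z : R * R3 => sn i z.2).
Proof.
move=> z; apply: (@cvg_comp _ _ _ (fun z : R * R3 => 2 * pi * crd i z.2) sin);
  last exact: continuous_sin.
apply: cvgM; first exact: cvg_cst.
by apply: cvg_comp; [exact: cvg_snd|exact: crd_continuous].
Qed.

(** One induction for both, since differentiation exchanges sine and cosine. *)
Lemma trig_Ck (E : set (R * R3)) i k :
  Ck E k (fun z : R * R3 => cs i z.2) /\ Ck E k (fun z : R * R3 => sn i z.2).
Proof.
elim: k => [|k [IHc IHs]].
  by split; split => //; apply: continuous_subspaceT; [exact: cs_continuous|exact: sn_continuous].
split; split; try by apply: continuous_subspaceT; [exact: cs_continuous || exact: sn_continuous].
- move=> v; exists (fun z => - (2 * pi * crd i v.2) * sn i z.2); split.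
    by apply: CkM => //; exact: Ck_cst.
  by move=> z _; exact: cs_is_derive.
- move=> v; exists (fun z => (2 * pi * crd i v.2) * cs i z.2); split.
    by apply: CkM => //; exact: Ck_cst.
  by move=> z _; exact: sn_is_derive.
Qed.

Lemma cs_periodic i j x : cs i (x + Defs.basis j) = cs i x.
Proof.
rewrite /cs crdD crd_basis; case: (i == j); last by rewrite addr0.
by rewrite mulrDr mulr1 mulr_natl cosD cos2pi sin2pi mulr1 mulr0 subr0.
Qed.

Lemma sn_periodic i j x : sn i (x + Defs.basis j) = sn i x.
Proof.
rewrite /sn crdD crd_basis; case: (i == j); last by rewrite addr0.
by rewrite mulrDr mulr1 mulr_natl sinD cos2pi sin2pi mulr1 mulr0 addr0.
Qed.

End Trig.

(** * Wallis integrals and the mollifying kernels *)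

Section TrigSmf.
Context {R : realType}.
Variable Tp : {posnum R}.
Local Notation T := (Tp%:num).
Notation smf := (smf Tp).
Notation D := (@smf_D _ Tp).
Notation Dx i := (smf_D (0, Defs.basis i)).
Notation cst := (smf_cst Tp).
Notation R3 := (R * R * R)%type.
Notation X1 := (measurableTypeR R).
Notation X3 := (X1 * X1 * X1)%type.
Notation torus := (@torus_measure R).

Lemma cs_smooth i : smooth_spacetime T (fun z : R * R3 => cs i z.2).
Proof.
split; first by move=> k; exact: (trig_Ck _ _ _).1.
by move=> j t x _; exact: cs_periodic.
Qed.

Lemma sn_smooth i : smooth_spacetime T (fun z : R * R3 => sn i z.2).
Proof.
split; first by move=> k; exact: (trig_Ck _ _ _).2.
by move=> j t x _; exact: sn_periodic.
Qed.

Definition smf_cs i : smf := Smf (cs_smooth i) (fun=> erefl).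
Definition smf_sn i : smf := Smf (sn_smooth i) (fun=> erefl).

Lemma smf_Dcs i j : Dx j (smf_cs i) = cst (- (2 * pi * (i == j)%:R)) * smf_sn i.
Proof. by apply: smf_DP => z _; rewrite -crd_basis; exact: cs_is_derive. Qed.

Lemma smf_Dsn i j : Dx j (smf_sn i) = cst (2 * pi * (i == j)%:R) * smf_cs i.
Proof. by apply: smf_DP => z _; rewrite -crd_basis; exact: sn_is_derive. Qed.

(* (1 + cos 2pi(x_i - y_i)) / 2 and sin 2pi(x_i - y_i), as functions of x *)
Definition kC i (y : R3) : smf :=
  cst (2^-1) * (1 + cst (cs i y) * smf_cs i + cst (sn i y) * smf_sn i).
Definition kS i (y : R3) : smf := cst (cs i y) * smf_sn i - cst (sn i y) * smf_cs i.

Lemma kC_E i y z : kC i y z = 2^-1 * (1 + cos (2 * pi * crd i z.2 - 2 * pi * crd i y)).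
Proof. by rewrite cosB /kC /= /cs /sn; ring. Qed.

Lemma kS_E i y z : kS i y z = sin (2 * pi * crd i z.2 - 2 * pi * crd i y).
Proof. by rewrite sinB /kS /= /cs /sn; ring. Qed.

Lemma kC_bounds i y z : 0 <= kC i y z <= 1.
Proof.
rewrite kC_E; set a := _ - _.
have := cos_geN1 a; have := cos_le1 a => h1 h2.
by apply/andP; split; lra.
Qed.

Lemma kC_sym i t s x y : kC i y (t, x) = kC i x (s, y).
Proof. by rewrite !kC_E/= -[in RHS]cosN opprB. Qed.

Lemma kS_sym i t s x y : kS i y (t, x) = - kS i x (s, y).
Proof. by rewrite !kS_E/= -sinN opprB. Qed.

Lemma smf_natE n (z : R * R3) : (n%:R : smf) z = n%:R.
Proof. by elim: n => [|n IHn] //; rewrite -!natr1 smfDE IHn. Qed.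

Lemma smf_mulrnE (u : smf) n z : (u *+ n) z = u z *+ n.
Proof. by elim: n => [|n IHn] //; rewrite !mulrS smfDE IHn. Qed.

Lemma kS2 i y : kS i y ^+ 2 = 4 * (kC i y * (1 - kC i y)).
Proof.
apply: smf_eq => z.
have -> : (4 * (kC i y * (1 - kC i y))) z = 4 * (kC i y z * (1 - kC i y z)).
  by rewrite -[4 in RHS](smf_natE 4 z).
rewrite smfXE kS_E kC_E; set a := _ - _.
have h := cos2Dsin2 a.
have -> : sin a ^+ 2 = 1 - cos a ^+ 2 by lra.
by field.
Qed.

Lemma smf_DkC i j y : Dx j (kC i y) = cst (- (pi * (i == j)%:R)) * kS i y.
Proof.
rewrite /kC smf_DZ !smf_DD (_ : 1 = cst 1)// smf_Dcst !smf_DZ smf_Dcs smf_Dsn.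
by apply: smf_eq => z; rewrite /kS /=; field.
Qed.

Lemma smf_DkS i j y : Dx j (kS i y) = cst (2 * pi * (i == j)%:R) * (2 * kC i y - 1).
Proof.
rewrite /kS smf_DB !smf_DZ smf_Dcs smf_Dsn.
apply: smf_eq => z; rewrite /kC /=.
by field.
Qed.

Lemma smf_DX v (u : smf) n : D v (u ^+ n) = (u ^+ n.-1 * D v u) *+ n.
Proof.
elim: n => [|n IHn]; first by rewrite expr0 mulr0n (_ : 1 = cst 1)// smf_Dcst.
rewrite exprS smf_DM IHn /=; case: n {IHn} => [|n].
  by rewrite !expr0 mulr0n mulr0 addr0 mulr1n mulr1 mul1r.
by rewrite /= mulrnAr mulrA -exprS [D v u * _]mulrC -mulrS.
Qed.

(* Wallis recursion: integrate the derivative of [kS * kC ^ n]. *)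
Lemma wallis_step i y (w : smf) n t : Dx i w = 0 ->
  \int[torus]_x (kC i y ^+ n.+1 * w) (t, x) =
  (n.*2.+1%:R / n.*2.+2%:R) * \int[torus]_x (kC i y ^+ n * w) (t, x).
Proof.
move=> Dw.
(* The product rule produces [kS ^ 2 * kC ^ (n - 1)]; [kS2] trades [kS ^ 2] for [4 kC (1 - kC)], and
   only the powers [n] and [n + 1] of [kC] remain. *)
have E : Dx i (kS i y * kC i y ^+ n * w) =
    cst pi * (cst n.*2.+2%:R * 2 * (kC i y ^+ n.+1 * w)
              - cst (2 * n.*2.+1%:R) * (kC i y ^+ n * w)).
  have e2 : n.*2.+2%:R = 2 * n%:R + 2 :> R by rewrite -mul2n -!natr1 natrM; ring.
  have e1 : n.*2.+1%:R = 2 * n%:R + 1 :> R by rewrite -mul2n -!natr1 natrM; ring.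
  rewrite 2!smf_DM Dw mulr0 addr0 smf_DX smf_DkC smf_DkS.
  have -> : kS i y * (kC i y ^+ n.-1 * (cst (- (pi * (i == i)%:R)) * kS i y) *+ n) =
      cst (- pi * n%:R * 4) * (1 - kC i y) * kC i y ^+ n.
    rewrite eqxx mulr1; case: n {e1 e2} => [|n].
      by apply: smf_eq => z; rewrite mulr0n mulr0 mulr0 mul0r /=; ring.
    transitivity (cst (- pi) * (kS i y ^+ 2) * kC i y ^+ n *+ n.+1).
      by rewrite /= -!mulrnAr; ring.
    rewrite kS2 exprS; apply: smf_eq => z; rewrite smf_mulrnE /=.
    by ring.
  rewrite eqxx e1 e2; apply: smf_eq => z.
  by rewrite exprS /=; ring.
have b m : bmf (fun x : X3 => (kC i y ^+ m * w) (t, x)) by exact: smf_bmf_slice.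
have := smf_int_dx (kS i y * kC i y ^+ n * w) i t.
rewrite E.
under eq_Rintegral => x _.
  have -> : (cst pi * (cst n.*2.+2%:R * 2 * (kC i y ^+ n.+1 * w)
              - cst (2 * n.*2.+1%:R) * (kC i y ^+ n * w))) (t, x) =
    2 * pi * n.*2.+2%:R * (kC i y ^+ n.+1 * w) (t, x) - 2 * pi * n.*2.+1%:R * (kC i y ^+ n * w) (t, x).
    by rewrite /=; ring.
  over.
rewrite bmf_RintegralB ?bmf_RintegralZ//; try by apply: bmfM => //; exact: bmf_cst.
have p0 : (pi : R) != 0 by rewrite gt_eqF// pi_gt0.
have n0 : (n.*2.+2%:R : R) != 0 by rewrite pnatr_eq0.
move=> H; apply: (@mulfI _ (2 * pi * n.*2.+2%:R)); first by rewrite !mulf_neq0.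
by move/eqP: H; rewrite subr_eq0 => /eqP ->; field.
Qed.

(** The mean of [cos (pi s) ^ (2 n)] over a period, that is [binom(2n, n) / 4 ^ n]: each [kC] is the
    square of the cosine of half the angle. *)
Definition wallis (n : nat) : R := \prod_(k < n) (k.*2.+1%:R / k.*2.+2%:R).

Lemma wallis_gt0 n : 0 < wallis n.
Proof. by apply: prodr_gt0 => k _; rewrite divr_gt0// ltr0n. Qed.

Lemma wallis_int i y (w : smf) n t : Dx i w = 0 ->
  \int[torus]_x (kC i y ^+ n * w) (t, x) = wallis n * \int[torus]_x w (t, x).
Proof.
move=> Dw; elim: n => [|n IHn].
  have -> : kC i y ^+ 0 * w = w by rewrite expr0 mul1r.
  by rewrite /wallis big_ord0 mul1r.
by rewrite wallis_step// IHn /wallis big_ord_recr/=; ring.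
Qed.

Definition i0 : 'I_3 := ord0.
Definition i1 : 'I_3 := lift ord0 ord0.
Definition i2 : 'I_3 := ord_max.

Definition kern n (y : R3) : smf :=
  cst ((wallis n ^+ 3)^-1) * (kC i0 y ^+ n * (kC i1 y ^+ n * kC i2 y ^+ n)).

Lemma DkCX_neq i j y n : i != j -> Dx j (kC i y ^+ n) = 0.
Proof.
move=> ij; rewrite smf_DX smf_DkC (negPf ij) mulr0 oppr0.
by rewrite (_ : cst 0 = 0)// mul0r mulr0 mul0rn.
Qed.

Lemma torusT : torus setT = 1%E.
Proof.
have iT : itv_measure 0 1 setT = 1%E :> \bar R by rewrite itv_measureT// subr0.
transitivity ((square_measure \x itv_measure 0 1)%E (setT `*` setT) : \bar R).
  by rewrite setXTT.
rewrite product_measure1E//; transitivity (1 * 1 : \bar R)%E; last exact: mule1.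
congr (_ * _)%E; last exact: iT.
transitivity ((itv_measure 0 1 \x itv_measure 0 1)%E (setT `*` setT) : \bar R).
  by rewrite setXTT.
rewrite product_measure1E//; transitivity (1 * 1 : \bar R)%E; last exact: mule1.
by congr (_ * _)%E; exact: iT.
Qed.

Lemma torus_cst (c : R) : \int[torus]_x c = c.
Proof.
transitivity (c * fine (torus setT)); first exact: Rintegral_cst.
by rewrite torusT mulr1.
Qed.

Lemma kern_int n y t : \int[torus]_x kern n y (t, x) = 1.
Proof.
rewrite /kern; under eq_Rintegral do rewrite smfME.
rewrite bmf_RintegralZ; last exact: smf_bmf_slice.
rewrite wallis_int; last by rewrite smf_DM !DkCX_neq// mul0r mulr0 addr0.
rewrite wallis_int; last by rewrite !DkCX_neq.
rewrite -[kC i2 y ^+ n]mulr1 wallis_int; last exact: smf_Dcst.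
rewrite (_ : (fun x => _) = (fun=> 1))// torus_cst mulr1.
have := wallis_gt0 n => w0.
by rewrite /=; field; rewrite gt_eqF.
Qed.

(** [1 - kC i] is the square of [sin (pi (x_i - y_i))], a periodic squared distance. Its mean under
    the kernel is one minus a Wallis ratio and tends to zero: the kernel concentrates on the
    diagonal. *)
Lemma kern_intM i n y t :
  \int[torus]_x ((1 - kC i y) * kern n y) (t, x) = n.*2.+2%:R^-1.
Proof.
have step (w : smf) : Dx i w = 0 -> (exists c, kern n y = cst c * (kC i y ^+ n * w)) ->
    \int[torus]_x ((1 - kC i y) * kern n y) (t, x) = n.*2.+2%:R^-1.
  move=> Dw [c kE].
  have E x : ((1 - kC i y) * kern n y) (t, x) =
      kern n y (t, x) - c * (kC i y ^+ n.+1 * w) (t, x).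
    by rewrite kE exprS /=; ring.
  under eq_Rintegral do rewrite E.
  rewrite bmf_RintegralB; [|exact: smf_bmf_slice|]; last first.
    by apply: bmfM; [exact: bmf_cst|exact: smf_bmf_slice].
  rewrite bmf_RintegralZ; last exact: smf_bmf_slice.
  rewrite wallis_step// mulrCA -bmf_RintegralZ; last exact: smf_bmf_slice.
  have -> : (fun x => c * (kC i y ^+ n * w) (t, x)) = (fun x => kern n y (t, x)).
    by apply/funext => x; rewrite kE.
  rewrite !kern_int mulr1.
  have -> : n.*2.+2%:R = n.*2.+1%:R + 1 :> R by rewrite natr1.
  have : (n.*2.+1%:R + 1 : R) != 0 by rewrite natr1 pnatr_eq0.
  by move: (n.*2.+1%:R : R) => m m0; field.
case: i step => -[|[|[|//]]] Hi step.
- apply: (step (kC i1 y ^+ n * kC i2 y ^+ n)).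
    by rewrite smf_DM !DkCX_neq// mul0r mulr0 addr0.
  exists (wallis n ^+ 3)^-1; rewrite /kern (_ : Ordinal Hi = i0)//; exact: val_inj.
- apply: (step (kC i0 y ^+ n * kC i2 y ^+ n)).
    by rewrite smf_DM !DkCX_neq// mul0r mulr0 addr0.
  exists (wallis n ^+ 3)^-1; rewrite /kern (_ : Ordinal Hi = i1); last exact: val_inj.
  by rewrite [kC i0 y ^+ n * (_ * _)]mulrCA.
- apply: (step (kC i0 y ^+ n * kC i1 y ^+ n)).
    by rewrite smf_DM !DkCX_neq// mul0r mulr0 addr0.
  exists (wallis n ^+ 3)^-1; rewrite /kern (_ : Ordinal Hi = i2); last exact: val_inj.
  by congr (_ * _); rewrite mulrA mulrC.
Qed.

Lemma kern_ge0 n y z : 0 <= kern n y z.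
Proof.
rewrite /kern !smfME !smfXE mulr_ge0//.
  by rewrite /= invr_ge0 exprn_ge0// ltW// wallis_gt0.
have h i : 0 <= kC i y z by have /andP[] := kC_bounds i y z.
by rewrite !mulr_ge0// exprn_ge0.
Qed.

Lemma kern_sym n t s x y : kern n y (t, x) = kern n x (s, y).
Proof. by rewrite /kern !smfME !smfXE !(kC_sym _ t s). Qed.

(** Exchanging [x] and [y] leaves each [kC] unchanged and reverses each [kS]. For a kernel depending
    on [x - y] this says that a derivative in [x] is minus the derivative in [y]; the times do not
    matter. *)
Lemma kern_anti i n t s x y : Dx i (kern n y) (t, x) = - Dx i (kern n x) (s, y).
Proof.
have DC j : Dx i (kC j y ^+ n) (t, x) = - Dx i (kC j x ^+ n) (s, y).
  have E x' y' t' : Dx i (kC j y' ^+ n) (t', x') =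
      (kC j y' (t', x') ^+ n.-1 * (- (pi * (j == i)%:R) * kS j y' (t', x'))) *+ n.
    by rewrite smf_DX smf_DkC smf_mulrnE; congr (_ *+ n); rewrite -smfXE.
  by rewrite !E (kC_sym _ t s) (kS_sym _ t s) !mulrN mulNrn.
have CX j : (kC j y ^+ n) (t, x) = (kC j x ^+ n) (s, y).
  by rewrite !smfXE (kC_sym _ t s).
have E x' y' t' : Dx i (kern n y') (t', x') = (wallis n ^+ 3)^-1 *
    (Dx i (kC i0 y' ^+ n) (t', x') *
        ((kC i1 y' ^+ n) (t', x') * (kC i2 y' ^+ n) (t', x'))
     + (kC i0 y' ^+ n) (t', x') *
        (Dx i (kC i1 y' ^+ n) (t', x') * (kC i2 y' ^+ n) (t', x')
         + (kC i1 y' ^+ n) (t', x') * Dx i (kC i2 y' ^+ n) (t', x'))).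
  by rewrite /kern smf_DZ smf_DM [in X in _ + X]smf_DM.
have opp_trans (u v u' v' : R) : u = u' -> v = v' -> u' = - v' -> u = - v by move=> -> ->.
have comb (k A B C A' B' C' a b c a' b' c' : R) : A = - A' -> B = - B' -> C = - C' ->
    a = a' -> b = b' -> c = c' ->
    k * (A * (b * c) + a * (B * c + b * C)) = - (k * (A' * (b' * c') + a' * (B' * c' + b' * C'))).
  by do 6! move=> ->; ring.
exact: opp_trans (E x y t) (E y x s)
  (comb _ _ _ _ _ _ _ _ _ _ _ _ _ (DC i0) (DC i1) (DC i2) (CX i0) (CX i1) (CX i2)).
Qed.

Lemma bmf_cs i : bmf (cs i : X3 -> R).
Proof. exact: (smf_bmf_slice (smf_cs i) 0). Qed.

Lemma bmf_sn i : bmf (sn i : X3 -> R).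
Proof. exact: (smf_bmf_slice (smf_sn i) 0). Qed.

Lemma bmf_kC i t : bmf (fun xy : X3 * X3 => kC i xy.2 (t, xy.1)).
Proof.
have b (f : X3 -> R) : bmf f -> bmf (fun xy : X3 * X3 => f xy.1) /\
                               bmf (fun xy : X3 * X3 => f xy.2).
  by move=> bf; split; exact: bmf_measurable_comp.
have E : (fun xy : X3 * X3 => kC i xy.2 (t, xy.1)) = (fun xy =>
  2^-1 * (1 + cs i xy.2 * cs i xy.1 + sn i xy.2 * sn i xy.1)) by [].
rewrite E; have [c1 c2] := b _ (bmf_cs i); have [s1 s2] := b _ (bmf_sn i).
apply: bmfM; first exact: bmf_cst.
by apply: bmfD; [apply: bmfD; [exact: bmf_cst|exact: bmfM]|exact: bmfM].
Qed.

Lemma bmf_kern n t : bmf (fun xy : X3 * X3 => kern n xy.2 (t, xy.1)).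
Proof.
have bC i : bmf (fun xy : X3 * X3 => kC i xy.2 (t, xy.1)) by exact: bmf_kC.
have E : (fun xy : X3 * X3 => kern n xy.2 (t, xy.1)) = (fun xy =>
    (wallis n ^+ 3)^-1 * (kC i0 xy.2 (t, xy.1) ^+ n *
      (kC i1 xy.2 (t, xy.1) ^+ n * kC i2 xy.2 (t, xy.1) ^+ n))).
  by apply/funext => xy; rewrite /kern !smfME !smfXE.
rewrite E; apply: bmfM; first exact: bmf_cst.
by apply: bmfM; [exact: bmfX|apply: bmfM; exact: bmfX].
Qed.

(* Kernels K(x, y) = \sum_j a_j(x) b_j(y), for which differentiation under
   the integral sign in [\int K(x, y) f(y) dy] is trivial. *)
Definition mollifiable (K : R3 -> smf) : Prop :=
  [/\ forall z, bmf (fun y : X3 => K y z), forall v z, bmf (fun y : X3 => D v (K y) z) &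
    forall f : X3 -> R, bmf f -> exists F : smf,
      (forall z, F z = \int[torus]_y (f y * K y z)) /\
      (forall v z, D v F z = \int[torus]_y (f y * D v (K y) z))].

Lemma mollifiable1 : mollifiable (fun=> 1).
Proof.
split.
- by move=> z; exact: bmf_cst.
- by move=> v z; exact: bmf_cst.
move=> f bf; exists (cst (\int[torus]_y f y)); split => [z|v z].
  by rewrite /=; apply: eq_Rintegral => y _; rewrite mulr1.
rewrite smf_Dcst smf0E -[LHS](mulr0 (\int[torus]_y f y)) -bmf_RintegralZr//.
by apply: eq_Rintegral => y _; rewrite (_ : 1 = cst 1)// smf_Dcst.
Qed.

Lemma mollifiableD K L : mollifiable K -> mollifiable L ->
  mollifiable (fun y => K y + L y).
Proof.
move=> [bK bDK mK] [bL bDL mL]; split.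
- by move=> z; exact: bmfD.
- move=> v z; rewrite (_ : (fun y => _) = (fun y => D v (K y) z + D v (L y) z)).
    exact: bmfD.
  by apply/funext => y; rewrite smf_DD.
move=> f bf; have [F [FE DFE]] := mK f bf; have [G [GE DGE]] := mL f bf.
exists (F + G); split => [z|v z].
  rewrite smfDE FE GE -bmf_RintegralD; [|exact: bmfM|exact: bmfM].
  by apply: eq_Rintegral => y _; rewrite smfDE mulrDr.
rewrite smf_DD smfDE DFE DGE -bmf_RintegralD; [|exact: bmfM|exact: bmfM].
by apply: eq_Rintegral => y _; rewrite smf_DD smfDE mulrDr.
Qed.

Lemma mollifiableM (g : X3 -> R) (a : smf) K : bmf g -> mollifiable K ->
  mollifiable (fun y => cst (g y) * a * K y).
Proof.
move=> bg [bK bDK mK].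
have DE v y z : D v (cst (g y) * a * K y) z = g y * (D v a z * K y z + a z * D v (K y) z).
  by rewrite -mulrA smf_DZ smf_DM.
split.
- move=> z; apply: bmfM => //; apply: bmfM => //; exact: bmf_cst.
- move=> v z; under eq_fun do rewrite DE.
  by apply: bmfM => //; apply: bmfD; apply: bmfM => //; exact: bmf_cst.
move=> f bf; have [F [FE DFE]] := mK (fun y => f y * g y) (bmfM bf bg).
exists (a * F); split => [z|v z].
  rewrite smfME FE -bmf_RintegralZ; last by do !apply: bmfM.
  by apply: eq_Rintegral => y _; rewrite /=; ring.
rewrite smf_DM smfDE !smfME FE DFE -!bmf_RintegralZ; try by do !apply: bmfM.
rewrite -bmf_RintegralD; last 2 first.
- by do !apply: bmfM => //; exact: bmf_cst.
- by do !apply: bmfM => //; exact: bmf_cst.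
by apply: eq_Rintegral => y _; rewrite DE; ring.
Qed.

Lemma mollifiable_eq K L : (forall y, K y = L y) -> mollifiable K -> mollifiable L.
Proof. by move=> /funext ->. Qed.

(** By the addition formula each factor [kC] is a sum of three products of a function of [x] and a
    function of [y], and multiplication by such a product preserves [mollifiable]. *)
Lemma mollifiable_kern n : mollifiable (kern n).
Proof.
have mC i K : mollifiable K -> mollifiable (fun y => kC i y * K y).
  move=> mK.
  have m1 : mollifiable (fun y => cst 2^-1 * 1 * K y) by apply: mollifiableM => //; exact: bmf_cst.
  have m2 := mollifiableM (smf_cs i) (bmfM (bmf_cst X3 2^-1) (bmf_cs i)) mK.
  have m3 := mollifiableM (smf_sn i) (bmfM (bmf_cst X3 2^-1) (bmf_sn i)) mK.
  apply: mollifiable_eq (mollifiableD (mollifiableD m1 m2) m3) => y.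
  by apply: smf_eq => z; rewrite /kC /=; ring.
have mCX i m K : mollifiable K -> mollifiable (fun y => kC i y ^+ m * K y).
  move=> mK; elim: m => [|m IHm].
    by apply: mollifiable_eq mK => y; rewrite expr0 mul1r.
  by apply: mollifiable_eq (mC i _ IHm) => y; rewrite exprS mulrA.
have := mCX i0 n _ (mCX i1 n _ (mCX i2 n _ mollifiable1)).
move=> /(mollifiableM 1 (bmf_cst X3 (wallis n ^+ 3)^-1)).
by apply: mollifiable_eq => y; rewrite /kern !mulr1.
Qed.

End TrigSmf.

Lemma small3 (R : realType) (a b c e : R) :
  a <= 6 * c + 3 * b -> b < e / 6 -> c < e / 12 -> a < e.
Proof. lra. Qed.

Lemma min1_lip (R : realType) (a b : R) : `|Num.min 1 a - Num.min 1 b| <= 1 * `|a - b|.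
Proof.
rewrite mul1r; case: (leP 1 a) => ha; case: (leP 1 b) => hb //.
- by rewrite subrr normr0.
- by rewrite !ger0_norm; lra.
- by rewrite !ler0_norm; lra.
Qed.

Lemma clip_lip (R : realType) (m : nat) (a b : R) :
  `|Num.min 1 (Num.max 0 (m%:R * a)) - Num.min 1 (Num.max 0 (m%:R * b))| <= m%:R * `|a - b|.
Proof.
apply: le_trans (min1_lip _ _) _; rewrite mul1r.
have -> : m%:R * `|a - b| = `|m%:R * a - m%:R * b| by rewrite -mulrBr normrM normr_nat.
move: (m%:R * a) (m%:R * b) => c d'.
case: (leP 0 c) => hc; case: (leP 0 d') => hd //.
- by rewrite !ger0_norm; lra.
- by rewrite !ler0_norm; lra.
- by rewrite subrr normr0.
Qed.

Lemma sqr_triangle3 (R : realType) (a b a' b' : R) :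
  (a - b) ^+ 2 <= 3 * (a - a') ^+ 2 + 3 * (b - b') ^+ 2 + 3 * (a' - b') ^+ 2.
Proof.
have := sqr_ge0 ((a - a') + (b - b')); have := sqr_ge0 ((a - a') - (a' - b')).
have := sqr_ge0 ((b - b') + (a' - b')).
by nra.
Qed.

Lemma limr_le_cvg (R : realType) (u : nat -> R) (l c : R) :
  u n @[n --> \oo] --> l -> (forall n, u n <= c) -> l <= c.
Proof.
move=> ul uc; rewrite -(cvg_lim _ ul)//; apply: limr_le; last exact: nearW.
by apply/cvg_ex; exists l.
Qed.

(** * Mean square convergence of mollified bounded functions, for an abstract kernel *)

Section Oscillation.
Context {R : realType} d (X : measurableType d).
Variable mu : {finite_measure set X -> \bar R}.
Variable ker : nat -> X -> X -> R.
Hypothesis bmf_ker : forall n, bmf (fun xy : X * X => ker n xy.1 xy.2).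
Hypothesis ker_ge0 : forall n x y, 0 <= ker n x y.
Hypothesis ker_int1 : forall n y, \int[mu]_x ker n x y = 1.
Hypothesis ker_int2 : forall n x, \int[mu]_y ker n x y = 1.
Implicit Types (f g h : X -> R) (F G : X * X -> R).

Definition dint (F : X * X -> R) : R := \int[mu]_x \int[mu]_y F (x, y).

Lemma dintD F G : bmf F -> bmf G -> dint (fun z => F z + G z) = dint F + dint G.
Proof.
move=> bF bG; rewrite /dint -bmf_RintegralD; [|exact: bmf_fubini1|exact: bmf_fubini1].
by apply: eq_Rintegral => x _; rewrite bmf_RintegralD//; exact: bmf_slice.
Qed.

Lemma dintZ c F : bmf F -> dint (fun z => c * F z) = c * dint F.
Proof.
move=> bF; rewrite /dint -bmf_RintegralZ; last exact: bmf_fubini1.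
by apply: eq_Rintegral => x _; rewrite bmf_RintegralZ//; exact: bmf_slice.
Qed.

Lemma le_dint F G : bmf F -> bmf G -> (forall z, F z <= G z) -> dint F <= dint G.
Proof.
move=> bF bG FG; apply: bmf_le_Rintegral; [exact: bmf_fubini1|exact: bmf_fubini1|].
move=> x; apply: bmf_le_Rintegral => //; exact: bmf_slice.
Qed.

Lemma dint_swap F : bmf F -> dint F = \int[mu]_y \int[mu]_x F (x, y).
Proof.
move=> bF; rewrite /dint -(bmf_Rintegral_prod _ _ bF).
exact: (bmf_Rintegral_prod2 _ _ bF).
Qed.

Lemma bmf1 f : bmf f -> bmf (fun z : X * X => f z.1).
Proof. by move=> bf; exact: bmf_measurable_comp. Qed.

Lemma bmf2 f : bmf f -> bmf (fun z : X * X => f z.2).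
Proof. by move=> bf; exact: bmf_measurable_comp. Qed.

Lemma dint_ker1 n f : bmf f ->
  dint (fun z => f z.1 * ker n z.1 z.2) = \int[mu]_x f x.
Proof.
move=> bf; apply: eq_Rintegral => x _ /=.
rewrite bmf_RintegralZ ?ker_int2 ?mulr1//.
exact: (bmf_slice x (bmf_ker n)).
Qed.

Lemma dint_ker2 n f : bmf f ->
  dint (fun z => f z.2 * ker n z.1 z.2) = \int[mu]_x f x.
Proof.
move=> bf; rewrite dint_swap; last by apply: bmfM; [exact: bmf2|exact: bmf_ker].
apply: eq_Rintegral => y _ /=.
rewrite bmf_RintegralZ ?ker_int1 ?mulr1//.
exact: (bmf_slice2 y (bmf_ker n)).
Qed.

(** By [osc_expand] this is twice the defect between the integral of [f ^ 2] and that of [f] times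
    its mollification. Its vanishing in the limit is the only convergence property of mollification
    that the interpolation inequality needs. *)
Definition osc n f : R := dint (fun z => (f z.1 - f z.2) ^+ 2 * ker n z.1 z.2).

Lemma bmf_osc n f : bmf f ->
  bmf (fun z : X * X => (f z.1 - f z.2) ^+ 2 * ker n z.1 z.2).
Proof.
move=> bf; apply: bmfM; last exact: bmf_ker.
by apply: bmfX; apply: bmfB; [exact: bmf1|exact: bmf2].
Qed.

Lemma osc_ge0 n f : 0 <= osc n f.
Proof.
apply: Rintegral_ge0 => x _; apply: Rintegral_ge0 => y _.
by rewrite mulr_ge0 ?sqr_ge0 ?ker_ge0.
Qed.

Definition good f := bmf f /\ osc n f @[n --> \oo] --> 0.

Lemma good_le (a b : R) f g h : bmf f -> good g -> good h ->
  (forall x y, (f x - f y) ^+ 2 <= a * (g x - g y) ^+ 2 + b * (h x - h y) ^+ 2) ->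
  good f.
Proof.
move=> bf [bg og] [bh oh] fgh; split; first exact: bf.
have bo u : bmf u -> forall n (c : R),
    bmf (fun z : X * X => c * ((u z.1 - u z.2) ^+ 2 * ker n z.1 z.2)).
  by move=> bu n c; apply: bmfM; [exact: bmf_cst|exact: bmf_osc].
have le n : 0 <= osc n f <= a * osc n g + b * osc n h.
  rewrite osc_ge0/= -!dintZ; [|exact: bmf_osc|exact: bmf_osc].
  rewrite -dintD; [|exact: bo|exact: bo].
  apply: le_dint => [||z]; first exact: bmf_osc.
    by apply: bmfD; exact: bo.
  have := ler_wpM2r (ker_ge0 n z.1 z.2) (fgh z.1 z.2).
  by rewrite mulrDl -!mulrA.
have l0 : a * osc n g + b * osc n h @[n --> \oo] --> a * 0 + b * 0.
  by apply: cvgD; apply: cvgM; [exact: cvg_cst|exact: og|exact: cvg_cst|exact: oh].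
rewrite !mulr0 addr0 in l0.
apply: squeeze_cvgr l0; [by apply: nearW; exact: le|exact: cvg_cst].
Qed.

Lemma good_lip (phi : R -> R) (L : R) f : bmf (fun x => phi (f x)) ->
  (forall a b, `|phi a - phi b| <= L * `|a - b|) -> good f ->
  good (fun x => phi (f x)).
Proof.
move=> bp pL gf; apply: (@good_le (L ^+ 2) 0 _ _ _ bp gf gf) => x y.
rewrite mul0r addr0 -exprMn -real_normK ?num_real// -[leRHS]real_normK ?num_real//.
rewrite lerXn2r ?nnegrE// (le_trans (pL _ _))// normrM ler_wpM2r//.
exact: ler_norm.
Qed.

Lemma goodD f g : good f -> good g -> good (fun x => f x + g x).
Proof.
move=> gf gg; apply: (@good_le 2 2 _ f g _ gf gg); first by apply: bmfD; [case: gf|case: gg].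
move=> x y; rewrite -subr_ge0.
rewrite (_ : _ - _ = ((f x - f y) - (g x - g y)) ^+ 2) ?sqr_ge0//.
by ring.
Qed.

Lemma goodZ c f : good f -> good (fun x => c * f x).
Proof.
move=> gf; apply: (@good_lip ( *%R c) `|c| _ _ _ gf).
  by apply: bmfM; [exact: bmf_cst|case: gf].
by move=> a b; rewrite -mulrBr normrM.
Qed.

Lemma good_cst c : good (fun=> c).
Proof.
split; first exact: bmf_cst.
rewrite (_ : (fun n => _) = (fun=> 0)); first exact: cvg_cst.
apply/funext => n; rewrite /osc /dint; apply: Rintegral_eq0_fun => x; apply: Rintegral_eq0_fun => y.
by rewrite subrr expr0n mul0r.
Qed.

(** The kernel has unit mass in each variable, so passing from [f] to [f_ m] costs a multiple of the
    integral of [(f - f_ m) ^ 2], uniformly in [n]. Dominated convergence fixes [m] first, and [n]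
    grows afterwards. *)
Lemma good_lim f (f_ : nat -> X -> R) (C : R) : measurable_fun setT f ->
  (forall m, good (f_ m)) -> (forall m x, `|f_ m x| <= C) ->
  {ae mu, forall x, f_ m x @[m --> \oo] --> f x} -> bmf f -> good f.
Proof.
move=> mf gf fC ff bf; split; first exact: bf.
have bd m : bmf (fun x => (f x - f_ m x) ^+ 2) by apply/bmfX/bmfB => //; case: (gf m).
have osc_le n m : osc n f <= 6 * (\int[mu]_x (f x - f_ m x) ^+ 2) + 3 * osc n (f_ m).
  have bm : bmf (f_ m) by case: (gf m).
  have b1 := bmfM (bmf1 (bd m)) (bmf_ker n).
  have b2 := bmfM (bmf2 (bd m)) (bmf_ker n).
  have b3 := bmf_osc n bm.
  have c3 := bmf_cst (X * X)%type (3 : R).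
  have eE : dint (fun z : X * X => 3 * ((f z.1 - f_ m z.1) ^+ 2 * ker n z.1 z.2)
      + 3 * ((f z.2 - f_ m z.2) ^+ 2 * ker n z.1 z.2)
      + 3 * ((f_ m z.1 - f_ m z.2) ^+ 2 * ker n z.1 z.2)) =
    3 * (\int[mu]_x (f x - f_ m x) ^+ 2) + 3 * (\int[mu]_x (f x - f_ m x) ^+ 2)
    + 3 * osc n (f_ m).
    etransitivity; first exact: (dintD (bmfD (bmfM c3 b1) (bmfM c3 b2)) (bmfM c3 b3)).
    congr (_ + _); last exact: (dintZ 3 b3).
    etransitivity; first exact: (dintD (bmfM c3 b1) (bmfM c3 b2)).
    congr (_ + _).
      by etransitivity; [exact: (dintZ 3 b1)|congr (_ * _); exact: dint_ker1].
    by etransitivity; [exact: (dintZ 3 b2)|congr (_ * _); exact: dint_ker2].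
  rewrite (_ : 6 = 3 + 3); last by rewrite -natrD.
  rewrite mulrDl -eE.
  apply: le_dint => [||[x y]]; first exact: bmf_osc.
    by apply: bmfD; [apply: bmfD|]; exact: bmfM.
  have := ler_wpM2r (ker_ge0 n x y) (sqr_triangle3 (f x) (f y) (f_ m x) (f_ m y)).
  by rewrite !mulrDl -!mulrA.
have d0 : \int[mu]_x (f x - f_ m x) ^+ 2 @[m --> \oo] --> 0.
  have [C' fC'] := bf.2.
  have [] := @dominated_convergence _ _ _ mu setT measurableT
     (fun m x => ((f x - f_ m x) ^+ 2)%:E) (fun=> 0%E) (fun=> ((C' + C) ^+ 2)%:E).
  - by move=> m; apply/measurable_EFinP; case: (bd m).
  - exact: measurable_cst.
  - apply: ae_mono ff => x ffx _; apply: cvg_EFin; first exact: nearW.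
    rewrite -[X in _ --> X](_ : (f x - f x) ^+ 2 = 0); last by rewrite subrr expr0n.
    by under eq_fun do rewrite /= expr2; apply: cvgM; apply: cvgB => //; exact: cvg_cst.
  - exact: finite_measure_integrable_cst.
  - apply: ae_all => x m _; rewrite lee_fin normrX lerXn2r ?nnegrE//.
      by rewrite addr_ge0// (le_trans _ (fC' x), le_trans _ (fC m x)).
    by rewrite (le_trans (ler_normB _ _))// lerD.
  move=> _ _; rewrite integral0 => /fine_cvgP[_]; apply: cvg_trans.
  by apply: near_eq_cvg; apply: nearW.
apply/cvgrPdist_lt => e e0.
have [m Hm] : exists m, \int[mu]_x (f x - f_ m x) ^+ 2 < e / 12.
  have /cvgrPdist_lt/(_ (e / 12)) := d0; rewrite divr_gt0// => /(_ isT)[m _ /(_ m (leqnn _))].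
  by rewrite sub0r normrN => H; exists m; rewrite (le_lt_trans (ler_norm _)).
have /cvgrPdist_lt/(_ (e / 6)) := (gf m).2; rewrite divr_gt0// => /(_ isT).
apply: filterS => n H.
have {}H : osc n (f_ m) < e / 6 by apply: le_lt_trans H; rewrite sub0r normrN; exact: ler_norm.
rewrite sub0r normrN [X in X < _](ger0_norm (osc_ge0 n f)).
exact: small3 (osc_le n m) H Hm.
Qed.

(** The kernel averages of the control [C] bound the oscillation. With the control [1 - kC] this is
    how the trigonometric functions enter the class. *)
Lemma good_ctrl (C : X -> X -> R) (c : nat -> R) f : bmf f ->
  bmf (fun z : X * X => C z.1 z.2) ->
  (forall n y, \int[mu]_x (C x y * ker n x y) = c n) -> (forall r : R, \int[mu]__ r = r) ->
  c n @[n --> \oo] --> 0 ->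
  (forall x y, (f x - f y) ^+ 2 <= 4 * C x y) -> good f.
Proof.
move=> bf bC Cc mu1 c0 fC; split; first exact: bf.
have bCk n := bmfM bC (bmf_ker n).
have b4 := bmf_cst (X * X)%type (4 : R).
have le n : 0 <= osc n f <= 4 * c n.
  rewrite osc_ge0/= (_ : c n = dint (fun z : X * X => C z.1 z.2 * ker n z.1 z.2)).
    rewrite -(dintZ 4 (bCk n)); apply: (le_dint (bmf_osc n bf) (bmfM b4 (bCk n))) => z.
    by rewrite mulrA ler_wpM2r// fC.
  rewrite (dint_swap (bCk n)).
  transitivity (\int[mu]_y c n); last by apply: eq_Rintegral => y _; rewrite Cc.
  exact/esym/mu1.
have l0 : 4 * c n @[n --> \oo] --> (4 * 0 : R) by apply: cvgM; [exact: cvg_cst|exact: c0].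
rewrite mulr0 in l0.
by apply: squeeze_cvgr l0; [apply: nearW; exact: le|exact: cvg_cst].
Qed.

Lemma osc_expand n f : bmf f ->
  osc n f = 2 * (\int[mu]_x f x ^+ 2) - 2 * \int[mu]_x (f x * \int[mu]_y (f y * ker n x y)).
Proof.
move=> bf; have b2f := bmfX 2 bf.
have b1 := bmfM (bmf1 b2f) (bmf_ker n); have b2 := bmfM (bmf2 b2f) (bmf_ker n).
have b3 := bmfM (bmf1 bf) (bmfM (bmf2 bf) (bmf_ker n)).
have b3' := bmfM (bmf_cst (X * X)%type (-2 : R)) b3.
transitivity (dint (fun z : X * X => f z.1 ^+ 2 * ker n z.1 z.2 + f z.2 ^+ 2 * ker n z.1 z.2
    + (-2) * (f z.1 * (f z.2 * ker n z.1 z.2)))).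
  congr dint; apply/funext => z /=.
  by move: (f z.1) (f z.2) (ker n z.1 z.2) => a b c; ring.
etransitivity; first exact: (dintD (bmfD b1 b2) b3').
rewrite -mulNr mulrDl mul1r; congr (_ + _).
  etransitivity; first exact: (dintD b1 b2).
  by congr (_ + _); [exact: dint_ker1|exact: dint_ker2].
etransitivity; first exact: (dintZ (-2) b3).
congr (_ * _); apply: eq_Rintegral => x _ /=.
by rewrite bmf_RintegralZ//; exact: (bmfM bf (bmf_slice x (bmf_ker n))).
Qed.

(** The unit mass of the kernel writes [a * u ^+ 2] as an average, after which the pointwise
    inequality is integrated against the kernel. *)
Lemma young_ker n (a b u : R) g x : bmf g ->
  (forall v, u * v <= a * u ^+ 2 + b * v ^+ 2) ->
  u * (\int[mu]_y (g y * ker n x y)) <=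
  a * u ^+ 2 + b * \int[mu]_y (g y ^+ 2 * ker n x y).
Proof.
move=> bg uv; have bk : bmf (ker n x) := bmf_slice x (bmf_ker n).
have bgk := bmfM bg bk; have bg2k := bmfM (bmfX 2 bg) bk.
have buk := bmfM (bmf_cst X (a * u ^+ 2)) bk.
have -> : a * u ^+ 2 = \int[mu]_y (a * u ^+ 2 * ker n x y).
  by rewrite bmf_RintegralZ// ker_int2 mulr1.
rewrite -!bmf_RintegralZ// -bmf_RintegralD//; last first.
  by apply: bmfM => //; exact: bmf_cst.
apply: bmf_le_Rintegral.
- by apply: bmfM => //; exact: bmf_cst.
- by apply: bmfD => //; apply: bmfM => //; exact: bmf_cst.
- by move=> y; have := ler_wpM2r (ker_ge0 n x y) (uv (g y)); rewrite mulrDl -!mulrA.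
Qed.

#[local] Opaque osc.

Lemma good_ext f g : f =1 g -> good f -> good g.
Proof. by move=> /funext ->. Qed.

(** An application of [good_lim] to the constant sequence [g]. *)
Lemma good_ae f g : bmf f -> good g -> {ae mu, forall x, f x = g x} -> good f.
Proof.
move=> bf gg fg; have [C gC] := gg.1.2.
apply: (@good_lim f (fun=> g) C); [by case: bf|by move=> _|by move=> _|  |exact: bf].
by apply: ae_mono fg => x ->; exact: cvg_cst.
Qed.

(** These sets form a sigma-algebra, so a generating family is enough. Complements and unions reduce
    to Lipschitz images and bounded limits of good functions. *)
Definition goodset (A : set X) := measurable A /\ good (\1_A : X -> R).

Lemma bmf_indic (A : set X) : measurable A -> bmf (\1_A : X -> R).
Proof.
move=> mA; split; first exact: measurable_indic.
by exists 1 => x; rewrite indicE; case: (_ \in _); rewrite ?normr1// normr0.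
Qed.

Lemma goodsetC (A : set X) : goodset A -> goodset (~` A).
Proof.
move=> [mA gA]; have mAC := measurableC mA; split; first exact: mAC.
apply: (@good_ext (fun x => 1 - \1_A x)) => [x|].
  by rewrite !indicE in_setC; case: (_ \in _); rewrite ?subrr ?subr0.
apply: (@good_lip (fun a => 1 - a) 1 _ _ _ gA) => [|a b].
  by apply: bmfB; [exact: bmf_cst|exact: bmf_indic].
by rewrite mul1r opprB addrC addrA subrK distrC.
Qed.

Lemma goodsetU (A B : set X) : goodset A -> goodset B -> goodset (A `|` B).
Proof.
move=> [mA gA] [mB gB]; have mAB := measurableU _ _ mA mB; split; first exact: mAB.
apply: (@good_ext (fun x => Num.min 1 (\1_A x + \1_B x))) => [x|].
  rewrite !indicE in_setU.
  case: (x \in A); case: (x \in B) => /=.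
  - by rewrite min_l// lerDl ler01.
  - by rewrite addr0 minxx.
  - by rewrite add0r minxx.
  - by rewrite addr0 min_r// ler01.
apply: (@good_lip (Num.min 1) 1 (fun x => \1_A x + \1_B x) _ (@min1_lip R) (goodD gA gB)).
have bAB := bmfD (bmf_indic mA) (bmf_indic mB).
apply: (@bmf_comp _ _ _ _ _ 1) => [a||x]; last 2 first.
- by case: bAB.
- by rewrite ger0_norm ?ge_min ?lexx// le_min ler01 addr_ge0// indicE ler0n.
by apply: (@continuous_min _ _ (fun=> 1) id); [exact: cvg_cst|exact: cvg_id].
Qed.

Lemma goodsetI (A B : set X) : goodset A -> goodset B -> goodset (A `&` B).
Proof.
by move=> gA gB; rewrite -[A `&` B]setCK setCI; apply/goodsetC/goodsetU; exact: goodsetC.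
Qed.

Lemma goodset0 : goodset set0.
Proof.
split; first exact: measurable0.
apply: good_ext (good_cst 0) => x.
by rewrite indicE in_set0.
Qed.

Lemma goodset_bigcup (F : nat -> set X) : (forall i, goodset (F i)) ->
  goodset (\bigcup_i F i).
Proof.
move=> gF; have mF : measurable (\bigcup_i F i).
  by apply: bigcupT_measurable => i; case: (gF i).
split; first exact: mF.
have gU n : goodset (\big[setU/set0]_(i < n) F i).
  elim: n => [|n IHn]; first by rewrite big_ord0; exact: goodset0.
  by rewrite big_ord_recr; exact: (goodsetU IHn (gF n)).
have {}gU n : goodset (\bigcup_(i < n) F i) by rewrite bigcup_mkord; exact: gU.
apply: (@good_lim _ (fun n => \1_(\bigcup_(i < n) F i)) 1).
- exact: measurable_indic.
- by move=> n; case: (gU n).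
- by move=> n x; rewrite indicE; case: (_ \in _); rewrite ?normr1// normr0.
- apply: ae_all => x; rewrite indicE; have [/set_mem[i _ Fix]|nF] := boolP (x \in \bigcup_i F i).
    apply: cvg_near_cst; exists i.+1 => // n /= ilen.
    by rewrite indicE mem_set//; exists i.
  apply: cvg_near_cst; apply: nearW => n.
  rewrite indicE memNset// => -[i _ Fix]; move/negP: nF; apply; apply/mem_set.
  by exists i.
- exact: bmf_indic.
Qed.

Lemma goodset_preimage d' (Y : measurableType d') (G : set (set Y)) (h : X -> Y) :
  (forall A, G A -> goodset (h @^-1` A)) ->
  forall A, <<s G >> A -> goodset (h @^-1` A).
Proof.
move=> gG; suff : <<s G >> `<=` [set A | goodset (h @^-1` A)] by [].
apply: smallest_sub; last by move=> A; exact: gG.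
split => /=.
- by rewrite preimage_set0; exact: goodset0.
- by move=> A gA; rewrite setTD preimage_setC; exact: goodsetC.
- by move=> F gF; rewrite preimage_bigcup; exact: goodset_bigcup.
Qed.

(* f > 0 is the bounded limit of min(1, m f^+) *)
Lemma goodset_gt0 f : good f -> goodset [set x | 0 < f x].
Proof.
move=> gf; have bf := gf.1.
have mS : measurable [set x | 0 < f x].
  have := bf.1 measurableT `]0, +oo[%classic (measurable_itv _).
  rewrite setTI; congr measurable; apply/seteqP; split => x /=;
    by rewrite in_itv/= andbT.
split; first exact: mS.
pose phi (m : nat) (a : R) := Num.min 1 (Num.max 0 (m%:R * a)).
have bphi m a : 0 <= phi m a <= 1.
  by rewrite /phi le_min ler01 le_max lexx/= ge_min lexx.
have cphi m : continuous (phi m).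
  have -> : phi m = ((fun=> 1) \min ((fun=> 0) \max (fun b => m%:R * b))) :> (R -> R) by [].
  move=> a; apply: continuous_min; first exact: cvg_cst.
  apply: continuous_max; first exact: cvg_cst.
  by apply: cvgM; [exact: cvg_cst|exact: cvg_id].
apply: (@good_lim _ (fun m x => phi m (f x)) 1).
- exact: measurable_indic.
- move=> m; apply: (@good_lip (phi m) m%:R _ _ _ gf) => [|a b].
    apply: (@bmf_comp _ _ _ (phi m) f 1); [exact: cphi|by case: bf|].
    by move=> x; rewrite ger0_norm; case/andP: (bphi m (f x)).
  exact: clip_lip.
- by move=> m x; rewrite ger0_norm; case/andP: (bphi m (f x)).
- apply: ae_all => x; have [fx|fx] := ltP 0 (f x); last first.
    rewrite indicE memNset/=; last by apply/negP; rewrite -leNgt.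
    apply: cvg_near_cst; apply: nearW => m.
    by rewrite /phi max_l ?min_r// mulr_ge0_le0.
  rewrite indicE mem_set//; apply: cvg_near_cst.
  exists (Num.bound (f x)^-1) => // m /= hm.
  have : 1 <= m%:R * f x.
    rewrite -ler_pdivrMr// div1r; apply: (@le_trans _ _ (Num.bound (f x)^-1)%:R).
      by apply/ltW/archi_boundP; rewrite invr_ge0 ltW.
    by rewrite ler_nat.
  move=> h1; rewrite /phi max_r ?min_l//.
  by rewrite mulr_ge0// ltW.
- exact: bmf_indic.
Qed.

(** Established for the torus in [tgoodset_all]; the passage from sets to bounded functions does not
    depend on the kernel. *)
Hypothesis goodset_all : forall A, measurable A -> goodset A.

Lemma good_sum (I : Type) (s : seq I) (F : I -> X -> R) :
  (forall i, good (F i)) -> good (fun x => \sum_(i <- s) F i x).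
Proof.
move=> gF; elim: s => [|i s IHs].
  by apply: good_ext (good_cst 0) => x; rewrite big_nil.
by apply: good_ext (goodD (gF i) IHs) => x; rewrite big_cons.
Qed.

Import HBNNSimple.

Let good_nnsfun (s : {nnsfun X >-> R}) : good (s : X -> R).
Proof.
have E : (fun x => \sum_(y <- fset_set (range s)) y * \1_(s @^-1` [set y]) x) =1 s.
  by move=> x; rewrite [RHS]fimfunE fsbig_finite.
move: E => /funext <-; apply: good_sum => y; apply: goodZ.
by apply: (goodset_all _).2.
Qed.

Lemma good_bmf f : bmf f -> good f.
Proof.
move=> bf; have [mf [C fC]] := bf.
suff H g : bmf g -> (forall x, 0 <= g x) -> good g.
  (* Adding the bound [C] makes the function nonnegative, the case in which approximation by
     increasing simple functions applies. *)
  have g1 : good (fun x => f x + C).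
    apply: H; first by apply: bmfD => //; exact: bmf_cst.
    by move=> x; have := fC x; rewrite ler_norml => /andP[]; rewrite -subr_ge0 opprK addrC.
  by apply: good_ext (goodD g1 (good_cst (- C))) => x; rewrite addrK.
move=> bg g0; have [mg [C' gC]] := bg.
have mEg : measurable_fun setT (EFin \o g) by exact/measurable_EFinP.
pose s := nnsfun_approx measurableT mEg.
have sg x : s m x @[m --> \oo] --> g x.
  have /fine_cvgP[_] : (EFin \o (s ^~ x)) @ \oo --> (g x)%:E.
    by apply: (cvg_nnsfun_approx measurableT mEg) => // y _; rewrite lee_fin.
  by apply: cvg_trans; apply: near_eq_cvg; apply: nearW.
have sle m x : s m x <= g x.
  have nd : nondecreasing_seq (s ^~ x).
    by move=> a b ab; have /lefP := nd_nnsfun_approx measurableT mEg ab; exact.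
  rewrite -(cvg_lim _ (sg x))//; apply: nondecreasing_cvgn_le => //.
  by apply/cvg_ex; exists (g x).
apply: (@good_lim g s C'); [exact: mg|by move=> m; exact: good_nnsfun| | |exact: bg].
- by move=> m x; rewrite ger0_norm// (le_trans (sle m x))// (le_trans (ler_norm _)).
- by apply: ae_all.
Qed.

End Oscillation.

Section AeProduct.
Context {R : realType} d1 d2 (X1 : measurableType d1) (X2 : measurableType d2).
Variables (m1 : {finite_measure set X1 -> \bar R}) (m2 : {finite_measure set X2 -> \bar R}).

Lemma ae_prod_fst (P : X1 -> Prop) : {ae m1, forall x, P x} ->
  {ae (m1 \x m2)%E, forall z, P z.1}.
Proof.
move=> [A [mA A0 PA]]; exists (A `*` setT); split; first exact: measurableX.
  transitivity (0 * m2 setT)%E; last by rewrite mul0e.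
  by rewrite -A0; exact: product_measure1E.
by move=> z nP; split => //; exact: PA.
Qed.

Lemma ae_prod_snd (P : X2 -> Prop) : {ae m2, forall x, P x} ->
  {ae (m1 \x m2)%E, forall z, P z.2}.
Proof.
move=> [A [mA A0 PA]]; exists (setT `*` A); split; first exact: measurableX.
  transitivity (m1 setT * 0)%E; last by rewrite mule0.
  by rewrite -A0; exact: product_measure1E.
by move=> z nP; split => //; exact: PA.
Qed.
End AeProduct.

(** * Convergence on the torus and the interpolation inequality *)

Section Mollification.
Context {R : realType}.
Variable Tp : {posnum R}.
Notation smf := (smf Tp).
Notation D := (@smf_D _ Tp).
Notation Dx i := (smf_D (0, Defs.basis i)).
Notation X1 := (measurableTypeR R).
Notation X3 := (X1 * X1 * X1)%type.
Notation X4 := (X1 * X3)%type.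
Notation torus := (@torus_measure R).
Implicit Types f g h : X3 -> R.

(** The kernel is constant in time; the time 0 is an arbitrary choice. *)
Definition ker n (x y : X3) : R := kern Tp n y (0, x).

Lemma bmf_ker n : bmf (fun xy : X3 * X3 => ker n xy.1 xy.2).
Proof. exact: bmf_kern. Qed.

Lemma ker_ge0 n x y : 0 <= ker n x y. Proof. exact: kern_ge0. Qed.

Lemma ker_sym n x y : ker n x y = ker n y x. Proof. exact: kern_sym. Qed.

Lemma ker_int1 n y : \int[torus]_x ker n x y = 1.
Proof. exact: kern_int. Qed.

Lemma ker_int2 n x : \int[torus]_y ker n x y = 1.
Proof. by under eq_Rintegral do rewrite ker_sym; exact: ker_int1. Qed.

Notation tosc := (@osc R _ X3 torus ker).
Notation tgood := (@good R _ X3 torus ker).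
Notation tgoodset := (@goodset R _ X3 torus ker).

Let cvg_wallis : n.*2.+2%:R^-1 @[n --> \oo] --> (0 : R).
Proof.
have h := @cvg_harmonic R.
apply: squeeze_cvgr h; last exact: cvg_cst.
apply: nearW => n; rewrite invr_ge0 ler0n/= lef_pV2 ?posrE ?ltr0n// ler_nat ltnS.
by rewrite -addnn leqW// leq_addr.
Qed.

(* (cos a - cos b)^2 and (sin a - sin b)^2 are at most 2 - 2 cos(a - b). *)
Lemma tgood_trig i (f : X3 -> R) : bmf f ->
  (forall x y, (f x - f y) ^+ 2 <= 4 * (1 - kC Tp i y (0, x))) -> tgood f.
Proof.
move=> bf fC.
apply: (@good_ctrl _ _ X3 torus ker bmf_ker ker_ge0 (fun x y => 1 - kC Tp i y (0, x)) (fun n => n.*2.+2%:R^-1) _ bf).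
- by apply: bmfB; [exact: bmf_cst|exact: bmf_kC].
- by move=> n y; exact: kern_intM.
- exact: torus_cst.
- exact: cvg_wallis.
- exact: fC.
Qed.

Lemma kC_cs i x y : kC Tp i y (0, x) = 2^-1 * (1 + cs i y * cs i x + sn i y * sn i x).
Proof. by []. Qed.

Lemma tgood_cs i : tgood (cs i).
Proof.
apply: (@tgood_trig i); first exact: (bmf_cs Tp).
move=> x y; rewrite kC_cs.
have := cos2Dsin2 (2 * pi * crd i x); have := cos2Dsin2 (2 * pi * crd i y).
rewrite -!/(cs i _) -!/(sn i _); move: (cs i x) (cs i y) (sn i x) (sn i y) => a b c d'.
have := sqr_ge0 (c - d'); nra.
Qed.

Lemma tgood_sn i : tgood (sn i).
Proof.
apply: (@tgood_trig i); first exact: (bmf_sn Tp).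
move=> x y; rewrite kC_cs.
have := cos2Dsin2 (2 * pi * crd i x); have := cos2Dsin2 (2 * pi * crd i y).
rewrite -!/(cs i _) -!/(sn i _); move: (cs i x) (cs i y) (sn i x) (sn i y) => a b c d'.
have := sqr_ge0 (a - b); nra.
Qed.

Lemma ae_cube : {ae torus, forall x : X3, forall i, 0 < crd i x < 1}.
Proof.
have iv := @ae_itv_measure R 0 1.
have sq1 : {ae square_measure, forall z : X1 * X1, 0 < z.1 < 1} := ae_prod_fst (itv_measure 0 1) iv.
have sq2 : {ae square_measure, forall z : X1 * X1, 0 < z.2 < 1} := ae_prod_snd (itv_measure 0 1) iv.
have h1 : {ae torus, forall z : X3, 0 < z.1.1 < 1} := ae_prod_fst (itv_measure 0 1) sq1.
have h2 : {ae torus, forall z : X3, 0 < z.1.2 < 1} := ae_prod_fst (itv_measure 0 1) sq2.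
have h3 : {ae torus, forall z : X3, 0 < z.2 < 1} := ae_prod_snd square_measure iv.
apply: (ae_mono _ (ae_mono2 (fun x a b => conj a b) h1 (ae_mono2 (fun x a b => conj a b) h2 h3))).
by move=> x [a [b c]] [[|[|[|//]]] Hi].
Qed.

Let ker_bmf := bmf_ker.

(** The expression is [sin (pi (s - r)) * sin (pi (1 - s))], whose second factor is positive. Unlike
    the first factor alone, the product has period 1 in [s]: up to null sets a half-space becomes
    the positivity set of a trigonometric polynomial. *)
Lemma sin_prod_gt0 (r s : R) : 0 <= r < 1 -> 0 < s < 1 ->
  (0 < 2^-1 * (cos (2 * pi * s - pi * (r + 1)) - cos (pi * (1 - r)))) = (r < s).
Proof.
move=> /andP[r0 r1] /andP[s0 s1].
have -> : 2^-1 * (cos (2 * pi * s - pi * (r + 1)) - cos (pi * (1 - r))) =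
    sin (pi * (s - r)) * sin (pi * (1 - s)).
  have -> : 2 * pi * s - pi * (r + 1) = pi * (s - r) - pi * (1 - s) by ring.
  have -> : pi * (1 - r) = pi * (s - r) + pi * (1 - s) by ring.
  by rewrite cosB cosD; field.
have p0 : 0 < pi :> R by exact: pi_gt0.
rewrite pmulr_lgt0; last first.
  by apply: sin_gt0_pi; rewrite mulr_gt0//= ?gtr_pMr//; lra.
apply/idP/idP => [|rs].
  rewrite !ltNge; apply: contra => sr.
  rewrite -oppr_ge0 -sinN -mulrN opprB.
  move: sr; rewrite le_eqVlt => /predU1P[->|sr]; first by rewrite subrr mulr0 sin0.
  by apply/ltW/sin_gt0_pi; rewrite mulr_gt0//= ?gtr_pMr//; lra.
by apply: sin_gt0_pi; rewrite mulr_gt0//= ?gtr_pMr//; lra.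
Qed.

Lemma tgoodset_halfspace i (r : R) : tgoodset [set x | r < crd i x].
Proof.
have mr : measurable ([set x | r < crd i x] : set X3).
  have mc : measurable_fun setT (crd i : X3 -> X1).
    case: i => -[|[|[|//]]] Hi; rewrite /crd/=.
    - by apply: (@measurableT_comp _ _ _ _ _ _ fst) => //; exact: measurable_fst.
    - by apply: (@measurableT_comp _ _ _ _ _ _ snd) => //; exact: measurable_fst.
    - exact: measurable_snd.
  have := mc measurableT `]r, +oo[%classic (measurable_itv _).
  rewrite setTI; congr measurable; apply/seteqP; split => x /=;
    by rewrite in_itv/= andbT.
split; first exact: mr.
have bi : bmf (\1_[set x | r < crd i x] : X3 -> R) by exact: bmf_indic.
(* The measure sits on the open unit cube, where the half-space is everything if [r < 0] and empty
   if [1 <= r]. *)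
have [r0|r0] := ltP r 0.
  apply: (good_ae ker_bmf ker_ge0 ker_int1 ker_int2 bi (good_cst _ _ 1)).
  apply: ae_mono ae_cube => x /(_ i)/andP[x0 _].
  by rewrite indicE mem_set//=; exact: lt_trans x0.
have [r1|r1] := leP 1 r.
  apply: (good_ae ker_bmf ker_ge0 ker_int1 ker_int2 bi (good_cst _ _ 0)).
  apply: ae_mono ae_cube => x /(_ i)/andP[_ x1].
  rewrite indicE memNset//=; apply/negP; rewrite -leNgt.
  exact: le_trans (ltW x1) r1.
pose s x := 2^-1 * (cos (pi * (r + 1)) * cs i x + sin (pi * (r + 1)) * sn i x
                    + (- cos (pi * (1 - r)))).
have gs : tgood s.
  apply: (goodZ ker_bmf ker_ge0); apply: (goodD ker_bmf ker_ge0); last exact: good_cst.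
  apply: (goodD ker_bmf ker_ge0).
    by apply: (goodZ ker_bmf ker_ge0); exact: tgood_cs.
  by apply: (goodZ ker_bmf ker_ge0); exact: tgood_sn.
have [_ g0] := goodset_gt0 ker_bmf ker_ge0 ker_int1 ker_int2 gs.
apply: (good_ae ker_bmf ker_ge0 ker_int1 ker_int2 bi g0).
apply: ae_mono ae_cube => x /(_ i) x01.
have rE : (0 < s x) = (r < crd i x).
  rewrite -(sin_prod_gt0 (r := r) _ x01); last by rewrite r0 r1.
  by rewrite /s /cs /sn cosB [cos (pi * (r + 1)) * _]mulrC [sin (pi * (r + 1)) * _]mulrC.
by rewrite !indicE; congr (nat_of_bool _)%:R; apply/idP/idP => /set_mem h; apply/mem_set;
  move: h => /=; rewrite rE.
Qed.

(** Rays generate the Borel sets of each coordinate and rectangles generate the product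
    sigma-algebra; rectangles are intersections of sets depending on one coordinate. *)
Lemma tgoodset_all (A : set X3) : measurable A -> tgoodset A.
Proof.
have gX := @goodset_preimage _ _ _ torus ker ker_bmf ker_ge0 ker_int1 ker_int2.
have h1 i (B : set X1) : measurable B -> tgoodset (crd i @^-1` B).
  rewrite (_ : measurable B = <<s @RGenOInfty.G R >> B); last by rewrite RGenOInfty.measurableE.
  apply: (gX _ X1 _ (crd i : X3 -> X1)) => _ [r ->].
  have -> : crd i @^-1` `]r, +oo[%classic = [set x | r < crd i x].
    by apply/seteqP; split => x /=; rewrite in_itv/= andbT.
  exact: tgoodset_halfspace.
have gI := @goodsetI _ _ X3 torus ker ker_bmf ker_ge0.
have h2 (B : set (X1 * X1)%type) : measurable B -> tgoodset (fst @^-1` B).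
  rewrite measurable_prod_measurableType; apply: (gX _ (X1 * X1)%type _ (fst : X3 -> (X1 * X1)%type)).
  move=> _ [C mC [E mE <-]].
  have -> : (fst : X3 -> X1 * X1) @^-1` (C `*` E) = crd i0 @^-1` C `&` crd i1 @^-1` E by [].
  by apply: gI; exact: h1.
rewrite measurable_prod_measurableType; apply: (gX _ X3 _ id).
move=> _ [C mC [E mE <-]].
have -> : id @^-1` (C `*` E) = (fst : X3 -> X1 * X1) @^-1` C `&` crd i2 @^-1` E by [].
by apply: gI; [exact: h2|exact: h1].
Qed.

Lemma tgood_bmf f : bmf f -> tgood f.
Proof.
exact: (good_bmf ker_bmf ker_ge0 ker_int1 ker_int2 tgoodset_all).
Qed.

(** [kern_anti] moves the derivative to the variable of integration, where the weak gradient acts: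
    mollification commutes with the weak gradient. *)
Lemma mollified_gradient n f (g : X3 -> R) i (F : smf) (t0 : R) : bmf f ->
  (forall phi : smf,
    \int[torus]_x (f x * Dx i phi (t0, x)) = - \int[torus]_x (g x * phi (t0, x))) ->
  (forall v z, D v F z = \int[torus]_y (f y * D v (kern Tp n y) z)) ->
  forall t x, Dx i F (t, x) = \int[torus]_y (g y * ker n x y).
Proof.
move=> bf fg DF t x; rewrite DF.
have b : bmf (fun y : X3 => f y * Dx i (kern Tp n x) (t0, y)).
  by apply: bmfM => //; exact: smf_bmf_slice.
transitivity (\int[torus]_y (- (f y * Dx i (kern Tp n x) (t0, y)))).
  apply: eq_Rintegral => y _.
  exact: etrans (congr1 (fun c => f y * c) (kern_anti Tp i n t t0 x y)) (mulrN _ _).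
rewrite (bmf_RintegralN torus b) fg opprK; apply: eq_Rintegral => y _.
by congr (_ * _); exact: (kern_sym Tp n t0 0 y x).
Qed.

(* Testing the weak equation f = - div \int_0^tau j with the mollified f, and
   controlling the mollified gradient by Young's inequality. *)
Lemma interpolation f (g : 'I_3 -> X3 -> R) (j : 'I_3 -> X4 -> R) (tau dl t0 : R) :
  bmf f -> (forall i, bmf (g i)) -> (forall i, bmf (j i)) -> 0 < dl -> 0 <= tau ->
  (forall i (phi : smf),
    \int[torus]_x (f x * Dx i phi (t0, x)) = - \int[torus]_x (g i x * phi (t0, x))) ->
  (forall psi : smf, (forall t x, psi (t, x) = psi (0, x)) ->
    \int[torus]_x (f x * psi (0, x)) =
    \int[itv_measure 0 tau]_t \int[torus]_x (\sum_i j i (t, x) * Dx i psi (t, x))) ->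
  \int[torus]_x f x ^+ 2 <=
    (2 * dl)^-1 * (\int[itv_measure 0 tau]_t \int[torus]_x (\sum_i j i (t, x) ^+ 2))
    + dl / 2 * tau * \int[torus]_x (\sum_i g i x ^+ 2).
Proof.
move=> bf bg bj dl0 tau0 fg fj; set RHS := (X in _ <= X).
have bG n i : bmf (fun x : X3 => \int[torus]_y (g i y ^+ 2 * ker n x y)).
  have b : bmf (fun xy : X3 * X3 => g i xy.2 ^+ 2 * ker n xy.1 xy.2).
    by apply: bmfM (ker_bmf n); exact: (bmf2 (bmfX 2 (bg i))).
  exact: (bmf_fubini1 torus torus b).
have young (u v : R) : u * v <= (2 * dl)^-1 * u ^+ 2 + dl / 2 * v ^+ 2.
  have E : (2 * dl)^-1 * u ^+ 2 + dl / 2 * v ^+ 2 - u * v = (2 * dl)^-1 * (u - dl * v) ^+ 2.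
    by field; rewrite gt_eqF.
  by rewrite -subr_ge0 E mulr_ge0 ?sqr_ge0// invr_ge0 mulr_ge0 ?ltW.
(* By [osc_expand] the left side is the integral of [f] times its mollification [F], a smooth
   stationary test function. The right side is free of [n], so letting [n] grow removes the
   oscillation at the end. *)
have key n : \int[torus]_x f x ^+ 2 - 2^-1 * tosc n f <= RHS.
  have [_ _ mK] := mollifiable_kern Tp n; have [F [FE DF]] := mK f bf.
  have Ft t x : F (t, x) = F (0, x).
    rewrite !FE; apply: eq_Rintegral => y _.
    by rewrite (kern_sym Tp n t 0) (kern_sym Tp n 0 0).
  have DFE i t x := mollified_gradient bf (fg i) DF t x.
  have -> : \int[torus]_x f x ^+ 2 - 2^-1 * tosc n f = \int[torus]_x (f x * F (0, x)).
    rewrite (osc_expand ker_bmf ker_int1 ker_int2 n bf).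
    have -> : \int[torus]_x (f x * F (0, x)) = \int[torus]_x (f x * \int[torus]_y (f y * ker n x y)).
      by apply: eq_Rintegral => x _; rewrite FE.
    by field.
  rewrite (fj F Ft).
  have bS : bmf (fun z : X4 => \sum_i j i z ^+ 2) by apply: bmf_sum => i; exact: bmfX.
  have bI : bmf (fun t : X1 => \int[torus]_x (\sum_i j i (t, x) ^+ 2)) by exact: (bmf_fubini1 (itv_measure 0 tau) torus bS).
  have bDF : bmf (fun z : X4 => \sum_i j i z * Dx i F z).
    by apply: bmf_sum => i; apply: bmfM => //; exact: smf_bmf.
  (* Mollifying [g i ^ 2] preserves its integral, by the unit mass of the kernel. *)
  have gE : \int[torus]_x (\sum_i \int[torus]_y (g i y ^+ 2 * ker n x y)) =
      \int[torus]_x (\sum_i g i x ^+ 2).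
    rewrite !bmf_Rintegral_sum//; last by move=> i; exact: bmfX.
    apply: eq_bigr => i _.
    exact: (dint_ker2 ker_bmf ker_int1 n (bmfX 2 (bg i))).
  apply: (@le_trans _ _ (\int[itv_measure 0 tau]_t
      ((2 * dl)^-1 * \int[torus]_x (\sum_i j i (t, x) ^+ 2)
       + dl / 2 * \int[torus]_x (\sum_i g i x ^+ 2)))).
    apply: bmf_le_Rintegral.
    - exact: (bmf_fubini1 (itv_measure 0 tau) torus bDF).
    - by apply: bmfD; [apply: bmfM => //; exact: bmf_cst|exact: bmf_cst].
    move=> t.
    have bSt : bmf (fun x : X3 => \sum_i j i (t, x) ^+ 2) by exact: (bmf_slice t bS).
    have bGs : bmf (fun x : X3 => \sum_i \int[torus]_y (g i y ^+ 2 * ker n x y)).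
      by apply: bmf_sum.
    rewrite -gE -!bmf_RintegralZ// -bmf_RintegralD; last 2 first.
    - by apply: bmfM => //; exact: bmf_cst.
    - by apply: bmfM => //; exact: bmf_cst.
    apply: bmf_le_Rintegral; first exact: (bmf_slice t bDF).
      by apply: bmfD; apply: bmfM => //; exact: bmf_cst.
    move=> x; rewrite !mulr_sumr -big_split/=; apply: ler_sum => i _.
    rewrite [X in _ * X <= _](DFE i t x).
    exact: (young_ker ker_bmf ker_ge0 ker_int2 n x (bg i) (young _)).
  rewrite bmf_RintegralD; last 2 first.
  - by apply: bmfM => //; exact: bmf_cst.
  - exact: bmf_cst.
  rewrite (bmf_RintegralZ _ _ bI); move: (\int[torus]_x _) (\int[_]_t _) @RHS => a b RHS.
  have -> : \int[itv_measure 0 tau]__ (dl / 2 * a) = dl / 2 * a * tau.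
    transitivity (dl / 2 * a * fine (itv_measure 0 tau setT)); first exact: Rintegral_cst.
    by rewrite itv_measureT//= subr0.
  by rewrite /RHS -!mulrA [tau * _]mulrC.
have l0 : \int[torus]_x f x ^+ 2 - 2^-1 * tosc n f @[n --> \oo] -->
    \int[torus]_x f x ^+ 2 - (2^-1 * 0 : R).
  apply: cvgB; first exact: cvg_cst.
  by apply: cvgM; [exact: cvg_cst|exact: (tgood_bmf bf).2].
rewrite mulr0 subr0 in l0.
apply: limr_le_cvg l0 key.
Qed.

End Mollification.

(** * Polynomial approximation of the pressure potential *)

Section Bernstein.
Context {R : realType}.
Implicit Types (g h : nat -> R) (x : R).

(* [bern n g s] is the expectation of g(s + S) for a binomial(n, 'X) variable S. *)
Fixpoint bern (n : nat) g (s : nat) : {poly R} :=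
  if n is n'.+1 then 'X * bern n' g s.+1 + (1 - 'X) * bern n' g s else (g s)%:P.

Definition diff_seq g k := g k.+1 - g k.

Lemma bernS n g s x :
  (bern n.+1 g s).[x] = x * (bern n g s.+1).[x] + (1 - x) * (bern n g s).[x].
Proof. by rewrite /= !hornerE. Qed.

Lemma bern_diff n g s : bern n g s.+1 - bern n g s = bern n (diff_seq g) s.
Proof.
elim: n s => [|n IHn] s /=; first by rewrite -polyCB.
by rewrite -!IHn; ring.
Qed.

(** The reason for using Bernstein polynomials: their derivatives are again of this kind, for
    difference quotients of the function, so that one estimate, [bern_close], serves both
    convergences. *)
Lemma bern_deriv n g s : (bern n.+1 g s)^`() = (bern n (diff_seq g) s) *+ n.+1.
Proof.
elim: n s => [|n IHn] s.
  by rewrite -bern_diff /= derivD !derivM derivB derivX !derivC; ring.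
rewrite [bern n.+2 g s]/= derivD !derivM derivB derivX derivC sub0r -!/(bern n.+1 _ _) !IHn.
rewrite (_ : bern n.+1 (diff_seq g) s = 'X * bern n (diff_seq g) s.+1
  + (1 - 'X) * bern n (diff_seq g) s); last by [].
rewrite mul1r mulN1r addrACA bern_diff [bern n.+1 _ s]/= [RHS]mulrS.
by rewrite !mulrnAr -mulrnDl.
Qed.

Lemma le_bern n g h s x : 0 <= x <= 1 ->
  (forall k, (s <= k <= s + n)%N -> g k <= h k) -> (bern n g s).[x] <= (bern n h s).[x].
Proof.
move=> /andP[x0 x1]; elim: n s => [|n IHn] s gh.
  by rewrite /= !hornerC gh// addn0 leqnn.
rewrite !bernS lerD// ler_wpM2l ?subr_ge0// IHn// => k /andP[sk kn]; apply: gh.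
  by rewrite (ltnW sk)/= addnS.
by rewrite sk/= addnS leqW.
Qed.

Lemma bern_lin n g h (a b : R) s x :
  (bern n (fun k => a * g k + b * h k) s).[x] = a * (bern n g s).[x] + b * (bern n h s).[x].
Proof.
elim: n s => [|n IHn] s; first by rewrite /= !hornerC.
by rewrite !bernS !IHn; ring.
Qed.

Lemma bern_cst n (c : R) s x : (bern n (fun=> c) s).[x] = c.
Proof.
elim: n s => [|n IHn] s; first by rewrite /= hornerC.
by rewrite !bernS !IHn; ring.
Qed.

Lemma bern_sqr n (c : R) s x :
  (bern n (fun k => (k%:R - c) ^+ 2) s).[x] = (s%:R + n%:R * x - c) ^+ 2 + n%:R * (x * (1 - x)).
Proof.
elim: n s => [|n IHn] s; first by rewrite /= hornerC; ring.
by rewrite !bernS !IHn -!natr1; ring.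
Qed.

(** [bern] is linear, monotone and exact on constants, and the binomial variance [n x (1 - x)] is at
    most [n]: a deviation controlled by [e] plus a square averages to [e + A n]. *)
Lemma bern_close n g (c e A x : R) : 0 <= x <= 1 -> 0 <= A ->
  (forall k, (k <= n)%N -> `|g k - c| <= e + A * (k%:R - n%:R * x) ^+ 2) ->
  `|(bern n g 0).[x] - c| <= e + A * n%:R.
Proof.
move=> x01 A0 gc.
have H : (bern n (fun k => e * 1 + A * (k%:R - n%:R * x) ^+ 2) 0).[x] <= e + A * n%:R.
  rewrite bern_lin bern_cst bern_sqr mulr1 add0r subrr expr0n add0r lerD2l ler_wpM2l//.
  rewrite ler_piMr//; move: x01 => /andP[x0 x1]; nra.
have E : (bern n g 0).[x] - c = (bern n (fun k => 1 * g k + (-1) * c) 0).[x].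
  by rewrite bern_lin bern_cst; ring.
rewrite E ler_norml; apply/andP; split; [rewrite lerNl|]; apply: le_trans H.
  have -> : - (bern n (fun k => 1 * g k + (-1) * c) 0).[x] =
            (bern n (fun k => (-1) * g k + 1 * c) 0).[x].
    by rewrite !bern_lin !bern_cst; ring.
  apply: le_bern => // k /andP[_ kn]; have := gc k kn.
  by rewrite mulr1 ler_norml => /andP[+ _]; move: (_ + _ * _) => B; lra.
apply: le_bern => // k /andP[_ kn]; have := gc k kn.
by rewrite mulN1r !mul1r mulr1 ler_norml => /andP[].
Qed.

End Bernstein.

Section PolynomialApproximation.
Context {R : realType}.

Lemma cvg_harmonic_bound (u : nat -> R) (l : R) :
  (forall e, 0 < e -> exists B, forall n, `|u n - l| <= e + B / n.+1%:R) ->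
  u n @[n --> \oo] --> l.
Proof.
move=> ul; apply/cvgrPdist_le => e e0.
have e2 : 0 < e / 2 by rewrite divr_gt0.
have [B uB] := ul _ e2.
have B0 : (B * n.+1%:R^-1) @[n --> \oo] --> (B * 0 : R).
  by apply: cvgM; [exact: cvg_cst|exact: cvg_harmonic].
rewrite mulr0 in B0.
have /cvgrPdist_le/(_ _ e2) := B0; apply: filterS => n.
rewrite sub0r normrN => Bn; rewrite distrC (le_trans (uB n))//.
by move: Bn; rewrite ler_norml => /andP[_]; move: (_ / _) => c; lra.
Qed.

(** Near [r] continuity gives [e]. At distance at least [d] the difference is at most [2 C], hence
    at most [(2 C / d ^ 2) (y - r) ^ 2]. *)
Lemma quadratic_modulus (h : R -> R) (r C : R) (P : R -> Prop) : h @ r --> h r ->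
  (forall y, P y -> `|h y| <= C) -> P r ->
  forall e, 0 < e -> exists2 A, 0 <= A &
    forall y, P y -> `|h y - h r| <= e + A * (y - r) ^+ 2.
Proof.
move=> ch hC Pr e e0.
have /cvgrPdist_le/(_ _ e0) := ch => /nbhs_ballP[d /= d0 hd].
have C0 : 0 <= C := le_trans (normr_ge0 _) (hC r Pr).
exists (2 * C / d ^+ 2) => [|y Py]; first by rewrite divr_ge0 ?sqr_ge0 ?mulr_ge0.
have [yr|yr] := ltP `|r - y| d.
  rewrite distrC (le_trans (hd _ _))// lerDl mulr_ge0 ?sqr_ge0//.
  by rewrite divr_ge0 ?sqr_ge0 ?mulr_ge0.
have hh : `|h y - h r| <= 2 * C.
  by rewrite (le_trans (ler_normB _ _))// mulr_natl mulr2n lerD ?hC.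
rewrite (le_trans hh)// -[leLHS]add0r lerD//; first exact: ltW.
have C20 : 0 <= 2 * C by rewrite mulr_ge0.
move: (2 * C) C20 => c c0; rewrite -mulrA -[leLHS]mulr1 ler_wpM2l// mulrC ler_pdivlMr ?exprn_gt0// mul1r.
by rewrite -[leRHS]real_normK ?num_real// distrC lerXn2r ?nnegrE// ltW.
Qed.

(* C^1 functions on [a, b] are limits of polynomials, together with their
   derivatives, pointwise and with uniform bounds. *)
Lemma poly_C1_approx (a b : R) (F f : R -> R) (C : R) : a < b ->
  (forall r, a <= r <= b -> is_derive r (1 : R) F (f r)) ->
  (forall r, a <= r <= b -> f @ r --> f r) ->
  (forall r, a <= r <= b -> `|F r| <= C) -> (forall r, a <= r <= b -> `|f r| <= C) ->
  exists q : nat -> {poly R},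
    [/\ forall n r, a <= r <= b -> `|(q n).[r]| <= C /\ `|(q n)^`().[r]| <= C,
        forall r, a <= r <= b -> (q n).[r] @[n --> \oo] --> F r &
        forall r, a <= r <= b -> (q n)^`().[r] @[n --> \oo] --> f r].
Proof.
move=> ab dF cf bF bf.
have ba0 : 0 < b - a by rewrite subr_gt0.
have ban0 : b - a != 0 by rewrite gt_eqF.
pose l : {poly R} := (b - a)^-1 *: ('X - a%:P).
have lE r : l.[r] = (r - a) / (b - a) by rewrite /l !hornerE mulrC.
have l01 r : a <= r <= b -> 0 <= l.[r] <= 1.
  by move=> /andP[ar rb]; rewrite lE divr_ge0 ?subr_ge0 ?(ltW ab)//= ler_pdivrMr// mul1r lerD2r.
have rE r : r = a + (b - a) * l.[r] by rewrite lE; field.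
pose y n k : R := a + (b - a) * (k%:R / n.+1%:R).
have n0 n : 0 < n.+1%:R :> R by rewrite ltr0n.
have nn0 n : n.+1%:R != 0 :> R by rewrite gt_eqF.
have yab n k : (k <= n.+1)%N -> a <= y n k <= b.
  move=> kn; have k1 : k%:R / n.+1%:R <= 1 :> R by rewrite ler_pdivrMr// mul1r ler_nat.
  have k0 : 0 <= k%:R / n.+1%:R :> R by rewrite divr_ge0.
  by rewrite /y; move: (k%:R / _) k1 k0 => t t1 t0; apply/andP; split; nra.
pose G n k := F (y n k).
(* The difference quotients of [F] on the grid; the summand with factor 0 only gives the shape
   expected by [bern_lin]. *)
pose g n k := n.+1%:R / (b - a) * diff_seq (G n) k + 0 * diff_seq (G n) k.
pose q n := bern n.+1 (G n) 0 \Po l.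
have qE n r : (q n).[r] = (bern n.+1 (G n) 0).[l.[r]] by rewrite /q horner_comp.
have dqE n r : (q n)^`().[r] = (bern n (g n) 0).[l.[r]].
  rewrite /q deriv_comp hornerM horner_comp bern_deriv hornerMn bern_lin mul0r addr0.
  by rewrite /l derivZ derivB derivX derivC subr0 !hornerE -[LHS]mulrA -mulr_natl; ring.
(* By the mean value theorem the quotients are values of [f] between consecutive nodes, hence
   bounded by [C] and close to the values of [f] at the nodes. *)
have xi n k : (k <= n)%N -> exists c, [/\ a <= c <= b, y n k <= c <= y n k.+1 & g n k = f c].
  move=> kn; have yy : y n k.+1 - y n k = (b - a) / n.+1%:R.
    by rewrite /y -[k.+1%:R]natr1; move: (nn0 n); move: (n.+1%:R) => N N0; field.
  have ylt : y n k < y n k.+1 by rewrite -subr_gt0 yy divr_gt0.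
  have /andP[ya _] := yab n k (leqW kn); have /andP[_ yb] := yab n k.+1 kn.
  have cab c : y n k <= c <= y n k.+1 -> a <= c <= b.
    by move=> /andP[c1 c2]; rewrite (le_trans ya c1) (le_trans c2 yb).
  have [|c cy E] := @MVT_closed _ F f _ _ ylt; first by move=> x /cab; exact: dF.
  exists c; split => //; first exact: cab.
  rewrite /g mul0r addr0 /diff_seq /G E yy.
  by move: (nn0 n); move: (n.+1%:R) => N N0; field; rewrite N0.
exists q; split.
- move=> n r /l01 rab; rewrite qE dqE; split.
    suff : `|(bern n.+1 (G n) 0).[l.[r]] - 0| <= C + 0 * n.+1%:R by rewrite subr0 mul0r addr0.
    by apply: bern_close => // k kn; rewrite subr0 mul0r addr0 bF// yab.
  suff : `|(bern n (g n) 0).[l.[r]] - 0| <= C + 0 * n%:R by rewrite subr0 mul0r addr0.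
  apply: bern_close => // k kn; rewrite subr0 mul0r addr0.
  by have [c [cab _ ->]] := xi n k kn; exact: bf.
- move=> r rab; apply: cvg_harmonic_bound => e e0.
  have cF : F @ r --> F r.
    by have [dFr _] := dF r rab; exact/differentiable_continuous/derivable1_diffP.
  have [A A0 FA] := @quadratic_modulus F r C (fun r => a <= r <= b) cF bF rab e e0.
  exists (A * (b - a) ^+ 2) => n; rewrite qE.
  have -> : A * (b - a) ^+ 2 / n.+1%:R = A * (b - a) ^+ 2 / n.+1%:R ^+ 2 * n.+1%:R.
    by move: (nn0 n); move: (n.+1%:R) => N N0; field.
  apply: bern_close; first exact: l01.
    by apply: divr_ge0; [apply: mulr_ge0 => //; exact: sqr_ge0|exact: sqr_ge0].
  move=> k kn; rewrite (le_trans (FA _ (yab n k kn)))// lerD2l.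
  rewrite {1}(rE r) /y le_eqVlt; apply/orP; left; apply/eqP.
  by move: (nn0 n); move: (n.+1%:R) (k%:R) l.[r] => N K' x N0; field.
- move=> r rab; apply: cvg_harmonic_bound => e e0.
  have [A A0 fA] := @quadratic_modulus f r C (fun r => a <= r <= b) (cf r rab) bf rab e e0.
  exists (10 * A * (b - a) ^+ 2) => n; rewrite dqE.
  (* With mesh [u = (b - a) / (n + 1)], [w] is [A u ^ 2]. The point [c] lies within [u] of its node
     and the node at [u (z - x)] from [r], where [x = l.[r]] and [z = k - n x]; so
     [(c - r) ^ 2 <= u ^ 2 (4 z ^ 2 + 6)]. As [z ^ 2] averages to at most [n], the total is at most
     [10 w (n + 1)]. *)
  pose w := A * (b - a) ^+ 2 / n.+1%:R ^+ 2.
  have w0 : 0 <= w.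
    by apply: divr_ge0; [apply: mulr_ge0 => //; exact: sqr_ge0|exact: sqr_ge0].
  apply: (@le_trans _ _ ((e + 6 * w) + 4 * w * n%:R)); last first.
    have -> : 10 * A * (b - a) ^+ 2 / n.+1%:R = 10 * w * n.+1%:R.
      by rewrite /w; move: (nn0 n); move: (n.+1%:R) => N N0; field.
    rewrite -natr1 -subr_ge0 (_ : _ - _ = w * (4 + 6 * n%:R)); last by ring.
    by rewrite mulr_ge0// addr_ge0// mulr_ge0.
  apply: bern_close; [exact: l01|by rewrite mulr_ge0|].
  move=> k kn; have [c [cab cy ->]] := xi n k kn.
  rewrite (le_trans (fA _ cab))// -addrA lerD2l.
  have -> : 6 * w + 4 * w * (k%:R - n%:R * l.[r]) ^+ 2 =
     A * ((b - a) / n.+1%:R) ^+ 2 * (4 * (k%:R - n%:R * l.[r]) ^+ 2 + 6).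
    by rewrite /w; move: (nn0 n); move: (n.+1%:R) => N N0; field.
  rewrite -mulrA ler_wpM2l//.
  pose u := (b - a) / n.+1%:R; have u0 : 0 <= u by rewrite divr_ge0 ?ltW.
  rewrite -/u.
  have yE : y n k - r = u * (k%:R - n%:R * l.[r] - l.[r]).
    rewrite {1}(rE r) /y /u -[n.+1%:R]natr1; move: (nn0 n); rewrite -natr1.
    by move: (n%:R) (k%:R) l.[r] => N K' x N0; field.
  have yS : y n k.+1 = y n k + u.
    by rewrite /y /u -[k.+1%:R]natr1; move: (nn0 n); move: (n.+1%:R) => N N0; field.
  move: cy; rewrite yS => /andP[c1 c2].
  have /andP[x0 x1] := l01 r rab.
  have -> : c - r = (c - y n k) + (y n k - r) by ring.
  rewrite yE; move: (c - y n k) (lerB c1 (lexx (y n k))) (lerB c2 (lexx (y n k))).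
  rewrite subrr addrAC subrr add0r => t t0 tu.
  move: (l.[r]) x0 x1 => x x0 x1; move: (k%:R - n%:R * x) => z.
  have h1 : (t + u * (z - x)) ^+ 2 <= 2 * t ^+ 2 + 2 * (u * (z - x)) ^+ 2.
    by have := sqr_ge0 (t - u * (z - x)); nra.
  have h2 : (z - x) ^+ 2 <= 2 * z ^+ 2 + 2 by have := sqr_ge0 (z + x); nra.
  have h3 : t ^+ 2 <= u ^+ 2 by rewrite lerXn2r.
  rewrite (le_trans h1)// exprMn; have := sqr_ge0 u; move: (u ^+ 2) h3 => U h3 U0.
have : U * (z - x) ^+ 2 <= U * (2 * z ^+ 2 + 2) by rewrite ler_wpM2l.
move: (z ^+ 2) (t ^+ 2) ((z - x) ^+ 2) h3 => Z W Y h3 h4.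
by rewrite -subr_ge0 (_ : _ - _ = 2 * (U * (2 * Z + 2) - U * Y) + 2 * (U - W)); [lra|ring].
Qed.

End PolynomialApproximation.

(** * Calculus on the positive half-line and the pressure potential *)

Section PositiveHalfLine.
Context {R : realType}.
Implicit Types (f g p : R -> R) (a b r : R).

Definition pos_continuous f := forall r, 0 < r -> f @ r --> f r.

Lemma pos_continuous_within f a b : 0 < a -> pos_continuous f ->
  {within `[a, b], continuous f}.
Proof.
move=> a0 cf; apply: continuous_in_subspaceT => r /set_mem/=.
by rewrite in_itv/= => /andP[ar _]; apply: cf; exact: lt_le_trans ar.
Qed.

Lemma within_pos_continuous f (A : set R) : (forall r, 0 < r -> A^° r) ->
  {within A, continuous f} -> pos_continuous f.
Proof.
move=> iA cf r r0; have Ar := iA r r0.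
have /subspace_continuousP := cf => /(_ r (interior_subset Ar)).
apply: cvg_trans => //; apply: cvg_app.
by rewrite -[X in X --> _](within_interior Ar).
Qed.

Lemma pos_continuous_bounded f a b : 0 < a ->
  pos_continuous f -> exists C, forall r, a <= r <= b -> `|f r| <= C.
Proof.
move=> a0 cf; have [ba|ab] := ltP b a.
  by exists 0 => r /andP[ar rb]; have := lt_le_trans ba (le_trans ar rb); rewrite ltxx.
have cnf : {within `[a, b], continuous (fun r => `|f r|)}.
  by apply: pos_continuous_within => // r r0; apply: cvg_norm; exact: cf.
have [c _ fc] := EVT_max ab cnf.
by exists `|f c| => r rab; apply: fc; rewrite in_itv.
Qed.

Lemma bmf_pos_continuous d (X : measurableType d) f (u : X -> R) a b : 0 < a ->
  pos_continuous f -> measurable_fun setT u -> (forall x, a <= u x <= b) ->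
  bmf (fun x => f (u x)).
Proof.
move=> a0 cf mu uab; have [C fC] := pos_continuous_bounded b a0 cf.
split; last by exists C => x; exact: fC.
have -> : (fun x => f (u x)) = (fun r => f (Num.max a r)) \o u.
  by apply/funext => x /=; rewrite max_r//; case/andP: (uab x).
apply: measurableT_comp => //; apply: continuous_measurable_fun => r.
have cm : {for r, continuous (fun r => Num.max a r)}.
  have -> : (fun r => Num.max a r) = (fun=> a) \max id by [].
  by apply: continuous_max; [exact: cvg_cst|exact: cvg_id].
apply: (continuous_comp cm).
by apply: cf; rewrite lt_max a0.
Qed.

Lemma pos_derive_continuous f g : (forall r, 0 < r -> is_derive r (1 : R) f (g r)) ->
  pos_continuous f.
Proof.
by move=> df r r0; have [dr _] := df r r0; exact/differentiable_continuous/derivable1_diffP.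
Qed.

Lemma pos_lipschitz f g a b : 0 < a -> (forall r, 0 < r -> is_derive r (1 : R) f (g r)) ->
  pos_continuous g -> exists C, 0 <= C /\
  forall r s, a <= r <= b -> a <= s <= b -> `|f s - f r| <= C * `|s - r|.
Proof.
move=> a0 df cg; have [C gC] := pos_continuous_bounded b a0 cg.
exists `|C|; split => //.
suff H r s : a <= r <= b -> a <= s <= b -> r < s -> `|f s - f r| <= `|C| * `|s - r|.
  move=> r s rab sab; have [rs|sr|->] := ltgtP r s; first exact: H.
    by rewrite distrC (distrC s); exact: H.
  by rewrite !subrr normr0 mulr0.
move=> /andP[ar _] /andP[_ sb] rs.
have [|c /andP[rc cs] ->] := @MVT_closed _ f g _ _ rs.
  by move=> x /andP[rx _]; apply: df; rewrite (lt_le_trans a0)// (le_trans ar).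
rewrite normrM ler_wpM2r// (le_trans _ (ler_norm C))//.
by apply: gC; rewrite (le_trans ar rc) (le_trans cs sb).
Qed.

Lemma pos_taylor1 f g h a b : 0 < a -> (forall r, 0 < r -> is_derive r (1 : R) f (g r)) ->
  (forall r, 0 < r -> is_derive r (1 : R) g (h r)) -> pos_continuous h ->
  exists C, 0 <= C /\ forall r s, a <= r <= b -> a <= s <= b ->
    `|f s - f r - g r * (s - r)| <= C * (s - r) ^+ 2.
Proof.
move=> a0 df dg ch; have [C [C0 gC]] := pos_lipschitz b a0 dg ch.
exists C; split => // r s rab sab.
have H c : a <= c <= b -> `|c - r| <= `|s - r| ->
    `|g c * (s - r) - g r * (s - r)| <= C * (s - r) ^+ 2.
  move=> cab cs; rewrite -mulrBl normrM -[(s - r) ^+ 2]real_normK ?num_real// expr2 mulrA.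
  by rewrite ler_wpM2r// (le_trans (gC _ _ rab cab))// ler_wpM2l.
have dab x : a <= x -> is_derive x (1 : R) f (g x) by move=> ax; apply: df; exact: lt_le_trans ax.
move: rab sab => /andP[ar rb] /andP[as_ sb].
have [rs|sr|->] := ltgtP r s.
- have [|c /andP[rc cs] ->] := @MVT_closed _ f g _ _ rs.
    by move=> x /andP[rx _]; apply: dab; exact: le_trans rx.
  apply: H; first by rewrite (le_trans ar rc) (le_trans cs sb).
  by rewrite !ger0_norm ?subr_ge0//; [rewrite lerD2r|exact: le_trans cs].
- have [|c /andP[sc cr] E] := @MVT_closed _ f g _ _ sr.
    by move=> x /andP[rx _]; apply: dab; exact: le_trans rx.
  have -> : f s - f r = g c * (s - r) by rewrite -[LHS]opprB E; ring.
  apply: H; first by rewrite (le_trans as_ sc) (le_trans cr rb).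
  by rewrite !ler0_norm ?subr_le0//; [rewrite lerN2 lerD2r|exact: le_trans cr].
- by rewrite !subrr mulr0 subr0 normr0 expr0n mulr0.
Qed.

Lemma pos_antiderivative f : pos_continuous f -> forall r, 0 < r ->
  is_derive r (1 : R) (fun r => if 1 <= r then \int[lebesgue_measure]_(z in `[1, r]) f z
       else - \int[lebesgue_measure]_(z in `[r, 1]) f z) (f r).
Proof.
(* A base point below both [r] and 1: a single primitive starting at [c] represents the oriented
   integral from 1 on either side of 1. *)
move=> cf r r0; pose c : R := Num.min r 1 / 2.
have m0 : 0 < Num.min r 1 by rewrite lt_min r0 ltr01.
have c0 : 0 < c by rewrite divr_gt0.
have cm : c < Num.min r 1 by rewrite /c ltr_pdivrMr// ltr_pMr// ltr1n.
have [cr c1] : c < r /\ c < 1 by move: cm; rewrite lt_min => /andP[].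
have fi a b : c <= a -> lebesgue_measure.-integrable `[a, b] (EFin \o f).
  move=> ca; apply: continuous_compact_integrable; first exact: segment_compact.
  by apply: pos_continuous_within => //; exact: lt_le_trans ca.
pose F y := \int[lebesgue_measure]_(z in `[c, y]) f z.
have FB x y : c <= x -> x <= y -> F y - F x = \int[lebesgue_measure]_(z in `[x, y]) f z.
  move=> cx xy; rewrite /F Rintegral_itvB ?bnd_simp//; last exact: fi.
  rewrite Rintegral_itv_obnd_cbnd//.
  by apply: integrableS (fi x y cx) => //; exact: subset_itv_oc_cc.
have dF : is_derive r (1 : R) F (f r).
  have [||||d1 d2] := @continuous_FTC1_closed R f c r (r + 1).
  - by rewrite ltrDl.
  - exact: fi.
  - exact: cr.
  - exact: cf.
  by apply: DeriveDef; [exact: d1|rewrite -derive1E; exact: d2].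
have dG : is_derive r (1 : R) (fun y => F y - F 1) (f r).
  by rewrite -[f r]subr0; apply: is_deriveB.
apply: near_eq_is_derive dG.
have : nbhs r (fun y => c < y) by exact: lt_nbhsr.
apply: filterS => y cy; case: ifPn => [y1|]; first by rewrite FB// ltW.
by rewrite -ltNge => /ltW y1; rewrite -FB// ?ltW// opprB.
Qed.

(** [dp] is the derivative of [p] and [F] that of the pressure potential, whose second derivative is
    therefore [dp r / r]. *)
Record pressure_data p (dp F : R -> R) : Prop := PressureData {
  pd_derive : forall r, 0 < r -> is_derive r (1 : R) p (dp r);
  pd_potential' : forall r, 0 < r -> is_derive r (1 : R) F (dp r / r);
  pd_potential : forall r, 0 < r -> is_derive r (1 : R) (pressure_potential p) (F r);
  pd_legendre : forall r, 0 < r -> r * F r - pressure_potential p r = p r;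
  pd_continuous : pos_continuous dp;
  pd_derive2 : exists ddp, pos_continuous ddp /\
    forall r, 0 < r -> is_derive r (1 : R) dp (ddp r)
}.

Lemma pressure_regular_data p : pressure_regular p -> exists dp F, pressure_data p dp F.
Proof.
move=> [_ [dp [_ dpp [ddp [cddp dddp]]]]].
have cp := pos_derive_continuous dpp; have cdp := pos_derive_continuous dddp.
have cf : pos_continuous (fun z => p z / z ^+ 2).
  move=> r r0; apply: cvgM; first exact: cp.
  apply: cvgV; first by rewrite expf_neq0// gt_eqF.
  by apply: (@exprn_continuous _ 2).
pose Iz r : R := if 1 <= r then \int[lebesgue_measure]_(z in `[1, r]) (p z / z ^+ 2)
       else - \int[lebesgue_measure]_(z in `[r, 1]) (p z / z ^+ 2).
have dI r : 0 < r -> is_derive r (1 : R) Iz (p r / r ^+ 2) by exact: pos_antiderivative.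
have dV r : 0 < r -> is_derive r (1 : R) (fun r => r^-1) (- (r ^+ 2)^-1).
  move=> r0; have rn0 : r != 0 by rewrite gt_eqF.
  split; first exact: (@derivableV _ _ id).
  by rewrite (@deriveV _ _ id)// derive_id scaler1.
(* The potential is [r * Iz r], where [Iz] has derivative [p r / r ^ 2]; this is its derivative by
   the product rule. *)
exists dp, (fun r => Iz r + p r / r); split => //.
- move=> r r0.
  have -> : dp r / r = p r / r ^+ 2 + (p r * (- (r ^+ 2)^-1) + r^-1 * dp r).
    by field; rewrite gt_eqF.
  have := dpp r r0; have := dI r r0; have := dV r r0 => d1 d2 d3.
  by apply: is_deriveD; exact: is_deriveM.
- move=> r r0; have d1 := dI r r0.
  have -> : Iz r + p r / r = r * (p r / r ^+ 2) + Iz r * 1 by field; rewrite gt_eqF.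
  exact: is_deriveM.
- move=> r r0; rewrite /pressure_potential -/(Iz r); field; rewrite gt_eqF//.
- exists ddp; split => //.
  apply: (within_pos_continuous _ cddp) => r r0.
  by rewrite interior_itv_bndy /= in_itv/= r0.
Qed.

End PositiveHalfLine.

(** * Test functions of class C^1 *)

Section C1Functions.
Context {R : realType}.
Variable Tp : {posnum R}.
Notation smf := (smf Tp).
Notation D := (@smf_D _ Tp).
Notation Dx i := (smf_D (0, Defs.basis i)).
Notation R3 := (R * R * R)%type.
Notation X1 := (measurableTypeR R).
Notation X3 := (X1 * X1 * X1)%type.
Notation X4 := (X1 * X3)%type.
Notation torus := (@torus_measure R).

Lemma smf_poly (P : {poly R}) (u : smf) : exists S : smf,
  (forall z, S z = P.[u z]) /\ forall v z, D v S z = P^`().[u z] * D v u z.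
Proof.
elim/poly_ind: P => [|P c [S [SE DS]]].
  by exists 0; split => [z|v z]; rewrite ?smf_D0 ?deriv0 horner0 ?mul0r.
exists (S * u + smf_cst Tp c); split => [z|v z].
  by rewrite smfDE smfME SE hornerMXaddC.
rewrite smf_DD smf_Dcst addr0 smf_DM smfDE !smfME DS SE derivD derivC addr0 derivM derivX mulr1.
by rewrite !hornerE; ring.
Qed.

(* phi is a bounded pointwise limit of smooth functions, together with its
   derivatives dphi. *)
Definition C1lim (phi : X4 -> R) (dphi : R * R3 -> X4 -> R) : Prop :=
  exists S : nat -> smf,
    [/\ exists C, forall n z, `|S n z| <= C,
        forall v, exists C, forall n z, `|D v (S n) z| <= C,
        forall z, S n z @[n --> \oo] --> phi z &
        forall v z, D v (S n) z @[n --> \oo] --> dphi v z].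

Lemma C1lim_comp (a b : R) (F f : R -> R) (u : smf) : 0 < a -> a < b ->
  (forall z, a <= u z <= b) ->
  (forall r : R, 0 < r -> is_derive r (1 : R) F (f r)) -> pos_continuous f ->
  C1lim (fun z => F (u z)) (fun v z => f (u z) * D v u z).
Proof.
move=> a0 ab uab dF cf.
have pos r : a <= r <= b -> 0 < r by move=> /andP[/(lt_le_trans a0)].
have [C1 FC] := pos_continuous_bounded b a0 (pos_derive_continuous dF).
have [C2 fC] := pos_continuous_bounded b a0 cf.
have [q [qC qF qf]] : exists q : nat -> {poly R},
    [/\ forall n r, a <= r <= b -> `|(q n).[r]| <= Num.max C1 C2 /\
                                  `|(q n)^`().[r]| <= Num.max C1 C2,
        forall r, a <= r <= b -> (q n).[r] @[n --> \oo] --> F r &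
        forall r, a <= r <= b -> (q n)^`().[r] @[n --> \oo] --> f r].
  apply: poly_C1_approx => //; first by move=> r /pos; exact: dF.
  - by move=> r /pos; exact: cf.
  - by move=> r /FC h; rewrite le_max h.
  - by move=> r /fC h; rewrite le_max h orbT.
have [S SP] := choice (fun n => smf_poly (q n) u).
exists S; split.
- by exists (Num.max C1 C2) => n z; rewrite (SP n).1; exact: (qC n _ (uab z)).1.
- move=> v; have [C uC] := smf_bounded (D v u).
  exists (Num.max C1 C2 * C) => n z; rewrite (SP n).2 normrM ler_pM//.
  exact: (qC n _ (uab z)).2.
- move=> z; under eq_fun do rewrite (SP _).1.
  exact: qF.
- move=> v z; under eq_fun do rewrite (SP _).2.
  by apply: cvgM; [exact: qf|exact: cvg_cst].
Qed.

Lemma cvg_bounded_mul d (X : measurableType d) (mu : {finite_measure set X -> \bar R})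
    (g f : X -> R) (f_ : nat -> X -> R) (C : R) : bmf g ->
  (forall n, bmf (f_ n)) -> (forall n x, `|f_ n x| <= C) -> bmf f ->
  (forall x, f_ n x @[n --> \oo] --> f x) ->
  \int[mu]_x (g x * f_ n x) @[n --> \oo] --> \int[mu]_x (g x * f x).
Proof.
move=> bg bf_ fC bf ff; have [Cg gC] := bg.2.
apply: (@bmf_dcvg _ _ _ mu (fun n x => g x * f_ n x) (fun x => g x * f x) (Cg * C)).
- by move=> n; exact: (bmfM bg (bf_ n)).1.
- exact: (bmfM bg bf).1.
- by move=> n x; rewrite normrM ler_pM.
- by move=> x; apply: cvgM; [exact: cvg_cst|exact: ff].
Qed.

(** The identity is linear in the test function and its first derivatives, so bounded convergence
    carries it to the limit. It is used for the continuity equation tested with [F (r)] and, with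
    density 1 and no flux, for the time derivative of the integral of [p (r)]. *)
Lemma C1lim_identity (rho : X4 -> R) (r0 : X3 -> R) (j : 'I_3 -> X4 -> R) (tau : R) :
  bmf rho -> bmf r0 -> (forall i, bmf (j i)) ->
  (forall phi : smf, \int[torus]_x (rho (tau, x) * phi (tau, x))
     - \int[torus]_x (r0 x * phi (0, x)) =
     \int[itv_measure 0 tau]_t \int[torus]_x
       (rho (t, x) * D (1, 0) phi (t, x) + \sum_i j i (t, x) * Dx i phi (t, x))) ->
  forall phi dphi, C1lim phi dphi -> bmf phi -> (forall v, bmf (dphi v)) ->
  \int[torus]_x (rho (tau, x) * phi (tau, x))
     - \int[torus]_x (r0 x * phi (0, x)) =
     \int[itv_measure 0 tau]_t \int[torus]_x
       (rho (t, x) * dphi (1, 0) (t, x) + \sum_i j i (t, x) * dphi (0, Defs.basis i) (t, x)).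
Proof.
move=> br b0 bj H phi dphi [S [[C SC] SD Sphi Sdphi]] bphi bdphi.
have slice (r : X3 -> R) t : bmf r ->
    \int[torus]_x (r x * S n (t, x)) @[n --> \oo] --> \int[torus]_x (r x * phi (t, x)).
  move=> br'; apply: (@cvg_bounded_mul _ _ torus r (fun x => phi (t, x))
    (fun n x => S n (t, x)) C).
  - exact: br'.
  - by move=> n; exact: smf_bmf_slice.
  - by move=> n x; exact: SC.
  - exact: (bmf_slice t bphi).
  - by move=> x; exact: Sphi.
have lhs : (\int[torus]_x (rho (tau, x) * S n (tau, x)) -
    \int[torus]_x (r0 x * S n (0, x))) @[n --> \oo] -->
    \int[torus]_x (rho (tau, x) * phi (tau, x)) -
    \int[torus]_x (r0 x * phi (0, x)).
  by apply: cvgB; apply: slice => //; exact: (bmf_slice tau br).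
pose mu := (itv_measure 0 tau \x torus)%E.
have full (g : X4 -> R) (v : R * R3) : bmf g ->
    \int[itv_measure 0 tau]_t \int[torus]_x (g (t, x) * D v (S n) (t, x)) @[n --> \oo] -->
    \int[itv_measure 0 tau]_t \int[torus]_x (g (t, x) * dphi v (t, x)).
  move=> bg; have [C' DC] := SD v.
  have E (h : X4 -> R) : bmf h -> \int[itv_measure 0 tau]_t \int[torus]_x (g (t, x) * h (t, x))
      = \int[spacetime_measure tau]_z (g z * h z).
    by move=> bh; rewrite -(bmf_Rintegral_prod _ _ (bmfM bg bh)).
  rewrite (E _ (bdphi v)); under eq_fun => n do rewrite (E (D v (S n)) (smf_bmf _)).
  apply: (@cvg_bounded_mul _ _ (spacetime_measure tau) g (dphi v) (fun n => D v (S n)) C').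
  - exact: bg.
  - by move=> n; exact: smf_bmf.
  - exact: DC.
  - exact: bdphi.
  - exact: Sdphi.
have split_int (a : X4 -> R) (d : R * R3 -> X4 -> R) : bmf a -> (forall v, bmf (d v)) ->
  \int[itv_measure 0 tau]_t \int[torus]_x
       (a (t, x) * d (1, 0) (t, x) + \sum_i j i (t, x) * d (0, Defs.basis i) (t, x)) =
  \int[itv_measure 0 tau]_t \int[torus]_x (a (t, x) * d (1, 0) (t, x)) +
  \sum_i \int[itv_measure 0 tau]_t \int[torus]_x (j i (t, x) * d (0, Defs.basis i) (t, x)).
  move=> ba bd.
  have bad := bmfM ba (bd (1, 0)).
  have bjd i := bmfM (bj i) (bd (0, Defs.basis i)).
  rewrite -bmf_Rintegral_sum; last first.
    by move=> i; exact: (bmf_fubini1 (itv_measure 0 tau) torus (bjd i)).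
  rewrite -bmf_RintegralD; last 2 first.
  - exact: (bmf_fubini1 (itv_measure 0 tau) torus bad).
  - by apply: bmf_sum => i; exact: (bmf_fubini1 (itv_measure 0 tau) torus (bjd i)).
  apply: eq_Rintegral => t _.
  rewrite -bmf_Rintegral_sum; last by move=> i; exact: (bmf_slice t (bjd i)).
  rewrite -bmf_RintegralD//; first exact: (bmf_slice t bad).
  by apply: bmf_sum => i; exact: (bmf_slice t (bjd i)).
rewrite (split_int rho dphi br bdphi).
have rhs : (\int[itv_measure 0 tau]_t \int[torus]_x (rho (t, x) * D (1, 0) (S n) (t, x)) +
    \sum_i \int[itv_measure 0 tau]_t \int[torus]_x
      (j i (t, x) * Dx i (S n) (t, x))) @[n --> \oo] -->
    \int[itv_measure 0 tau]_t \int[torus]_x (rho (t, x) * dphi (1, 0) (t, x)) +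
    \sum_i \int[itv_measure 0 tau]_t \int[torus]_x
      (j i (t, x) * dphi (0, Defs.basis i) (t, x)).
  apply: cvgD; first exact: full.
  by apply: cvg_big => [|i _]; [exact: add_continuous|exact: full].
have E : (fun n => \int[torus]_x (rho (tau, x) * S n (tau, x)) -
                   \int[torus]_x (r0 x * S n (0, x))) =
    (fun n => \int[itv_measure 0 tau]_t \int[torus]_x (rho (t, x) * D (1, 0) (S n) (t, x)) +
      \sum_i \int[itv_measure 0 tau]_t \int[torus]_x (j i (t, x) * Dx i (S n) (t, x))).
  apply/funext => n; rewrite H.
  by apply: (split_int rho (fun v => D v (S n)) br) => v; exact: smf_bmf.
rewrite -E in rhs.
exact: (cvg_unique _ lhs rhs).
Qed.

Lemma C1lim_parts phi dphi (w : smf) i t : C1lim phi dphi -> bmf phi -> (forall v, bmf (dphi v)) ->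
  \int[torus]_x (dphi (0, Defs.basis i) (t, x) * w (t, x)) =
  - \int[torus]_x (phi (t, x) * Dx i w (t, x)).
Proof.
move=> [S [[C SC] SD Sphi Sdphi]] bphi bdphi.
have [C' DC] := SD (0, Defs.basis i).
have l1 := @cvg_bounded_mul _ _ torus (fun x => w (t, x)) (fun x => dphi (0, Defs.basis i) (t, x))
    (fun n x => Dx i (S n) (t, x)) C' (smf_bmf_slice w t) (fun n => smf_bmf_slice _ t)
    (fun n x => DC n (t, x)) (bmf_slice t (bdphi _)) (fun x => Sdphi _ (t, x)).
have l2 := @cvg_bounded_mul _ _ torus (fun x => Dx i w (t, x)) (fun x => phi (t, x))
    (fun n x => S n (t, x)) C (smf_bmf_slice _ t) (fun n => smf_bmf_slice _ t)
    (fun n x => SC n (t, x)) (bmf_slice t bphi) (fun x => Sphi (t, x)).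
transitivity (\int[torus]_x (w (t, x) * dphi (0, Defs.basis i) (t, x))).
  by apply: eq_Rintegral => x _; rewrite mulrC.
rewrite (_ : \int[torus]_x (phi (t, x) * Dx i w (t, x)) =
             \int[torus]_x (Dx i w (t, x) * phi (t, x))); last first.
  by apply: eq_Rintegral => x _; rewrite mulrC.
apply: (cvg_unique _ l1) => //.
have -> : (fun n => \int[torus]_x (w (t, x) * Dx i (S n) (t, x))) =
          (fun n => - \int[torus]_x (Dx i w (t, x) * S n (t, x))).
  apply/funext => n; rewrite (smf_int_parts w (S n) i t) opprK.
  by [].
exact: cvgN.
Qed.

End C1Functions.

(** * Relative energy *)

Section StrongSolution.
Context {R : realType}.
Variable Tp : {posnum R}.
Notation smf := (smf Tp).
Notation Dx i := (@smf_D _ Tp (0, Defs.basis i)).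
Notation Dt := (@smf_D _ Tp (1, 0)).
Variables (r Phi : smf) (U : 'I_3 -> smf) (m : R).
Hypothesis continuity : Dt r + \sum_i Dx i (r * U i) = 0.
Hypothesis poisson : \sum_i Dx i (Dx i Phi) = r - smf_cst Tp m.

Definition divergence (u : 'I_3 -> smf) : smf := \sum_i Dx i (u i).
Definition laplacian (f : smf) : smf := \sum_i Dx i (Dx i f).

(** Field and source collecting the third-order Korteweg terms: in [relative_pointwise] they
    multiply the gradient gap [Dr - r_] and the density gap [rho - r]. *)
Definition kort_flux (i : 'I_3) : smf :=
  - (Dx i (r * divergence U) + \sum_j Dx j r * (Dx j (U i) + Dx i (U j))).
Definition kort_source : smf :=
  \sum_i U i * Dx i (laplacian r) + Dt (laplacian r)
  - \sum_i Dx i r * Dx i (divergence U).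

(** After [Dt r] is replaced by [- div (r U)], the two sides differ by a double sum of the form
    [X i j - X j i], which vanishes. The Korteweg residue thus pairs a function and its weak
    gradient with a divergence and its field, and needs only first derivatives of the weak
    density. *)
Lemma kort_divergence : divergence kort_flux = kort_source.
Proof.
pose A i j := Dx i (Dx i (r * Dx j (U j))) + Dx i (Dx j r * (Dx j (U i) + Dx i (U j))).
pose B i j := Dx i (Dx i (Dx j (r * U j))) - U j * Dx j (Dx i (Dx i r))
  + Dx i r * Dx i (Dx j (U j)).
pose X i j := Dx i (Dx j r) * Dx j (U i) + Dx j r * Dx i (Dx j (U i)).
have AB i j : A i j - B i j = X i j - X j i.
  rewrite /A /B /X (smf_DC (0, Defs.basis j) (0, Defs.basis i) r).
  rewrite (smf_DC (0, Defs.basis j) (0, Defs.basis i) (U j)).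
  rewrite !(smf_DM, smf_DD).
  rewrite (smf_DC (0, Defs.basis j) (0, Defs.basis i) (Dx i r)).
  rewrite (smf_DC (0, Defs.basis j) (0, Defs.basis i) r).
  ring.
have EA : divergence kort_flux = - \sum_i \sum_j A i j.
  rewrite /divergence -sumrN; apply: eq_bigr => i _.
  rewrite /kort_flux /divergence smf_DN; congr (- _).
  by rewrite smf_DD mulr_sumr !smf_Dsum -big_split.
have EB : kort_source = - \sum_i \sum_j B i j.
  have Dtr : Dt r = - \sum_j Dx j (r * U j) by apply/eqP; rewrite -addr_eq0 continuity.
  have E1 : Dt (laplacian r) = - \sum_i \sum_j Dx i (Dx i (Dx j (r * U j))).
    rewrite /laplacian smf_Dsum -sumrN; apply: eq_bigr => i _.
    rewrite (smf_DC (1, 0) (0, Defs.basis i)) (smf_DC (1, 0) (0, Defs.basis i) r) Dtr.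
    by rewrite !smf_DN !smf_Dsum.
  have E2 : \sum_i U i * Dx i (laplacian r) = \sum_i \sum_j U j * Dx j (Dx i (Dx i r)).
    rewrite exchange_big/=; apply: eq_bigr => i _.
    by rewrite /laplacian smf_Dsum mulr_sumr.
  have E3 : \sum_i Dx i r * Dx i (divergence U) = \sum_i \sum_j Dx i r * Dx i (Dx j (U j)).
    by apply: eq_bigr => i _; rewrite /divergence smf_Dsum mulr_sumr.
  rewrite /kort_source E1 E2 E3 -!sumrN -!big_split/=; apply: eq_bigr => i _.
  rewrite -!sumrN -!big_split/=; apply: eq_bigr => j _.
  by rewrite /B; ring.
rewrite EA EB; congr (- _); apply/eqP; rewrite -subr_eq0 -sumrB.
under eq_bigr do rewrite -sumrB.
under eq_bigr => i _ do under eq_bigr => j _ do rewrite AB.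
under eq_bigr do rewrite sumrB.
by rewrite sumrB [X in _ - X]exchange_big/= subrr.
Qed.

(** The time derivative of the Poisson equation shows that the Laplacian of [Dt Phi] is [Dt r],
    which the continuity equation cancels. Gradients being orthogonal to this field, the gap between
    the weak and the classical electric field drops out against it. *)
Lemma flux_divergence_free : divergence (fun i => r * U i + Dx i (Dt Phi)) = 0.
Proof.
rewrite /divergence; under eq_bigr do rewrite smf_DD.
rewrite big_split/= -[RHS]continuity addrC; congr (_ + _).
have -> : Dt r = Dt (r - smf_cst Tp m) by rewrite smf_DB smf_Dcst subr0.
rewrite -poisson smf_Dsum; apply: eq_bigr => i _.
by rewrite (smf_DC (1, 0) (0, Defs.basis i)) (smf_DC (1, 0) (0, Defs.basis i) Phi).
Qed.

End StrongSolution.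

(** * Algebraic identities between the densities *)

Section Pointwise.
Context {R : realType}.
Implicit Types (a b : 'I_3 -> R).

Lemma sum3 (V : nmodType) (f : 'I_3 -> V) : \sum_i f i = f 0 + (f 1 + f 2).
Proof.
rewrite !big_ord_recl big_ord0 addr0.
by congr (f _ + (f _ + f _)); apply: val_inj.
Qed.

(** Values at one point: [prho], [pr], [dpr] stand for [p (rho)], [p (r)], [p' (r)]; [Dr] and [G]
    for the weak gradients of [rho] and [V]; [r_], [Phi_], [lap_], [div_] for the gradients of [r],
    of [Phi], of the Laplacian of [r] and of [div U]. The marker [_t] is a time derivative, and
    [DU i j] is the derivative of [U j] in direction [i]. *)
Variables (K rho r r_t dpr prho pr lap_t Phi_t : R).
Variables (J Dr G U r_ lap_ Phi_ Phi_t_ r_t_ div_ U_t : 'I_3 -> R) (DU : 'I_3 -> 'I_3 -> R).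
Hypotheses (rho0 : rho != 0) (r0 : r != 0).
Let divU := \sum_i DU i i.
Hypothesis continuity : r_t + \sum_i (r_ i * U i + r * DU i i) = 0.
Hypothesis velocity : forall i,
  U_t i + \sum_j U j * DU j i + U i + dpr / r * r_ i - K * lap_ i - Phi_ i = 0.

(** Integrand of the weak momentum equation tested with [U], all terms brought to one side. *)
Definition mom_density : R :=
  \sum_i J i * U_t i + \sum_i \sum_j J i * J j / rho * DU j i + prho * divU
  + K * (2^-1 * (\sum_i Dr i ^+ 2) * divU + rho * (\sum_i Dr i * div_ i)
         + \sum_i \sum_j Dr i * Dr j * DU j i)
  - \sum_i J i * U i + rho * \sum_i G i * U i.

(** Integrand of the weak continuity equation tested with [- |U|^2 / 2 - K lap - Phi]. *)
Definition test_density : R :=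
  rho * (- (\sum_i U i * U_t i) - K * lap_t - Phi_t)
  + \sum_i J i * (- (\sum_j U j * DU i j) - K * lap_ i - Phi_ i).

(** The first summand is the damping. All others are quadratic in the gaps [J - rho U], [rho - r],
    [Dr - r_] and [G - Phi_], the pressure term by Taylor's formula. *)
Definition rel_density : R :=
  (\sum_i (J i - rho * U i) ^+ 2) / rho
  + \sum_i \sum_j (J i - rho * U i) * (J j - rho * U j) / rho * DU j i
  + (prho - pr - dpr * (rho - r)) * divU
  + K * (2^-1 * (\sum_i (Dr i - r_ i) ^+ 2) * divU
         + (rho - r) * (\sum_i (Dr i - r_ i) * div_ i)
         + \sum_i \sum_j (Dr i - r_ i) * (Dr j - r_ j) * DU j i)
  + (rho - r) * \sum_i U i * (G i - Phi_ i).

Definition kflux i : R := - (r_ i * divU + r * div_ i + \sum_j r_ j * (DU j i + DU i j)).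
Definition ksource : R := \sum_i U i * lap_ i + lap_t - \sum_i r_ i * div_ i.

(** Eliminating [r_t] by the continuity equation and [U_t] by the velocity equation leaves a
    rational identity. The right side is grouped so that everything except [rel_density] integrates
    to zero: the pressure divergence, three Korteweg pairings and the two Poisson terms. *)
Lemma relative_pointwise :
  (\sum_i J i ^+ 2) / rho + mom_density + test_density
  + (rho * (dpr / r * r_t) + \sum_i J i * (dpr / r * r_ i))
  - (K * (\sum_i r_ i * r_t_ i) + \sum_i Phi_ i * Phi_t_ i) - dpr * r_t =
  rel_density + (dpr * (\sum_i r_ i * U i) + pr * divU)
  - K * (\sum_i (Dr i - r_ i) * kflux i + (rho - r) * ksource)
  - K * (2^-1 * (\sum_i r_ i * kflux i + r * ksource))
  - K * (2^-1 * r * (\sum_i U i * lap_ i) + 2^-1 * r * lap_t + \sum_i r_ i * r_t_ i)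
  + (\sum_i (r * U i + Phi_t_ i) * (G i - Phi_ i) - (rho * Phi_t + \sum_i G i * Phi_t_ i)).
Proof.
have -> : r_t = - \sum_i (r_ i * U i + r * DU i i).
  by apply/eqP; rewrite -addr_eq0 continuity.
rewrite /mom_density /test_density /rel_density /kflux /ksource /divU.
have Ut i : U_t i = K * lap_ i + Phi_ i - \sum_j U j * DU j i - U i - dpr / r * r_ i.
  by apply/eqP; rewrite -subr_eq0 -[X in _ == X](velocity i); apply/eqP; ring.
rewrite !sum3 !Ut !sum3.
move: (Dr 0) (Dr 1) (Dr 2) (r_ 0) (r_ 1) (r_ 2) (div_ 0) (div_ 1) (div_ 2) (lap_ 0) (lap_ 1) (lap_ 2).
move: (r_t_ 0) (r_t_ 1) (r_t_ 2) (U 0) (U 1) (U 2) (DU 0 0) (DU 0 1) (DU 0 2) (DU 1 0) (DU 1 1) (DU 1 2) (DU 2 0) (DU 2 1) (DU 2 2).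
move: (J 0) (J 1) (J 2) (G 0) (G 1) (G 2) (Phi_ 0) (Phi_ 1) (Phi_ 2) (Phi_t_ 0) (Phi_t_ 1) (Phi_t_ 2).
move: rho0 r0; clear; move=> rho0 r0 *; field.
by rewrite rho0 r0.
Qed.

Variables (Prho Pr F Phi h : R) (lap : R).
Hypothesis legendre : r * F - Pr = pr.

Definition energy_density : R :=
  2^-1 * ((\sum_i J i ^+ 2) / rho) + Prho + K / 2 * (\sum_i Dr i ^+ 2)
  + 2^-1 * \sum_i G i ^+ 2.

Definition rel_energy_density : R :=
  2^-1 * ((\sum_i (J i - rho * U i) ^+ 2) / rho)
  + K / 2 * (\sum_i (Dr i - r_ i) ^+ 2) + 2^-1 * \sum_i (G i - Phi_ i) ^+ 2.

(** Expanding the squares yields the tested quantities and two last terms that integrate to zero by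
    the weak gradient and Poisson identities; the Legendre relation brings in the pressure. *)
Lemma energy_pointwise :
  rel_energy_density + (Prho - Pr - F * (rho - r)) =
  energy_density
  - (\sum_i J i * U i + rho * (- (2^-1 * \sum_i U i ^+ 2) - K * lap - Phi) + rho * F)
  + (K / 2 * (\sum_i r_ i ^+ 2) + 2^-1 * (\sum_i Phi_ i ^+ 2) + pr)
  - K * (\sum_i Dr i * r_ i + rho * lap) - (\sum_i G i * Phi_ i + rho * Phi).
Proof.
rewrite /rel_energy_density /energy_density -legendre !sum3.
move: (Dr 0) (Dr 1) (Dr 2) (r_ 0) (r_ 1) (r_ 2) (U 0) (U 1) (U 2).
move: (J 0) (J 1) (J 2) (G 0) (G 1) (G 2) (Phi_ 0) (Phi_ 1) (Phi_ 2).
move=> *; field; exact: rho0.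
Qed.

End Pointwise.

Section Bounds.
Context {R : realType}.
Implicit Types (a b : 'I_3 -> R).

Lemma quadratic_form_bound a (M : 'I_3 -> 'I_3 -> R) (B : R) :
  (forall i j, `|M i j| <= B) ->
  `|\sum_i \sum_j a i * a j * M j i| <= 3 * B * \sum_i a i ^+ 2.
Proof.
move=> MB; have B0 : 0 <= B := le_trans (normr_ge0 _) (MB 0 0).
have h i j : `|a i * a j * M j i| <= B / 2 * (a i ^+ 2 + a j ^+ 2).
  rewrite !normrM; apply: (@le_trans _ _ (`|a i| * `|a j| * B)); first by rewrite ler_wpM2l.
  have := sqr_ge0 (`|a i| - `|a j|); rewrite sqrrB !real_normK ?num_real// => h.
  rewrite -subr_ge0.
  rewrite (_ : _ - _ = B / 2 * (a i ^+ 2 - `|a i| * `|a j| *+ 2 + a j ^+ 2)); last by field.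
  by rewrite mulr_ge0// divr_ge0.
rewrite (le_trans (ler_norm_sum _ _ _))//.
apply: (@le_trans _ _ (\sum_i \sum_j B / 2 * (a i ^+ 2 + a j ^+ 2))).
  by apply: ler_sum => i _; rewrite (le_trans (ler_norm_sum _ _ _))//; apply: ler_sum.
by rewrite le_eqVlt; apply/orP; left; apply/eqP; rewrite !sum3; field.
Qed.

Lemma scalar_form_bound a b (s B : R) : 0 <= B -> (forall i, `|b i| <= B) ->
  `|s * \sum_i a i * b i| <= B * (2 * s ^+ 2 + \sum_i a i ^+ 2).
Proof.
move=> B0 bB; rewrite mulr_sumr (le_trans (ler_norm_sum _ _ _))//.
apply: (@le_trans _ _ (\sum_i B / 2 * (s ^+ 2 + a i ^+ 2))).
  apply: ler_sum => i _; rewrite !normrM mulrA.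
  apply: (@le_trans _ _ (`|s| * `|a i| * B)); first by rewrite ler_wpM2l// mulr_ge0.
  have := sqr_ge0 (`|s| - `|a i|); rewrite sqrrB !real_normK ?num_real// => h.
  rewrite -subr_ge0.
  rewrite (_ : _ - _ = B / 2 * (s ^+ 2 - `|s| * `|a i| *+ 2 + a i ^+ 2)); last by field.
  by rewrite mulr_ge0// divr_ge0.
rewrite !sum3 -subr_ge0.
rewrite (_ : _ - _ = B / 2 * (s ^+ 2 + (a 0 ^+ 2 + (a 1 ^+ 2 + a 2 ^+ 2)))); last by field.
by rewrite mulr_ge0 ?divr_ge0// ?addr_ge0 ?sqr_ge0.
Qed.

(** [A], [D2], [W2], [S] are the squared gaps, and the damping [- A] has the good sign. The gradient
    part asks for [11/2 K B D2] against the weight [K / 2], which [12 B] covers; the other two terms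
    of the constant are dictated by [S]. *)
Lemma rel_bound_aux (K B Cp A D2 W2 S Q Pd Dd dd Sd Sw : R) :
  0 < K -> 0 <= B -> 0 <= Cp -> 0 <= A -> 0 <= D2 -> 0 <= W2 -> 0 <= S ->
  `|Q| <= 3 * B * A -> `|Pd| <= 3 * B * Cp * S -> `|Dd| <= 3 * B * D2 ->
  `|dd| <= 3 * B * D2 -> `|Sd| <= B * (2 * S + D2) -> `|Sw| <= B * (2 * S + W2) ->
  - (A + Q + Pd + K * (2^-1 * Dd + Sd + dd) + Sw) <=
  (12 * B + 3 * B * Cp + 2 * K * B) * (2^-1 * A + K / 2 * D2 + 2^-1 * W2 + S).
Proof.
move=> K0 B0 Cp0 A0 D0 W0 S0; rewrite !ler_norml.
move=> /andP[h1 _] /andP[h2 _] /andP[h3 _] /andP[h4 _] /andP[h5 _] /andP[h6 _].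
have h : K * (- (2^-1 * Dd + Sd + dd)) <= K * (2^-1 * (3 * B * D2) + B * (2 * S + D2) + 3 * B * D2).
  by rewrite ler_wpM2l ?(ltW K0)//; lra.
have BA : 0 <= B * A by rewrite mulr_ge0.
have BS : 0 <= B * S by rewrite mulr_ge0.
have BW : 0 <= B * W2 by rewrite mulr_ge0.
have K1 := ltW K0.
have KB : 0 <= K * B by rewrite mulr_ge0.
have BC : 0 <= B * Cp by rewrite mulr_ge0.
have KBD : 0 <= K * B * D2 by rewrite mulr_ge0.
have KBA : 0 <= K * B * A by rewrite mulr_ge0.
have KBW : 0 <= K * B * W2 by rewrite mulr_ge0.
have KKBD : 0 <= K * B * D2 * K by rewrite mulr_ge0.
have BCA : 0 <= B * Cp * A by rewrite mulr_ge0.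
have BCW : 0 <= B * Cp * W2 by rewrite mulr_ge0.
have BCKD : 0 <= B * Cp * (K * D2) by rewrite mulr_ge0// mulr_ge0.
have KBS : 0 <= K * B * S by rewrite mulr_ge0.
have BCS : 0 <= B * Cp * S by rewrite mulr_ge0.
lra.
Qed.

Lemma rel_density_bound (K rho r dpr prho pr B Cp : R) (J Dr G U r_ Phi_ div_ : 'I_3 -> R)
    (DU : 'I_3 -> 'I_3 -> R) : 0 < K -> 0 < rho -> 0 <= Cp ->
  (forall i j, `|DU i j| <= B) -> (forall i, `|U i| <= B) -> (forall i, `|div_ i| <= B) ->
  `|prho - pr - dpr * (rho - r)| <= Cp * (rho - r) ^+ 2 ->
  - rel_density K rho r dpr prho pr J Dr G U r_ Phi_ div_ DU <=
  (12 * B + 3 * B * Cp + 2 * K * B) *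
    (rel_energy_density K rho J Dr G U r_ Phi_ + (rho - r) ^+ 2).
Proof.
move=> K0 rho0 Cp0 DUB UB divB pB.
have B0 : 0 <= B := le_trans (normr_ge0 _) (UB 0).
rewrite /rel_density /rel_energy_density.
pose mm i := J i - rho * U i; pose d i := Dr i - r_ i; pose w i := G i - Phi_ i.
have -> : \sum_i \sum_j (J i - rho * U i) * (J j - rho * U j) / rho * DU j i =
    (\sum_i \sum_j mm i * mm j * DU j i) / rho.
  rewrite mulr_suml; apply: eq_bigr => i _; rewrite mulr_suml; apply: eq_bigr => j _.
  by rewrite /mm mulrAC.
have := quadratic_form_bound mm DUB; have := quadratic_form_bound d DUB.
have := scalar_form_bound d (rho - r) B0 divB.
have := scalar_form_bound w (rho - r) B0 UB.
rewrite -/(mm _) [\sum_i U i * _](eq_bigr (fun i => w i * U i)); last by move=> i _; rewrite mulrC.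
have : `|\sum_i DU i i| <= 3 * B.
  rewrite (le_trans (ler_norm_sum _ _ _))// sum3 (_ : 3 * B = B + (B + B)); last by ring.
  by rewrite !lerD.
have M0 : 0 <= \sum_i mm i ^+ 2 by apply: sumr_ge0 => i _; exact: sqr_ge0.
have D0 : 0 <= \sum_i d i ^+ 2 by apply: sumr_ge0 => i _; exact: sqr_ge0.
have W0 : 0 <= \sum_i w i ^+ 2 by apply: sumr_ge0 => i _; exact: sqr_ge0.
rewrite /mm /d /w in M0 D0 W0 *; move: M0 D0 W0.
move: (\sum_i (J i - rho * U i) ^+ 2) (\sum_i (Dr i - r_ i) ^+ 2) (\sum_i (G i - Phi_ i) ^+ 2).
move=> M2 D2 W2 M0 D0 W0; rewrite !mulrA.
move: (\sum_i \sum_j (J i - _) * _ * _) (\sum_i \sum_j (Dr i - _) * _ * _) => q dd.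
move: (\sum_i (Dr i - _) * _) (\sum_i (G i - _) * _) (\sum_i DU i i) => sd sw dv.
move: (sqr_ge0 (rho - r)) pB; move: (prho - pr - _) => P; move: (rho - r) => s.
move=> s0 pB dvB swB sdB ddB qB.
have pdv : `|P * dv| <= 3 * B * Cp * s ^+ 2.
  by rewrite normrM mulrC (le_trans (ler_pM _ _ dvB pB))// !mulrA.
have Ddv : `|D2 * dv| <= 3 * B * D2.
  by rewrite normrM (ger0_norm D0) mulrC ler_wpM2r.
have qr : `|q / rho| <= 3 * B * (M2 / rho).
  by rewrite normrM normfV (gtr0_norm rho0) mulrA ler_wpM2r// invr_ge0 ltW.
have Mr : 0 <= M2 / rho by rewrite divr_ge0// ltW.
rewrite -!mulrA -!expr2 [2^-1 * (M2 / _)]mulrA in swB sdB *.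
have H := rel_bound_aux K0 B0 Cp0 Mr D0 W0 s0 qr pdv Ddv ddB sdB swB.
apply: (le_trans _ (le_trans H _)); rewrite le_eqVlt; apply/orP; left; apply/eqP.
  by field; rewrite gt_eqF.
by field; rewrite gt_eqF.
Qed.

(** [J - r U] is [(J - rho U) + (rho - r) U], and the first part costs a factor [rho <= b] against
    the kinetic density. The flux of the interpolation inequality is thereby controlled. *)
Lemma flux_gap_bound (K rho r B b : R) (J Dr G U r_ Phi_ : 'I_3 -> R) :
  0 <= K -> 0 < rho -> rho <= b -> 0 <= B -> (forall i, `|U i| <= B) ->
  \sum_i (J i - r * U i) ^+ 2 <=
  (4 * b + 6 * B ^+ 2) * (rel_energy_density K rho J Dr G U r_ Phi_ + (rho - r) ^+ 2).
Proof.
move=> K0 rho0 rb B0 UB.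
have b0 : 0 <= b := le_trans (ltW rho0) rb.
pose e1 := (\sum_i (J i - rho * U i) ^+ 2) / rho.
have M0 : 0 <= \sum_i (J i - rho * U i) ^+ 2 by apply: sumr_ge0 => i _; exact: sqr_ge0.
have e10 : 0 <= e1 by rewrite divr_ge0// ltW.
have h1 : \sum_i (J i - r * U i) ^+ 2 <= 2 * b * e1 + 6 * B ^+ 2 * (rho - r) ^+ 2.
  have h : \sum_i (J i - rho * U i) ^+ 2 <= b * e1.
    by rewrite /e1 mulrA ler_pdivlMr// mulrC ler_wpM2r.
  apply: (@le_trans _ _ (\sum_i (2 * (J i - rho * U i) ^+ 2 + 2 * B ^+ 2 * (rho - r) ^+ 2))).
    apply: ler_sum => i _.
    have -> : J i - r * U i = (J i - rho * U i) + (rho - r) * U i by ring.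
    move: (J i - rho * U i) (rho - r) => x s.
    have UB2 : U i ^+ 2 <= B ^+ 2.
      by rewrite -[U i ^+ 2]real_normK ?num_real// lerXn2r ?nnegrE.
    rewrite -subr_ge0.
    rewrite (_ : _ - _ = (x - s * U i) ^+ 2 + 2 * (s ^+ 2 * (B ^+ 2 - U i ^+ 2))); last by ring.
    by rewrite addr_ge0 ?sqr_ge0// mulr_ge0// mulr_ge0 ?sqr_ge0// subr_ge0.
  rewrite big_split/= -mulr_sumr [X in _ + X <= _](_ : _ = 6 * B ^+ 2 * (rho - r) ^+ 2).
    by rewrite lerD2r -mulrA ler_wpM2l.
  by rewrite sum3; ring.
have h2 : e1 <= 2 * rel_energy_density K rho J Dr G U r_ Phi_.
  rewrite /rel_energy_density -/e1.
  have D0 : 0 <= K / 2 * \sum_i (Dr i - r_ i) ^+ 2.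
    by rewrite mulr_ge0 ?divr_ge0//; apply: sumr_ge0 => i _; exact: sqr_ge0.
  have W0 : 0 <= \sum_i (G i - Phi_ i) ^+ 2 by apply: sumr_ge0 => i _; exact: sqr_ge0.
  lra.
rewrite (le_trans h1)//; clear h1; clearbody e1.
have s0 := sqr_ge0 (rho - r); have B20 := sqr_ge0 B.
move: (rel_energy_density _ _ _ _ _ _ _ _) e1 (B ^+ 2) ((rho - r) ^+ 2) h2 e10 s0 B20 => E f B2 S h2 f0 S0 B20.
have E0 : 0 <= E by lra.
have := mulr_ge0 B20 E0; have := mulr_ge0 b0 S0.
have : b * f <= b * (2 * E) by rewrite ler_wpM2l.
lra.
Qed.

End Bounds.

Ltac bmf_tac := repeat (first [assumption | lazymatch goal with
  | |- forall _, _ => move=> ?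
  | |- bmf (fun x => bigop _ _ _) => apply: bmf_sum => ?
  | |- bmf (fun x => GRing.add _ _) => apply: bmfD
  | |- bmf (fun x => GRing.opp _) => apply: bmfN
  | |- bmf (fun x => GRing.mul _ _) => apply: bmfM
  | |- bmf (fun x => GRing.exp _ _) => apply: bmfX
  | |- _ => first [exact: bmf_cst | done]
  end]).

Section IntegratedDensities.
Context {R : realType} d (X : measurableType d) (mu : {finite_measure set X -> \bar R}).
Variables (K a : R).
Variables (rho r r_t dpr prho pr lap_t Phi_t Prho Pr F Phi lap : X -> R).
Variables (J Dr G U r_ lap_ Phi_ Phi_t_ r_t_ div_ U_t : 'I_3 -> X -> R).
Variable (DU : 'I_3 -> 'I_3 -> X -> R).
Hypotheses (b_rho : bmf rho) (b_r : bmf r) (b_r_t : bmf r_t) (b_dpr : bmf dpr)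
  (b_prho : bmf prho) (b_pr : bmf pr) (b_lap_t : bmf lap_t) (b_Phi_t : bmf Phi_t)
  (b_Prho : bmf Prho) (b_Pr : bmf Pr) (b_F : bmf F) (b_Phi : bmf Phi) (b_lap : bmf lap).
Hypotheses (b_J : forall i, bmf (J i)) (b_Dr : forall i, bmf (Dr i))
  (b_G : forall i, bmf (G i)) (b_U : forall i, bmf (U i)) (b_r_ : forall i, bmf (r_ i))
  (b_lap_ : forall i, bmf (lap_ i)) (b_Phi_ : forall i, bmf (Phi_ i))
  (b_Phi_t_ : forall i, bmf (Phi_t_ i)) (b_r_t_ : forall i, bmf (r_t_ i))
  (b_div_ : forall i, bmf (div_ i)) (b_U_t : forall i, bmf (U_t i))
  (b_DU : forall i j, bmf (DU i j)).
Hypotheses (a0 : 0 < a) (rho_ge : forall x, a <= rho x) (r_ge : forall x, a <= r x).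

Let b_rhoV : bmf (fun x => (rho x)^-1). Proof. exact: (bmfV a0). Qed.
Let b_rV : bmf (fun x => (r x)^-1). Proof. exact: (bmfV a0). Qed.

Lemma bmf_kinetic : bmf (fun x => (\sum_i J i x ^+ 2) / rho x).
Proof. by bmf_tac. Qed.

Lemma bmf_mom_density : bmf (fun x => mom_density K (rho x) (prho x) (fun i => J i x)
  (fun i => Dr i x) (fun i => G i x) (fun i => U i x) (fun i => div_ i x)
  (fun i => U_t i x) (fun i j => DU i j x)).
Proof. by rewrite /mom_density; bmf_tac. Qed.

Lemma bmf_test_density : bmf (fun x => test_density K (rho x) (lap_t x) (Phi_t x)
  (fun i => J i x) (fun i => U i x) (fun i => lap_ i x) (fun i => Phi_ i x)
  (fun i => U_t i x) (fun i j => DU i j x)).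
Proof. by rewrite /test_density; bmf_tac. Qed.

Lemma bmf_rel_density : bmf (fun x => rel_density K (rho x) (r x) (dpr x) (prho x) (pr x)
  (fun i => J i x) (fun i => Dr i x) (fun i => G i x) (fun i => U i x) (fun i => r_ i x)
  (fun i => Phi_ i x) (fun i => div_ i x) (fun i j => DU i j x)).
Proof. by rewrite /rel_density; bmf_tac. Qed.

Lemma bmf_rel_energy_density : bmf (fun x => rel_energy_density K (rho x)
  (fun i => J i x) (fun i => Dr i x) (fun i => G i x) (fun i => U i x) (fun i => r_ i x)
  (fun i => Phi_ i x)).
Proof. by rewrite /rel_energy_density; bmf_tac. Qed.

Lemma bmf_kflux i : bmf (fun x => kflux (r x) (fun i => r_ i x) (fun i => div_ i x)
  (fun i j => DU i j x) i).
Proof. by rewrite /kflux; bmf_tac. Qed.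

Lemma bmf_ksource : bmf (fun x => ksource (lap_t x) (fun i => U i x) (fun i => r_ i x)
  (fun i => lap_ i x) (fun i => div_ i x)).
Proof. by rewrite /ksource; bmf_tac. Qed.

Notation kin x := ((\sum_i J i x ^+ 2) / rho x).
Notation mom x := (mom_density K (rho x) (prho x) (fun i => J i x)
  (fun i => Dr i x) (fun i => G i x) (fun i => U i x) (fun i => div_ i x)
  (fun i => U_t i x) (fun i j => DU i j x)).
Notation test x := (test_density K (rho x) (lap_t x) (Phi_t x)
  (fun i => J i x) (fun i => U i x) (fun i => lap_ i x) (fun i => Phi_ i x)
  (fun i => U_t i x) (fun i j => DU i j x)).
Notation rel x := (rel_density K (rho x) (r x) (dpr x) (prho x) (pr x)
  (fun i => J i x) (fun i => Dr i x) (fun i => G i x) (fun i => U i x) (fun i => r_ i x)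
  (fun i => Phi_ i x) (fun i => div_ i x) (fun i j => DU i j x)).
Notation flux i x := (kflux (r x) (fun i => r_ i x) (fun i => div_ i x)
  (fun i j => DU i j x) i).
Notation source x := (ksource (lap_t x) (fun i => U i x) (fun i => r_ i x)
  (fun i => lap_ i x) (fun i => div_ i x)).
Notation relE x := (rel_energy_density K (rho x) (fun i => J i x) (fun i => Dr i x)
  (fun i => G i x) (fun i => U i x) (fun i => r_ i x) (fun i => Phi_ i x)).
Notation ener x := (energy_density K (rho x) (fun i => J i x) (fun i => Dr i x)
  (fun i => G i x) (Prho x)).

(** The vanishing hypotheses are the remainder terms of [relative_pointwise]. The measure is generic
    because this is used on space-time and [integral_energy] on a time slice. *)
Lemma integral_relative :
  {ae mu, forall x, r_t x + \sum_i (r_ i x * U i x + r x * DU i i x) = 0} ->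
  {ae mu, forall x, forall i, U_t i x + \sum_j U j x * DU j i x + U i x
    + dpr x / r x * r_ i x - K * lap_ i x - Phi_ i x = 0} ->
  \int[mu]_x (dpr x * (\sum_i r_ i x * U i x) + pr x * (\sum_i DU i i x)) = 0 ->
  \int[mu]_x (\sum_i (Dr i x - r_ i x) * flux i x + (rho x - r x) * source x) = 0 ->
  \int[mu]_x (\sum_i r_ i x * flux i x + r x * source x) = 0 ->
  \int[mu]_x (2^-1 * r x * (\sum_i U i x * lap_ i x) + 2^-1 * r x * lap_t x
             + \sum_i r_ i x * r_t_ i x) = 0 ->
  \int[mu]_x (\sum_i (r x * U i x + Phi_t_ i x) * (G i x - Phi_ i x)) = 0 ->
  \int[mu]_x (rho x * Phi_t x + \sum_i G i x * Phi_t_ i x) = 0 ->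
  \int[mu]_x kin x + \int[mu]_x mom x + \int[mu]_x test x
  + \int[mu]_x (rho x * (dpr x / r x * r_t x) + \sum_i J i x * (dpr x / r x * r_ i x))
  - \int[mu]_x (K * (\sum_i r_ i x * r_t_ i x) + \sum_i Phi_ i x * Phi_t_ i x)
  - \int[mu]_x (dpr x * r_t x) = \int[mu]_x rel x.
Proof.
move=> aecont aevel z1 z2 z3 z4 z5 z6.
have b1 := bmf_kinetic; have b2 := bmf_mom_density; have b3 := bmf_test_density.
have b4 := bmf_rel_density; have b5 := bmf_kflux; have b6 := bmf_ksource.
rewrite -!bmf_RintegralD -?bmf_RintegralB; try by bmf_tac.
rewrite (Rintegral_ae (g := fun x => rel x
  + (dpr x * (\sum_i r_ i x * U i x) + pr x * (\sum_i DU i i x))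
  - K * (\sum_i (Dr i x - r_ i x) * flux i x + (rho x - r x) * source x)
  - K * (2^-1 * (\sum_i r_ i x * flux i x + r x * source x))
  - K * (2^-1 * r x * (\sum_i U i x * lap_ i x) + 2^-1 * r x * lap_t x
             + \sum_i r_ i x * r_t_ i x)
  + (\sum_i (r x * U i x + Phi_t_ i x) * (G i x - Phi_ i x)
     - (rho x * Phi_t x + \sum_i G i x * Phi_t_ i x)))).
  rewrite bmf_RintegralD; try by bmf_tac.
  rewrite bmf_RintegralB; try by bmf_tac.
  rewrite bmf_RintegralB; try by bmf_tac.
  rewrite bmf_RintegralB; try by bmf_tac.
  rewrite bmf_RintegralD; try by bmf_tac.
  rewrite bmf_RintegralB; try by bmf_tac.
  rewrite !bmf_RintegralZ; try by bmf_tac.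
  by rewrite z1 z2 z3 z4 z5 z6 !mulr0 !subr0 !addr0.
apply: (ae_mono2 _ aecont aevel) => x c v.
by apply: relative_pointwise => //; rewrite gt_eqF// (lt_le_trans a0).
Qed.

Lemma integral_energy :
  (forall x, r x * F x - Pr x = pr x) ->
  \int[mu]_x (\sum_i Dr i x * r_ i x + rho x * lap x) = 0 ->
  \int[mu]_x (\sum_i G i x * Phi_ i x + rho x * Phi x) = 0 ->
  \int[mu]_x relE x + \int[mu]_x (Prho x - Pr x - F x * (rho x - r x)) =
  \int[mu]_x ener x - (\int[mu]_x (\sum_i J i x * U i x)
    + \int[mu]_x (rho x * (- (2^-1 * \sum_i U i x ^+ 2) - K * lap x - Phi x))
    + \int[mu]_x (rho x * F x))
  + (\int[mu]_x (K / 2 * (\sum_i r_ i x ^+ 2) + 2^-1 * (\sum_i Phi_ i x ^+ 2))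
     + \int[mu]_x pr x).
Proof.
move=> leg z1 z2.
have b1 := bmf_kinetic; have b2 := bmf_rel_energy_density.
have b3 : bmf (fun x => ener x) by rewrite /energy_density; bmf_tac.
rewrite -!bmf_RintegralD -?bmf_RintegralB -?bmf_RintegralD; try by bmf_tac.
rewrite (Rintegral_ae (g := fun x => ener x
  - (\sum_i J i x * U i x + rho x * (- (2^-1 * \sum_i U i x ^+ 2) - K * lap x - Phi x)
     + rho x * F x)
  + (K / 2 * (\sum_i r_ i x ^+ 2) + 2^-1 * (\sum_i Phi_ i x ^+ 2) + pr x)
  - K * (\sum_i Dr i x * r_ i x + rho x * lap x)
  - (\sum_i G i x * Phi_ i x + rho x * Phi x))); last first.
  apply: ae_all => x; apply: energy_pointwise => //.
  by rewrite gt_eqF// (lt_le_trans a0).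
rewrite bmf_RintegralB; try by bmf_tac.
rewrite bmf_RintegralB; try by bmf_tac.
by rewrite bmf_RintegralZ ?z1 ?z2 ?mulr0 ?subr0//; bmf_tac.
Qed.

End IntegratedDensities.

Section SliceIdentities.
Context {R : realType}.
Variable Tp : {posnum R}.
Local Notation T := (Tp%:num).
Notation smf := (smf Tp).
Notation Dx i := (@smf_D _ Tp (0, Defs.basis i)).
Notation X1 := (measurableTypeR R).
Notation X3 := (X1 * X1 * X1)%type.
Notation X4 := (X1 * X3)%type.
Notation torus := (@torus_measure R).
Notation II tau f := (\int[spacetime_measure tau]_z f z).

Lemma divergenceE (N : 'I_3 -> smf) z : divergence N z = \sum_i Dx i (N i) z.
Proof. exact: smf_sumE. Qed.

Lemma II_iter tau (f : X4 -> R) : bmf f ->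
  II tau f = \int[itv_measure 0 tau]_t \int[torus]_x f (t, x).
Proof. by move=> bf; exact: (bmf_Rintegral_prod (itv_measure 0 tau) torus bf). Qed.

Lemma II_slice0 (tau : R) (f : X4 -> R) : bmf f -> tau <= T ->
  {ae itv_measure 0 T, forall t : R, \int[torus]_x f (t, x) = 0} -> II tau f = 0.
Proof.
move=> bf tauT f0; rewrite II_iter//.
transitivity (\int[itv_measure 0 tau]__ (0 : R)); last exact: Rintegral_eq0_fun.
by apply: Rintegral_ae; exact: ae_itv_measureS f0.
Qed.

Definition grad_pair (f : X3 -> R) (g : 'I_3 -> X3 -> R) (t : R) : Prop :=
  forall i (phi : smf), \int[torus]_x (f x * Dx i phi (t, x)) =
                        - \int[torus]_x (g i x * phi (t, x)).

Lemma grad_pair_smf (f : smf) t :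
  grad_pair (fun x => f (t, x)) (fun i x => Dx i f (t, x)) t.
Proof. by move=> i phi; rewrite (smf_int_parts f phi i t) opprK. Qed.

(** Sum over [i] of the weak gradient identity with test functions [N i]. The Korteweg integrals
    that must vanish are brought to this form. *)
Lemma grad_pair_divergence (f : X3 -> R) (g : 'I_3 -> X3 -> R) t (N : 'I_3 -> smf) (c : smf) :
  bmf f -> (forall i, bmf (g i)) -> grad_pair f g t -> divergence N = c ->
  \int[torus]_x (\sum_i g i x * N i (t, x) + f x * c (t, x)) = 0.
Proof.
move=> bf bg fg <-.
have b1 i : bmf (fun x => g i x * N i (t, x)) by apply: bmfM; [exact: bg|exact: smf_bmf_slice].
have b2 i : bmf (fun x => f x * Dx i (N i) (t, x)).
  by apply: bmfM; [exact: bf|exact: smf_bmf_slice].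
have E : (fun x => \sum_i g i x * N i (t, x) + f x * divergence N (t, x)) =
  (fun x => \sum_i (g i x * N i (t, x) + f x * Dx i (N i) (t, x))).
  by apply/funext => x; rewrite divergenceE mulr_sumr -big_split.
rewrite E bmf_Rintegral_sum => [|i]; last exact: (bmfD (b1 i) (b2 i)).
apply: big1 => i _; rewrite (bmf_RintegralD _ (b1 i) (b2 i)).
by rewrite (fg i (N i)) subrr.
Qed.

End SliceIdentities.

(** The energy identity at time 0 is subtracted from the one at time tau, and each difference is
    replaced by its balance law. *)
Lemma energy_combine (R : realType) (relE q ener JU rh rF S pt kin mom test pot sd dpt rel
    ener0 JU0 rh0 rF0 S0 p0 : R) :
  relE + q = ener - (JU + rh + rF) + (S + pt) ->
  ener0 - (JU0 + rh0 + rF0) + (S0 + p0) = 0 -> ener + kin <= ener0 ->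
  JU - JU0 = mom -> rh - rh0 = test -> rF - rF0 = pot -> S - S0 = sd -> pt - p0 = dpt ->
  kin + mom + test + pot - sd - dpt = rel -> relE + q <= - rel.
Proof. by move=> *; lra. Qed.

(** * The relative energy inequality *)

Section RelativeEnergy.
Context {R : realType}.
Variable Tp : {posnum R}.
Local Notation T := (Tp%:num).
Notation smf := (smf Tp).
Notation D := (@smf_D _ Tp).
Notation Dx i := (@smf_D _ Tp (0, Defs.basis i)).
Notation Dt := (@smf_D _ Tp (1, 0)).
Notation X1 := (measurableTypeR R).
Notation X3 := (X1 * X1 * X1)%type.
Notation X4 := (X1 * X3)%type.
Notation torus := (@torus_measure R).
Notation II tau f := (\int[spacetime_measure tau]_z f z).
Variables (a b K m : R) (p dp F : R -> R).
Hypotheses (a0 : 0 < a) (ab : a < b) (pd : pressure_data p dp F).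
Notation P := (pressure_potential p).

Variables (r Phi : smf) (U : 'I_3 -> smf).
Hypothesis r_ab : forall z, a <= r z <= b.
Hypothesis continuity : Dt r + \sum_i Dx i (r * U i) = 0.
Hypothesis poisson : \sum_i Dx i (Dx i Phi) = r - smf_cst Tp m.
Hypothesis Phi_mean : forall t, \int[torus]_x Phi (t, x) = 0.
Hypothesis velocity : forall i t x, 0 < t < T ->
  Dt (U i) (t, x) + \sum_j U j (t, x) * Dx j (U i) (t, x) + U i (t, x)
  + dp (r (t, x)) / r (t, x) * Dx i r (t, x) - K * Dx i (laplacian r) (t, x)
  - Dx i Phi (t, x) = 0.

Variables (rho : X4 -> R) (J Dr G : 'I_3 -> X4 -> R).
Hypotheses (b_rho : bmf rho) (b_J : forall i, bmf (J i)) (b_Dr : forall i, bmf (Dr i))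
  (b_G : forall i, bmf (G i)) (rho_ab : forall z, a <= rho z <= b).

(** All that is kept of the weak potential is its gradient [G], through the Poisson equation and the
    orthogonality to divergence-free fields. *)
Record slice_ok (t : R) : Prop := SliceOk {
  slice_gradient : grad_pair Tp (fun x => rho (t, x)) (fun i x => Dr i (t, x)) t;
  slice_poisson : forall phi : smf, \int[torus]_x (\sum_i G i (t, x) * Dx i phi (t, x)) =
    - \int[torus]_x ((rho (t, x) - m) * phi (t, x));
  slice_solenoidal : forall N : 'I_3 -> smf, divergence N = 0 ->
    \int[torus]_x (\sum_i G i (t, x) * N i (t, x)) = 0
}.
Hypothesis slices : {ae itv_measure 0 T, forall t : R, slice_ok t}.

Let rho_ge z : a <= rho z. Proof. by case/andP: (rho_ab z). Qed.
Let r_ge z : a <= r z. Proof. by case/andP: (r_ab z). Qed.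
Let b_smf (u : smf) : bmf (u : X4 -> R) := smf_bmf u.
Let b_pos f (u : X4 -> R) : pos_continuous f -> bmf u -> (forall z, a <= u z <= b) ->
  bmf (fun z => f (u z)).
Proof. by move=> cf [mu _] uab; exact: bmf_pos_continuous a0 cf mu uab. Qed.
Let cp : pos_continuous p := pos_derive_continuous (pd_derive pd).
Let cF : pos_continuous F := pos_derive_continuous (pd_potential' pd).
Let cP : pos_continuous P := pos_derive_continuous (pd_potential pd).
Let b_dpr : bmf (fun z : X4 => dp (r z)) := b_pos (pd_continuous pd) (b_smf r) r_ab.
Let b_pr : bmf (fun z : X4 => p (r z)) := b_pos cp (b_smf r) r_ab.
Let b_prho : bmf (fun z : X4 => p (rho z)) := b_pos cp b_rho rho_ab.
Let b_Pr : bmf (fun z : X4 => P (r z)) := b_pos cP (b_smf r) r_ab.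
Let b_Prho : bmf (fun z : X4 => P (rho z)) := b_pos cP b_rho rho_ab.
Let b_F : bmf (fun z : X4 => F (r z)) := b_pos cF (b_smf r) r_ab.
Let b_rV : bmf (fun z : X4 => (r z)^-1) := bmfV a0 (b_smf r) r_ge.

Notation mom z := (mom_density K (rho z) (p (rho z)) (fun i => J i z) (fun i => Dr i z)
  (fun i => G i z) (fun i => U i z) (fun i => Dx i (divergence U) z) (fun i => Dt (U i) z)
  (fun i j => Dx i (U j) z)).
Notation rel z := (rel_density K (rho z) (r z) (dp (r z)) (p (rho z)) (p (r z))
  (fun i => J i z) (fun i => Dr i z) (fun i => G i z) (fun i => U i z)
  (fun i => Dx i r z) (fun i => Dx i Phi z) (fun i => Dx i (divergence U) z)
  (fun i j => Dx i (U j) z)).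
Notation relE z := (rel_energy_density K (rho z) (fun i => J i z) (fun i => Dr i z)
  (fun i => G i z) (fun i => U i z) (fun i => Dx i r z) (fun i => Dx i Phi z)).
Notation ener z := (energy_density K (rho z) (fun i => J i z) (fun i => Dr i z)
  (fun i => G i z) (P (rho z))).
Notation ener_strong z := (energy_density K (r z) (fun i => r z * U i z) (fun i => Dx i r z)
  (fun i => Dx i Phi z) (P (r z))).
Notation flux i z := (kflux (r z) (fun i => Dx i r z) (fun i => Dx i (divergence U) z)
  (fun i j => Dx i (U j) z) i).
Notation source z := (ksource (Dt (laplacian r) z) (fun i => U i z) (fun i => Dx i r z)
  (fun i => Dx i (laplacian r) z) (fun i => Dx i (divergence U) z)).

Let fluxE i z : flux i z = kort_flux r U i z.
Proof.
rewrite /kort_flux /kflux smfNE smfDE smf_DM smfDE !smfME divergenceE smf_sumE.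
by congr (- (_ + _)); apply: eq_bigr => j _; rewrite smfME smfDE.
Qed.

Let sourceE z : source z = kort_source r U z.
Proof.
rewrite /kort_source /ksource smfBE smfDE !smf_sumE.
by congr (_ + _ - _); apply: eq_bigr => i _; rewrite smfME.
Qed.

Let pressure_term t : \int[torus]_x (dp (r (t, x)) * (\sum_i Dx i r (t, x) * U i (t, x))
  + p (r (t, x)) * \sum_i Dx i (U i) (t, x)) = 0.
Proof.
have C1 := C1lim_comp a0 ab r_ab (pd_derive pd) (pd_continuous pd).
have bd v : bmf (fun z : X4 => dp (r z) * D v r z) by apply: bmfM.
have b1 i : bmf (fun x : X3 => dp (r (t, x)) * Dx i r (t, x) * U i (t, x)).
  by apply: bmfM; [exact: (bmf_slice t (bd _))|exact: smf_bmf_slice].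
have b2 i : bmf (fun x : X3 => p (r (t, x)) * Dx i (U i) (t, x)).
  by apply: bmfM; [exact: (bmf_slice t b_pr)|exact: smf_bmf_slice].
have E : (fun x : X3 => dp (r (t, x)) * (\sum_i Dx i r (t, x) * U i (t, x))
    + p (r (t, x)) * \sum_i Dx i (U i) (t, x)) =
  (fun x : X3 => \sum_i (dp (r (t, x)) * Dx i r (t, x) * U i (t, x)
     + p (r (t, x)) * Dx i (U i) (t, x))).
  apply/funext => x; rewrite !mulr_sumr -big_split; apply: eq_bigr => i _.
  by rewrite mulrA.
rewrite E bmf_Rintegral_sum => [|i]; last exact: (bmfD (b1 i) (b2 i)).
apply: big1 => i _; rewrite (bmf_RintegralD _ (b1 i) (b2 i)).
by rewrite (C1lim_parts (U i) i t C1 b_pr bd) addNr.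
Qed.

Let pair_r t (N : 'I_3 -> smf) (c : smf) : divergence N = c ->
  \int[torus]_x (\sum_i Dx i r (t, x) * N i (t, x) + r (t, x) * c (t, x)) = 0.
Proof.
move=> Nc; apply: (grad_pair_divergence _ _ (grad_pair_smf r t) Nc).
  exact: smf_bmf_slice.
by move=> i; exact: smf_bmf_slice.
Qed.

Let kort_r t : \int[torus]_x (\sum_i Dx i r (t, x) * flux i (t, x) + r (t, x) * source (t, x)) = 0.
Proof.
rewrite -[RHS](pair_r t (kort_divergence continuity)); apply: eq_Rintegral => x _.
by rewrite sourceE; congr (_ + _); apply: eq_bigr => i _; rewrite fluxE.
Qed.

Let kort_rho t : slice_ok t ->
  \int[torus]_x (\sum_i (Dr i (t, x) - Dx i r (t, x)) * flux i (t, x)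
    + (rho (t, x) - r (t, x)) * source (t, x)) = 0.
Proof.
move=> ok; have bs (f : X4 -> R) : bmf f -> bmf (fun x => f (t, x)) by move=> bf; exact: (bmf_slice t bf).
have b1 : bmf (fun x => \sum_i Dr i (t, x) * kort_flux r U i (t, x)
     + rho (t, x) * kort_source r U (t, x)).
  apply: bmfD; last by apply: bmfM; [exact: bs|exact: smf_bmf_slice].
  by apply: bmf_sum => i; apply: bmfM; [exact: (bs _ (b_Dr i))|exact: smf_bmf_slice].
have b2 : bmf (fun x => \sum_i Dx i r (t, x) * kort_flux r U i (t, x)
     + r (t, x) * kort_source r U (t, x)).
  apply: bmfD; last by apply: bmfM; exact: smf_bmf_slice.
  by apply: bmf_sum => i; apply: bmfM; exact: smf_bmf_slice.
have e1 := grad_pair_divergence (bs _ b_rho) (fun i => bs _ (b_Dr i)) (slice_gradient ok)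
  (kort_divergence continuity).
have e2 := pair_r t (kort_divergence continuity).
transitivity (\int[torus]_x (\sum_i Dr i (t, x) * kort_flux r U i (t, x)
    + rho (t, x) * kort_source r U (t, x) - (\sum_i Dx i r (t, x) * kort_flux r U i (t, x)
    + r (t, x) * kort_source r U (t, x)))).
  apply: eq_Rintegral => x _; rewrite sourceE opprD addrACA -mulrBl; congr (_ + _).
  by rewrite -sumrB; apply: eq_bigr => i _; rewrite fluxE mulrBl.
transitivity (\int[torus]_x (\sum_i Dr i (t, x) * kort_flux r U i (t, x)
    + rho (t, x) * kort_source r U (t, x)) - \int[torus]_x (\sum_i Dx i r (t, x)
    * kort_flux r U i (t, x) + r (t, x) * kort_source r U (t, x))).
  exact: (bmf_RintegralB torus b1 b2).
by rewrite e1 e2 subrr.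
Qed.

(** Half the sum of three pairings: the Laplacian of [r] with [r U], [r] with the gradient of
    [Dt r], and [Dt r] with the gradient of [r]. The products of [Dt r] and the Laplacian cancel. *)
Let kort_time t : \int[torus]_x (2^-1 * r (t, x) * (\sum_i U i (t, x) * Dx i (laplacian r) (t, x))
  + 2^-1 * r (t, x) * Dt (laplacian r) (t, x) + \sum_i Dx i r (t, x) * Dx i (Dt r) (t, x)) = 0.
Proof.
pose N1 i := r * U i; pose N2 i := Dx i (Dt r); pose N3 i := Dx i r.
have d1 : divergence N1 = - Dt r.
  by apply/eqP; rewrite -addr_eq0 addrC; apply/eqP; exact: continuity.
have d2 : divergence N2 = Dt (laplacian r).
  rewrite /laplacian smf_Dsum; apply: eq_bigr => i _; rewrite /N2.
  by rewrite (smf_DC (1, 0) (0, Defs.basis i)) (smf_DC (1, 0) (0, Defs.basis i) r).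
have d3 : divergence N3 = laplacian r by [].
have bs (u : smf) : bmf (fun x : X3 => u (t, x)) := smf_bmf_slice u t.
have gp (u : smf) N c := grad_pair_divergence (bs u) (fun i => bs (Dx i u)) (grad_pair_smf u t) (N := N) (c := c).
have h1 := gp (laplacian r) N1 _ d1; have h2 := gp r N2 _ d2; have h3 := gp (Dt r) N3 _ d3.
have b1 : bmf (fun x : X3 => \sum_i Dx i (laplacian r) (t, x) * N1 i (t, x)
    + laplacian r (t, x) * (- Dt r) (t, x)) by bmf_tac; exact: bs.
have b2 : bmf (fun x : X3 => \sum_i Dx i r (t, x) * N2 i (t, x)
    + r (t, x) * Dt (laplacian r) (t, x)) by bmf_tac; exact: bs.
have b3 : bmf (fun x : X3 => \sum_i Dx i (Dt r) (t, x) * N3 i (t, x)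
    + Dt r (t, x) * laplacian r (t, x)) by bmf_tac; exact: bs.
have b23 := bmfD b2 b3; have b123 := bmfD b1 b23.
have S : \int[torus]_x (2^-1 * (\sum_i Dx i (laplacian r) (t, x) * N1 i (t, x)
    + laplacian r (t, x) * (- Dt r) (t, x) + (\sum_i Dx i r (t, x) * N2 i (t, x)
    + r (t, x) * Dt (laplacian r) (t, x) + (\sum_i Dx i (Dt r) (t, x) * N3 i (t, x)
    + Dt r (t, x) * laplacian r (t, x))))) = 0.
  etransitivity; first exact: (bmf_RintegralZ torus 2^-1 b123).
  rewrite (_ : \int[torus]_x _ = 0) ?mulr0//.
  etransitivity; first exact: (bmf_RintegralD torus b1 b23).
  rewrite h1 add0r; etransitivity; first exact: (bmf_RintegralD torus b2 b3).
  by rewrite h2 h3 addr0.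
rewrite -[RHS]S; apply: eq_Rintegral => x _.
rewrite smfNE /N1 /N2 /N3 !sum3 !smfME.
move: (laplacian r (t, x)) (r (t, x)) (Dt r (t, x)) (Dt (laplacian r) (t, x)) => A B C E.
by field.
Qed.

Let poisson_flux t : slice_ok t ->
  \int[torus]_x (\sum_i (r (t, x) * U i (t, x) + Dx i (Dt Phi) (t, x))
    * (G i (t, x) - Dx i Phi (t, x))) = 0.
Proof.
move=> ok; have dN := flux_divergence_free continuity poisson.
pose N i := r * U i + Dx i (Dt Phi).
have bs (u : smf) : bmf (fun x : X3 => u (t, x)) := smf_bmf_slice u t.
have h1 := slice_solenoidal ok dN.
have h2 := grad_pair_divergence (bs Phi) (fun i => bs (Dx i Phi)) (grad_pair_smf Phi t) dN.
have b1 : bmf (fun x : X3 => \sum_i G i (t, x) * N i (t, x)).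
  by apply: bmf_sum => i; apply: bmfM; [exact: (bmf_slice t (b_G i))|exact: bs].
have b2 : bmf (fun x : X3 => \sum_i Dx i Phi (t, x) * N i (t, x) + Phi (t, x) * (0 : smf) (t, x)).
  by bmf_tac; exact: bs.
transitivity (\int[torus]_x (\sum_i G i (t, x) * N i (t, x)
   - (\sum_i Dx i Phi (t, x) * N i (t, x) + Phi (t, x) * (0 : smf) (t, x)))).
  apply: eq_Rintegral => x _; rewrite smf0E mulr0 addr0 -sumrB; apply: eq_bigr => i _.
  by rewrite /N smfDE smfME -mulrBl mulrC.
etransitivity; first exact: (bmf_RintegralB torus b1 b2).
by rewrite h1 h2 subrr.
Qed.

Let poisson_smf t (phi : smf) : slice_ok t ->
  \int[torus]_x (\sum_i G i (t, x) * Dx i phi (t, x) + rho (t, x) * phi (t, x)) =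
  m * \int[torus]_x phi (t, x).
Proof.
move=> ok; have bs (u : smf) : bmf (fun x : X3 => u (t, x)) := smf_bmf_slice u t.
have br : bmf (fun x : X3 => rho (t, x)) := bmf_slice t b_rho.
have b1 : bmf (fun x : X3 => \sum_i G i (t, x) * Dx i phi (t, x)).
  by apply: bmf_sum => i; apply: bmfM; [exact: (bmf_slice t (b_G i))|exact: bs].
have b2 : bmf (fun x : X3 => rho (t, x) * phi (t, x)) := bmfM br (bs phi).
have b3 : bmf (fun x : X3 => m * phi (t, x)) := bmfM (bmf_cst _ m) (bs phi).
rewrite (bmf_RintegralD torus b1 b2) (slice_poisson ok).
have -> : \int[torus]_x ((rho (t, x) - m) * phi (t, x)) =
    \int[torus]_x (rho (t, x) * phi (t, x)) - \int[torus]_x (m * phi (t, x)).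
  rewrite -(bmf_RintegralB torus b2 b3); apply: eq_Rintegral => x _; exact: mulrBl.
by rewrite opprB addrNK (bmf_RintegralZ torus m (bs phi)).
Qed.

(** At almost every time the weak Poisson equation reduces the integral to [m] times that of
    [Dt Phi]; integrated in time this vanishes because [Phi] always has mean zero. It is false slice
    by slice without that last step only in form: the cancellation is taken after the time
    integration. *)
Let poisson_time tau : 0 <= tau <= T ->
  II tau (fun z => rho z * Dt Phi z + \sum_i G i z * Dx i (Dt Phi) z) = 0.
Proof.
move=> /andP[tau0 tauT].
pose g z := \sum_i G i z * Dx i (Dt Phi) z + rho z * Dt Phi z.
have bg : bmf g by rewrite /g; bmf_tac; exact: b_smf.
have bP : bmf (fun z : X4 => m * Dt Phi z) := bmfM (bmf_cst _ m) (b_smf (Dt Phi)).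
have z0 : II tau (fun z => g z - m * Dt Phi z) = 0.
  apply: II_slice0 tauT _; first exact: (bmfB bg bP).
  apply: ae_mono slices => t ok.
  etransitivity; first exact: (bmf_RintegralB torus (bmf_slice t bg) (bmf_slice t bP)).
  rewrite [X in X - _](poisson_smf (Dt Phi) ok).
  by rewrite (bmf_RintegralZ torus m (smf_bmf_slice (Dt Phi) t)) subrr.
have z1 : II tau (fun z => m * Dt Phi z) = 0.
  rewrite (bmf_RintegralZ _ m (b_smf (Dt Phi))) (II_iter _ (b_smf (Dt Phi))).
  by rewrite -smf_int_dt ?tau0// !Phi_mean subrr mulr0.
transitivity (II tau (fun z => (g z - m * Dt Phi z) + m * Dt Phi z)).
  by apply: eq_Rintegral => z _; rewrite subrK /g addrC.
etransitivity; first exact: (bmf_RintegralD _ (bmfB bg bP) bP).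
by rewrite z0 z1 addr0.
Qed.

(** The initial terms are written with the classical solution, which has the same initial data;
    likewise in the two balances below. *)
Definition continuity_balance (tau : R) : Prop := forall phi : smf,
  \int[torus]_x (rho (tau, x) * phi (tau, x)) - \int[torus]_x (r (0, x) * phi (0, x)) =
  \int[itv_measure 0 tau]_t \int[torus]_x
    (rho (t, x) * Dt phi (t, x) + \sum_i J i (t, x) * Dx i phi (t, x)).

Definition momentum_balance (tau : R) : Prop :=
  \int[torus]_x (\sum_i J i (tau, x) * U i (tau, x))
  - \int[torus]_x (\sum_i r (0, x) * U i (0, x) * U i (0, x)) =
  II tau (fun z => mom z).

Definition energy_balance (tau : R) : Prop :=
  \int[torus]_x ener (tau, x) + II tau (fun z => (\sum_i J i z ^+ 2) / rho z) <=
  \int[torus]_x ener_strong (0, x).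

Let hs : smf := - (smf_cst Tp 2^-1 * \sum_i U i ^+ 2) - smf_cst Tp K * laplacian r - Phi.

Let hsE z : hs z = - (2^-1 * \sum_i U i z ^+ 2) - K * laplacian r z - Phi z.
Proof.
rewrite /hs !smfBE smfNE !smfME smf_sumE.
by congr (- (_ * _) - _ - _); apply: eq_bigr => i _; rewrite smfXE.
Qed.

Let hs_D v z : D v hs z = - (\sum_i U i z * D v (U i) z) - K * D v (laplacian r) z - D v Phi z.
Proof.
rewrite /hs !smf_DB smf_DN !smf_DZ smf_Dsum !smfBE smfNE !smfME smf_sumE mulr_sumr.
congr (- _ - _ - _); apply: eq_bigr => i _.
rewrite smf_D2 smf_mulrnE smfME [smf_cst _ _ _]/= -mulr_natl.
by field.
Qed.

Let test_balance tau : continuity_balance tau ->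
  \int[torus]_x (rho (tau, x) * hs (tau, x)) - \int[torus]_x (r (0, x) * hs (0, x)) =
  II tau (fun z => test_density K (rho z) (Dt (laplacian r) z) (Dt Phi z)
    (fun i => J i z) (fun i => U i z) (fun i => Dx i (laplacian r) z)
    (fun i => Dx i Phi z) (fun i => Dt (U i) z) (fun i j => Dx i (U j) z)).
Proof.
move=> cb; rewrite cb -(II_iter _ (f := fun z => rho z * Dt hs z + \sum_i J i z * Dx i hs z)).
  apply: eq_Rintegral => z _; rewrite /test_density hs_D; congr (_ + _).
  by apply: eq_bigr => i _; rewrite hs_D.
by bmf_tac; exact: b_smf.
Qed.

Let potential_balance tau : continuity_balance tau ->
  \int[torus]_x (rho (tau, x) * F (r (tau, x))) - \int[torus]_x (r (0, x) * F (r (0, x))) =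
  II tau (fun z => rho z * (dp (r z) / r z * Dt r z)
    + \sum_i J i z * (dp (r z) / r z * Dx i r z)).
Proof.
move=> cb.
have cdF : pos_continuous (fun s => dp s / s).
  move=> s s0; apply: cvgM; first exact: (pd_continuous pd).
  by apply: cvgV; [rewrite gt_eqF|exact: cvg_id].
have C1 := C1lim_comp a0 ab r_ab (pd_potential' pd) cdF.
have bd v : bmf (fun z : X4 => dp (r z) / r z * D v r z) by bmf_tac; exact: b_smf.
rewrite (C1lim_identity b_rho (smf_bmf_slice r 0) b_J cb C1 b_F bd).
rewrite -(II_iter _ (f := fun z => rho z * (dp (r z) / r z * Dt r z)
    + \sum_i J i z * (dp (r z) / r z * Dx i r z)))//.
by apply: bmfD; [exact: (bmfM b_rho (bd _))|apply: bmf_sum => i; exact: (bmfM (b_J i) (bd _))].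
Qed.

(** The constant density 1 without flux satisfies the hypothesis of [C1lim_identity], which then
    differentiates the integral of [p (r)] in time. *)
Let pressure_balance tau : 0 <= tau <= T ->
  \int[torus]_x p (r (tau, x)) - \int[torus]_x p (r (0, x)) =
  II tau (fun z => dp (r z) * Dt r z).
Proof.
move=> tauT; have C1 := C1lim_comp a0 ab r_ab (pd_derive pd) (pd_continuous pd).
have bd v : bmf (fun z : X4 => dp (r z) * D v r z) by bmf_tac; exact: b_smf.
have cb (phi : smf) : \int[torus]_x (1 * phi (tau, x)) - \int[torus]_x (1 * phi (0, x)) =
    \int[itv_measure 0 tau]_t \int[torus]_x
       (1 * Dt phi (t, x) + \sum_(i < 3) 0 * Dx i phi (t, x)).
  transitivity (\int[torus]_x phi (tau, x) - \int[torus]_x phi (0, x)).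
    by congr (_ - _); apply: eq_Rintegral => x _; rewrite mul1r.
  rewrite (smf_int_dt phi tauT); apply: eq_Rintegral => t _; apply: eq_Rintegral => x _.
  by rewrite mul1r big1 ?addr0// => i _; rewrite mul0r.
have := C1lim_identity (bmf_cst X4 (1 : R)) (bmf_cst X3 (1 : R))
  (fun i : 'I_3 => bmf_cst X4 (0 : R)) cb C1 b_pr bd.
move=> E; transitivity (\int[torus]_x (1 * p (r (tau, x))) - \int[torus]_x (1 * p (r (0, x)))).
  by congr (_ - _); apply: eq_Rintegral => x _; rewrite mul1r.
rewrite E (II_iter _ (bd (1, 0))); apply: eq_Rintegral => t _; apply: eq_Rintegral => x _.
by rewrite mul1r big1 ?addr0// => i _; rewrite mul0r.
Qed.

Let strong_balance tau : 0 <= tau <= T ->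
  \int[torus]_x (K / 2 * (\sum_i Dx i r (tau, x) ^+ 2) + 2^-1 * (\sum_i Dx i Phi (tau, x) ^+ 2))
  - \int[torus]_x (K / 2 * (\sum_i Dx i r (0, x) ^+ 2) + 2^-1 * (\sum_i Dx i Phi (0, x) ^+ 2)) =
  II tau (fun z => K * (\sum_i Dx i r z * Dx i (Dt r) z) + \sum_i Dx i Phi z * Dx i (Dt Phi) z).
Proof.
move=> tauT; pose u := smf_cst Tp (K / 2) * (\sum_i Dx i r ^+ 2)
  + smf_cst Tp 2^-1 * (\sum_i Dx i Phi ^+ 2).
have uE z : u z = K / 2 * (\sum_i Dx i r z ^+ 2) + 2^-1 * (\sum_i Dx i Phi z ^+ 2).
  rewrite /u smfDE !smfME !smf_sumE.
  by congr (_ * _ + _ * _); apply: eq_bigr => i _; rewrite smfXE.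
have DuE z : Dt u z = K * (\sum_i Dx i r z * Dx i (Dt r) z) + \sum_i Dx i Phi z * Dx i (Dt Phi) z.
  rewrite /u smf_DD !smf_DZ !smf_Dsum smfDE !smfME !smf_sumE !mulr_sumr.
  congr (_ + _); apply: eq_bigr => i _; rewrite smf_D2 smf_mulrnE smfME.
    by rewrite (smf_DC (1, 0) (0, Defs.basis i)) [smf_cst _ _ _]/= -mulr_natl; field.
  by rewrite (smf_DC (1, 0) (0, Defs.basis i)) [smf_cst _ _ _]/= -mulr_natl; field.
have := smf_int_dt u tauT; rewrite -(II_iter _ (b_smf (Dt u))) => E.
transitivity (\int[torus]_x u (tau, x) - \int[torus]_x u (0, x)).
  by congr (_ - _); apply: eq_Rintegral => x _; rewrite uE.
by rewrite E; apply: eq_Rintegral => z _; rewrite DuE.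
Qed.

Lemma relative_energy_balance tau : 0 < tau < T -> slice_ok tau ->
  continuity_balance tau -> momentum_balance tau -> energy_balance tau ->
  \int[torus]_x relE (tau, x) + \int[torus]_x (P (rho (tau, x)) - P (r (tau, x))
     - F (r (tau, x)) * (rho (tau, x) - r (tau, x))) <= - II tau (fun z => rel z).
Proof.
move=> tau_in ok cb mb eb.
have tauT : 0 <= tau <= T by case/andP: tau_in => /ltW -> /ltW ->.
have [_ tauT'] := andP tauT.
have bs (u : smf) t : bmf (fun x : X3 => u (t, x)) := smf_bmf_slice u t.
have bt (f : X4 -> R) t : bmf f -> bmf (fun x => f (t, x)) by move=> bf; exact: (bmf_slice t bf).
have leg z : r z * F (r z) - P (r z) = p (r z).
  by apply: (pd_legendre pd); exact: lt_le_trans (r_ge z).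
have gradr t : \int[torus]_x (\sum_i Dx i r (t, x) * Dx i r (t, x)
    + r (t, x) * laplacian r (t, x)) = 0 by exact: pair_r.
have poissonr t : \int[torus]_x (\sum_i Dx i Phi (t, x) * Dx i Phi (t, x)
    + r (t, x) * Phi (t, x)) = 0.
  have h := grad_pair_divergence (bs Phi t) (fun i => bs (Dx i Phi) t) (grad_pair_smf Phi t)
    (poisson : divergence (fun i => Dx i Phi) = _).
  have b1 : bmf (fun x => \sum_i Dx i Phi (t, x) * Dx i Phi (t, x)
    + Phi (t, x) * (r - smf_cst Tp m) (t, x)) by bmf_tac; exact: bs.
  have b2 : bmf (fun x => m * Phi (t, x)) := bmfM (bmf_cst _ m) (bs Phi t).
  transitivity (\int[torus]_x (\sum_i Dx i Phi (t, x) * Dx i Phi (t, x)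
    + Phi (t, x) * (r - smf_cst Tp m) (t, x) + m * Phi (t, x))).
    apply: eq_Rintegral => x _; rewrite smfBE [smf_cst _ _ _]/= -addrA; congr (_ + _).
    by ring.
  rewrite (bmf_RintegralD torus b1 b2) h (bmf_RintegralZ torus m (bs Phi t)) Phi_mean.
  by rewrite mulr0 addr0.
(* At time 0 both states coincide: [integral_energy] with the classical solution in both roles has a
   zero left side. *)
have E0 : \int[torus]_x ener_strong (0, x) -
    (\int[torus]_x (\sum_i r (0, x) * U i (0, x) * U i (0, x))
     + \int[torus]_x (r (0, x) * hs (0, x)) + \int[torus]_x (r (0, x) * F (r (0, x))))
    + (\int[torus]_x (K / 2 * (\sum_i Dx i r (0, x) ^+ 2) + 2^-1 * (\sum_i Dx i Phi (0, x) ^+ 2))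
       + \int[torus]_x p (r (0, x))) = 0.
  have H := @integral_energy R _ X3 torus K a (fun x => r (0, x)) (fun x => r (0, x))
    (fun x => p (r (0, x))) (fun x => P (r (0, x))) (fun x => P (r (0, x)))
    (fun x => F (r (0, x))) (fun x => Phi (0, x)) (fun x => laplacian r (0, x))
    (fun i x => r (0, x) * U i (0, x)) (fun i x => Dx i r (0, x)) (fun i x => Dx i Phi (0, x))
    (fun i x => U i (0, x)) (fun i x => Dx i r (0, x)) (fun i x => Dx i Phi (0, x))
    (bs r 0) (bs r 0) (bt _ 0 b_pr) (bt _ 0 b_Pr) (bt _ 0 b_Pr) (bt _ 0 b_F)
    (bs Phi 0) (bs _ 0) (fun i => bmfM (bs r 0) (bs (U i) 0)) (fun i => bs _ 0)
    (fun i => bs _ 0) (fun i => bs _ 0) (fun i => bs _ 0) (fun i => bs _ 0)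
    a0 (fun x => r_ge (0, x)) (fun x => leg (0, x)) (gradr 0) (poissonr 0).
  have hs0 : \int[torus]_x (r (0, x) * (- (2^-1 * \sum_i U i (0, x) ^+ 2)
      - K * laplacian r (0, x) - Phi (0, x))) = \int[torus]_x (r (0, x) * hs (0, x)).
    by apply: eq_Rintegral => x _; rewrite hsE.
  rewrite hs0 in H; etransitivity; first exact: (esym H).
  transitivity (0 + 0 : R); last exact: addr0.
  apply: (congr2 +%R).
    apply: Rintegral_eq0_fun => x.
    by rewrite /rel_energy_density !sum3 !subrr expr0n !addr0 mul0r !mulr0 !addr0.
  by apply: Rintegral_eq0_fun => x; rewrite !subrr mulr0 subr0.
have Et := @integral_energy R _ X3 torus K a (fun x => rho (tau, x)) (fun x => r (tau, x))
    (fun x => p (r (tau, x))) (fun x => P (rho (tau, x))) (fun x => P (r (tau, x)))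
    (fun x => F (r (tau, x))) (fun x => Phi (tau, x)) (fun x => laplacian r (tau, x))
    (fun i x => J i (tau, x)) (fun i x => Dr i (tau, x)) (fun i x => G i (tau, x))
    (fun i x => U i (tau, x)) (fun i x => Dx i r (tau, x)) (fun i x => Dx i Phi (tau, x))
    (bt _ tau b_rho) (bs r tau) (bt _ tau b_pr) (bt _ tau b_Prho) (bt _ tau b_Pr) (bt _ tau b_F)
    (bs Phi tau) (bs _ tau) (fun i => bt _ tau (b_J i)) (fun i => bt _ tau (b_Dr i))
    (fun i => bt _ tau (b_G i)) (fun i => bs _ tau) (fun i => bs _ tau) (fun i => bs _ tau)
    a0 (fun x => rho_ge (tau, x)) (fun x => leg (tau, x))
    (grad_pair_divergence (bt _ tau b_rho) (fun i => bt _ tau (b_Dr i)) (slice_gradient ok)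
      (erefl : divergence (fun i => Dx i r) = laplacian r))
    (etrans (poisson_smf Phi ok) (etrans (congr1 ( *%R m) (Phi_mean tau)) (mulr0 m))).
have Et' : \int[torus]_x (rho (tau, x) * (- (2^-1 * \sum_i U i (tau, x) ^+ 2)
      - K * laplacian r (tau, x) - Phi (tau, x))) = \int[torus]_x (rho (tau, x) * hs (tau, x)).
  by apply: eq_Rintegral => x _; rewrite hsE.
rewrite Et' in Et.
have bII (u : smf) := b_smf u.
have kin_bmf := bmf_kinetic b_rho b_J a0 rho_ge.
have Hrel := @integral_relative R _ X4 (spacetime_measure tau) K a rho r (Dt r)
  (fun z => dp (r z)) (fun z => p (rho z)) (fun z => p (r z)) (Dt (laplacian r)) (Dt Phi)
  J Dr G U (fun i => Dx i r) (fun i => Dx i (laplacian r)) (fun i => Dx i Phi)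
  (fun i => Dx i (Dt Phi)) (fun i => Dx i (Dt r)) (fun i => Dx i (divergence U))
  (fun i => Dt (U i)) (fun i j => Dx i (U j))
  b_rho (b_smf _) (b_smf _) b_dpr b_prho b_pr (b_smf _) (b_smf _) b_J b_Dr b_G
  (fun i => b_smf _) (fun i => b_smf _) (fun i => b_smf _) (fun i => b_smf _)
  (fun i => b_smf _) (fun i => b_smf _) (fun i => b_smf _) (fun i => b_smf _)
  (fun i j => b_smf _) a0 rho_ge r_ge.
have acont : {ae spacetime_measure tau, forall z, Dt r z
    + \sum_i (Dx i r z * U i z + r z * Dx i (U i) z) = 0}.
  apply: ae_all => z; transitivity ((Dt r + \sum_i Dx i (r * U i)) z); last by rewrite continuity.
  rewrite smfDE smf_sumE; congr (_ + _); apply: eq_bigr => i _.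
  by rewrite smf_DM smfDE !smfME.
have avel : {ae spacetime_measure tau, forall z, forall i, Dt (U i) z
    + \sum_j U j z * Dx j (U i) z + U i z + dp (r z) / r z * Dx i r z
    - K * Dx i (laplacian r) z - Dx i Phi z = 0}.
  have h : {ae spacetime_measure tau, forall z : X4, 0 < z.1 < tau}.
    exact: (ae_prod_fst torus (ae_itv_measure 0 tau)).
  apply: ae_mono h => -[t x] /andP[t0 ttau] i; apply: velocity.
  by rewrite t0 (lt_le_trans ttau).
have bS (f : X4 -> R) (h : forall t, \int[torus]_x f (t, x) = 0) (bf : bmf f) : II tau f = 0.
  by apply: (II_slice0 bf tauT'); apply: ae_all => t; exact: h.
have bfl i : bmf (fun z : X4 => flux i z).
  by rewrite (_ : (fun z : X4 => flux i z) = kort_flux r U i); [exact: b_smf|apply/funext => z; exact: fluxE].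
have bso : bmf (fun z : X4 => source z).
  by rewrite (_ : (fun z : X4 => source z) = kort_source r U); [exact: b_smf|apply/funext => z; exact: sourceE].
have z1 : II tau (fun z => dp (r z) * (\sum_i Dx i r z * U i z) + p (r z) * (\sum_i Dx i (U i) z)) = 0.
  by apply: bS; [exact: pressure_term|bmf_tac; exact: bII].
have z2 : II tau (fun z => \sum_i (Dr i z - Dx i r z) * flux i z + (rho z - r z) * source z) = 0.
  apply: (II_slice0 _ tauT'); last by apply: ae_mono slices; exact: kort_rho.
  by bmf_tac; first [exact: bII|exact: bfl].
have z3 : II tau (fun z => \sum_i Dx i r z * flux i z + r z * source z) = 0.
  by apply: bS; [exact: kort_r|bmf_tac; first [exact: bII|exact: bfl]].
have z4 : II tau (fun z => 2^-1 * r z * (\sum_i U i z * Dx i (laplacian r) z)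
    + 2^-1 * r z * Dt (laplacian r) z + \sum_i Dx i r z * Dx i (Dt r) z) = 0.
  by apply: bS; [exact: kort_time|bmf_tac; exact: bII].
have z5 : II tau (fun z => \sum_i (r z * U i z + Dx i (Dt Phi) z) * (G i z - Dx i Phi z)) = 0.
  apply: (II_slice0 _ tauT'); last by apply: ae_mono slices; exact: poisson_flux.
  by bmf_tac; exact: bII.
have H := Hrel acont avel z1 z2 z3 z4 z5 (poisson_time tauT).
exact: (energy_combine Et E0 eb mb (test_balance cb) (potential_balance cb)
  (strong_balance tauT) (pressure_balance tauT) H).
Qed.

End RelativeEnergy.

(** * Stability *)

Section Gronwall.
Context {R : realType}.

(** Integrating [A e^(lam s)] up to [t] gives at most [A e^(lam t) / lam], and [C / lam] is at most
    one half. *)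
Lemma gronwall_step (T C A lam : R) (y : measurableTypeR R -> R) : 0 < T -> 0 <= C -> 0 <= A ->
  0 < lam -> 2 * C <= lam -> bmf y ->
  {ae itv_measure 0 T, forall t : R, y t <= C * \int[itv_measure 0 t]_s y s} ->
  {ae itv_measure 0 T, forall t : R, y t <= A * expR (lam * t)} ->
  {ae itv_measure 0 T, forall t : R, y t <= A / 2 * expR (lam * t)}.
Proof.
move=> T0 C0 A0 l0 Cl by_ yC yA.
have cexp : continuous (fun s : R => expR (lam * s)).
  move=> s; apply: (@continuous_comp _ _ _ (fun s : R => lam * s) expR); last exact: continuous_expR.
  by apply: cvgM; [exact: cvg_cst|exact: cvg_id].
apply: (ae_mono2 _ (ae_itv_measure 0 T) yC); last first.
move=> t /andP[t0 tT] yt; apply: le_trans yt _.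
(* The clamped time keeps the exponential bounded on the whole line, as [bmf] demands, and changes
   nothing on []0, t[]. *)
pose g (s : R) := A * expR (lam * clampt T s).
have cg : continuous (fun s : R => expR (lam * clampt T s)).
  move=> s; apply: (@continuous_comp _ _ _ (clampt T) (fun s : R => expR (lam * s))).
    exact: clampt_continuous.
  exact: cexp.
have bg : bmf (g : measurableTypeR R -> R).
  apply: bmfM; first exact: bmf_cst.
  apply: (@bmf_comp _ _ _ (fun s : R => expR (lam * clampt T s)) id (expR (lam * T))) => //.
  move=> s; rewrite ger0_norm ?expR_ge0// ler_expR ler_wpM2l ?(ltW l0)//.
  by case/andP: (clampt_in T0 s).
have yg : {ae itv_measure 0 t, forall s : R, y s <= g s}.
  apply: (ae_mono2 _ (ae_itv_measure 0 t) (ae_itv_measureS (ltW tT) yA)) => s /andP[s0 st] h.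
  by rewrite /g clampt_id ?(ltW s0) ?(ltW (lt_trans st tT)).
have := bmf_le_Rintegral_ae by_ bg yg.
have -> : \int[itv_measure 0 t]_s g s = A * ((expR (lam * t) - 1) / lam).
  transitivity (\int[itv_measure 0 t]_s (A * expR (lam * s))).
    apply: Rintegral_ae; apply: ae_mono (ae_itv_measure 0 t) => s /andP[s0 st].
    by rewrite /g clampt_id ?(ltW s0) ?(ltW (lt_trans st tT)).
  have -> : A * ((expR (lam * t) - 1) / lam) = A / lam * expR (lam * t) - A / lam * expR (lam * 0).
    by rewrite mulr0 expR0; field; rewrite gt_eqF.
  apply: (@FTC_itv _ (fun s => A / lam * expR (lam * s)) (fun s => A * expR (lam * s))).
  - exact: ltW.
  - by move=> s; apply: cvgM; [exact: cvg_cst|exact: cexp].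
  - by move=> s; apply: cvgM; [exact: cvg_cst|exact: cexp].
  move=> s _.
  have -> : A * expR (lam * s) = A / lam * (expR (lam * s) * lam) by field; rewrite gt_eqF.
  have d1 : is_derive s (1 : R) (fun u => lam * u) lam.
    by rewrite -[X in is_derive _ _ _ X]mulr1; exact: is_deriveZ.
  have d2 : is_derive s (1 : R) (fun u => expR (lam * u)) (expR (lam * s) * lam).
    exact: (@is_derive1_comp R expR (fun u => lam * u)).
  exact: (is_deriveZ (A / lam) d2).
move=> h; apply: (@le_trans _ _ (C * (A * ((expR (lam * t) - 1) / lam)))).
  by rewrite ler_wpM2l.
have e0 := expR_ge0 (lam * t); move: (expR (lam * t)) e0 => e e0.
rewrite (_ : C * (A * ((e - 1) / lam)) = (C / lam) * (A * (e - 1))); last by field; rewrite gt_eqF.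
have Cl2 : C / lam <= 2^-1 by rewrite ler_pdivrMr//; lra.
have Cl0 : 0 <= C / lam by rewrite divr_ge0// ltW.
apply: (@le_trans _ _ (C / lam * (A * e))).
  by rewrite ler_wpM2l// ler_wpM2l//; lra.
by rewrite (_ : A / 2 * e = 2^-1 * (A * e)); [rewrite ler_wpM2r// mulr_ge0|ring].
Qed.

(** [y] is merely measurable and the inequality holds at almost all times, so there is nothing to
    differentiate. Instead each [gronwall_step] halves the constant of an exponential bound that
    starts from the supremum of [y]. *)
Lemma gronwall (T C : R) (y : measurableTypeR R -> R) : 0 < T -> bmf y -> (forall t, 0 <= y t) ->
  {ae itv_measure 0 T, forall t : R, y t <= C * \int[itv_measure 0 t]_s y s} ->
  {ae itv_measure 0 T, forall t : R, y t = 0}.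
Proof.
move=> T0 by_ y0 yC; have [M yM] := by_.2.
have M0 : 0 <= M := le_trans (normr_ge0 _) (yM 0).
have yC' : {ae itv_measure 0 T, forall t : R, y t <= `|C| * \int[itv_measure 0 t]_s y s}.
  apply: ae_mono yC => t h; rewrite (le_trans h)// ler_wpM2r ?ler_norm//.
  by apply: Rintegral_ge0 => s _.
pose lam := 2 * `|C| + 1.
have l0 : 0 < lam by rewrite /lam ltr_wpDl// mulr_ge0.
have H n : {ae itv_measure 0 T, forall t : R, y t <= M / 2 ^+ n * expR (lam * t)}.
  elim: n => [|n IHn].
    apply: ae_mono (ae_itv_measure 0 T) => t /andP[t0 _].
    rewrite expr0 divr1 (le_trans (ler_norm _))// (le_trans (yM t))//.
    by rewrite ler_peMr// -expR0 ler_expR mulr_ge0// ltW.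
  have -> : M / 2 ^+ n.+1 = M / 2 ^+ n / 2 by rewrite exprS invfM mulrA mulrAC.
  apply: (gronwall_step T0 (normr_ge0 C) _ l0 _ by_ yC' IHn).
    by rewrite divr_ge0// exprn_ge0.
  by rewrite /lam lerDl.
(* One exceptional set for all [n]: a countable union of null sets. *)
have : {ae itv_measure 0 T, forall t : R, forall n, y t <= M / 2 ^+ n * expR (lam * t)}.
  have := negligible_bigcup H; apply: negligibleS => t /= nH.
  by apply: contrapT => hn; apply: nH => n; apply: contrapT => hh; apply: hn; exists n.
apply: ae_mono => t yt; apply/eqP; rewrite eq_le y0 andbT.
have l : (M * expR (lam * t)) * (2^-1) ^+ n @[n --> \oo] --> (M * expR (lam * t) * 0 : R).
  by apply: cvgM; [exact: cvg_cst|apply: cvg_expr; rewrite ger0_norm// invf_lt1// ltr1n].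
have l2 : (y t - (M * expR (lam * t)) * (2^-1) ^+ n) @[n --> \oo] --> (y t - M * expR (lam * t) * 0 : R).
  by apply: cvgB; [exact: cvg_cst|exact: l].
rewrite mulr0 subr0 in l2; apply: (limr_le_cvg l2) => n.
by rewrite subr_le0 (le_trans (yt n))// exprVn mulrAC.
Qed.

End Gronwall.

Lemma fin_bound (R : realType) (I : finType) (X : Type) (f : I -> X -> R) :
  (forall i, exists C, forall x, `|f i x| <= C) -> exists C, forall i x, `|f i x| <= C.
Proof.
move=> /choice[c fc]; exists (\sum_i `|c i|) => i x.
rewrite (le_trans (fc i x))// (le_trans (ler_norm _))//.
by rewrite (bigD1 i)//= lerDl sumr_ge0.
Qed.

(** [dl] makes [CP + 1] times the last term of the second inequality equal to [e / 2]. Adding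
    [CP + 1] times that inequality to the first absorbs [CP * n] and half of [e]; the extra 1 leaves
    one [n] on the left and keeps [dl] meaningful when [CP = 0]. *)
Lemma absorb (R : realType) (e n G C1 CP C2 T K dl : R) : 0 < K -> 0 < T -> 0 <= CP ->
  dl = K / (2 * (CP + 1) * T) -> 0 <= e -> 0 <= n ->
  e <= C1 * G + CP * n -> n <= (2 * dl)^-1 * (C2 * G) + dl / 2 * T * (2 / K * e) ->
  e + n <= 2 * (C1 + (CP + 1) * ((2 * dl)^-1 * C2)) * G.
Proof.
move=> K0 T0 CP0 dlE e0 n0 eG nG.
have c0 : 0 < CP + 1 by rewrite ltr_wpDl.
have E : (CP + 1) * (dl / 2 * T * (2 / K * e)) = 2^-1 * e.
  by rewrite dlE; field; rewrite !gt_eqF.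
have : (CP + 1) * n <= (CP + 1) * ((2 * dl)^-1 * (C2 * G) + dl / 2 * T * (2 / K * e)).
  by rewrite ler_wpM2l// ltW.
rewrite mulrDr E; move: ((2 * dl)^-1) => q h.
have -> : 2 * (C1 + (CP + 1) * (q * C2)) * G = 2 * (C1 * G) + 2 * ((CP + 1) * (q * (C2 * G))) by ring.
have : n * (CP + 1) = CP * n + n by ring.
move: ((CP + 1) * (q * (C2 * G))) h; rewrite [(CP + 1) * n]mulrC => B; move: (n * (CP + 1)) (CP * n) (C1 * G) eG => *; lra.
Qed.

Lemma gradient_gap_bound (R : realType) (K rho : R) (J Dr G U r_ Phi_ : 'I_3 -> R) :
  0 < K -> 0 < rho ->
  \sum_i (Dr i - r_ i) ^+ 2 <= 2 / K * rel_energy_density K rho J Dr G U r_ Phi_.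
Proof.
move=> K0 rho0; rewrite /rel_energy_density.
have A0 : 0 <= (\sum_i (J i - rho * U i) ^+ 2) / rho.
  by rewrite divr_ge0 ?(ltW rho0)//; apply: sumr_ge0 => i _; exact: sqr_ge0.
have W0 : 0 <= \sum_i (G i - Phi_ i) ^+ 2 by apply: sumr_ge0 => i _; exact: sqr_ge0.
move: (_ / rho) (\sum_i (G i - _) ^+ 2) (\sum_i (Dr i - _) ^+ 2) A0 W0 => A W S A0 W0.
have -> : 2 / K * (2^-1 * A + K / 2 * S + 2^-1 * W) = S + (A + W) / K by field; rewrite gt_eqF.
by rewrite lerDl divr_ge0 ?addr_ge0// ltW.
Qed.

Lemma gap_eq0 (R : realType) (K rho r : R) (J Dr G U r_ Phi_ : 'I_3 -> R) :
  0 < K -> 0 < rho -> rel_energy_density K rho J Dr G U r_ Phi_ + (rho - r) ^+ 2 = 0 ->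
  rho = r /\ forall i, J i = r * U i.
Proof.
move=> K0 rho0; rewrite /rel_energy_density.
have M0 : 0 <= \sum_i (J i - rho * U i) ^+ 2 by apply: sumr_ge0 => i _; exact: sqr_ge0.
have A0 : 0 <= (\sum_i (J i - rho * U i) ^+ 2) / rho by rewrite divr_ge0 ?(ltW rho0).
have S0 : 0 <= K / 2 * \sum_i (Dr i - r_ i) ^+ 2.
  by rewrite mulr_ge0 ?divr_ge0 ?(ltW K0)//; apply: sumr_ge0 => i _; exact: sqr_ge0.
have W0 : 0 <= \sum_i (G i - Phi_ i) ^+ 2 by apply: sumr_ge0 => i _; exact: sqr_ge0.
have r0 := sqr_ge0 (rho - r) => E.
have rr : (rho - r) ^+ 2 = 0 by lra.
have {}rr : rho = r by apply/eqP; rewrite -subr_eq0 -sqrf_eq0 rr.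
have Ae : (\sum_i (J i - rho * U i) ^+ 2) / rho = 0 by lra.
split=> // i; rewrite -rr; apply/eqP; rewrite -subr_eq0 -sqrf_eq0.
move/eqP: Ae; rewrite mulf_eq0 invr_eq0 (gt_eqF rho0) orbF => /eqP Ae.
rewrite eq_le sqr_ge0 andbT -Ae (bigD1 i)//= lerDl.
by apply: sumr_ge0 => j _; exact: sqr_ge0.
Qed.

(** * The closing estimate *)

Section Stability.
Context {R : realType}.
Variable Tp : {posnum R}.
Local Notation T := (Tp%:num).
Notation smf := (smf Tp).
Notation Dx i := (@smf_D _ Tp (0, Defs.basis i)).
Notation Dt := (@smf_D _ Tp (1, 0)).
Notation X1 := (measurableTypeR R).
Notation X3 := (X1 * X1 * X1)%type.
Notation X4 := (X1 * X3)%type.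
Notation torus := (@torus_measure R).
Notation II tau f := (\int[spacetime_measure tau]_z f z).
Variables (a b K m : R) (p dp F : R -> R).
Hypotheses (a0 : 0 < a) (ab : a < b) (K0 : 0 < K) (pd : pressure_data p dp F).
Notation P := (pressure_potential p).
Variables (r Phi : smf) (U : 'I_3 -> smf).
Hypothesis r_ab : forall z, a <= r z <= b.
Hypothesis continuity : Dt r + \sum_i Dx i (r * U i) = 0.
Hypothesis poisson : \sum_i Dx i (Dx i Phi) = r - smf_cst Tp m.
Hypothesis Phi_mean : forall t, \int[torus]_x Phi (t, x) = 0.
Hypothesis velocity : forall i t x, 0 < t < T ->
  Dt (U i) (t, x) + \sum_j U j (t, x) * Dx j (U i) (t, x) + U i (t, x)
  + dp (r (t, x)) / r (t, x) * Dx i r (t, x) - K * Dx i (laplacian r) (t, x)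
  - Dx i Phi (t, x) = 0.
Variables (rho : X4 -> R) (J Dr G : 'I_3 -> X4 -> R).
Hypotheses (b_rho : bmf rho) (b_J : forall i, bmf (J i)) (b_Dr : forall i, bmf (Dr i))
  (b_G : forall i, bmf (G i)) (rho_ab : forall z, a <= rho z <= b).

Record good_time (t : R) : Prop := GoodTime {
  good_slice : slice_ok Tp m rho Dr G t;
  good_continuity : continuity_balance r rho J t;
  good_momentum : momentum_balance K p r U rho J Dr G t;
  good_energy : energy_balance K p r Phi U rho J Dr G t
}.
Hypothesis good_times : {ae itv_measure 0 T, forall t : R, good_time t}.

Notation relE z := (rel_energy_density K (rho z) (fun i => J i z) (fun i => Dr i z)
  (fun i => G i z) (fun i => U i z) (fun i => Dx i r z) (fun i => Dx i Phi z)).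
Let gap z := relE z + (rho z - r z) ^+ 2.
Let rho_ge z : a <= rho z. Proof. by case/andP: (rho_ab z). Qed.
Let r_ge z : a <= r z. Proof. by case/andP: (r_ab z). Qed.
Let rho_gt0 z : 0 < rho z. Proof. exact: lt_le_trans (rho_ge z). Qed.
Let b_smf (u : smf) : bmf (u : X4 -> R) := smf_bmf u.
Let bs (u : smf) t : bmf (fun x : X3 => u (t, x)) := smf_bmf_slice u t.
Let bt (f : X4 -> R) t : bmf f -> bmf (fun x => f (t, x)).
Proof. by move=> bf; exact: (bmf_slice t bf). Qed.

Let b_relE : bmf (fun z : X4 => relE z).
Proof.
exact: (bmf_rel_energy_density K b_rho b_J b_Dr b_G (fun i => b_smf (U i))
  (fun i => b_smf (Dx i r)) (fun i => b_smf (Dx i Phi)) a0 rho_ge).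
Qed.

Let b_sq : bmf (fun z : X4 => (rho z - r z) ^+ 2).
Proof. by apply: bmfX; exact: bmfB b_rho (b_smf r). Qed.

Let b_gap : bmf (gap : X4 -> R) := bmfD b_relE b_sq.

Let relE_ge0 z : 0 <= relE z.
Proof.
rewrite /rel_energy_density !addr_ge0// mulr_ge0//.
- by rewrite divr_ge0 ?(ltW (rho_gt0 z))//; apply: sumr_ge0 => i _; exact: sqr_ge0.
- by rewrite divr_ge0// ltW.
- by apply: sumr_ge0 => i _; exact: sqr_ge0.
- by apply: sumr_ge0 => i _; exact: sqr_ge0.
Qed.

Let gap_ge0 z : 0 <= gap z.
Proof. by rewrite addr_ge0 ?sqr_ge0. Qed.

Let coefficient_bound : exists B, 0 <= B /\ forall z, [/\ forall i, `|U i z| <= B,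
  forall i, `|Dx i (divergence U) z| <= B & forall i j, `|Dx i (U j) z| <= B].
Proof.
have [B1 h1] := fin_bound (fun i => smf_bounded (U i)).
have [B2 h2] := fin_bound (fun i => smf_bounded (Dx i (divergence U))).
have [B3 h3] := fin_bound (fun ij : 'I_3 * 'I_3 => smf_bounded (Dx ij.1 (U ij.2))).
have n1 : 0 <= B1 := le_trans (normr_ge0 _) (h1 0 (0, 0)).
have n2 : 0 <= B2 := le_trans (normr_ge0 _) (h2 0 (0, 0)).
have n3 : 0 <= B3 := le_trans (normr_ge0 _) (h3 (0, 0) (0, 0)).
exists (B1 + B2 + B3); split=> [|z]; first by rewrite !addr_ge0.
split => [i|i|i j].
- by rewrite (le_trans (h1 i z))// -addrA lerDl addr_ge0.
- by rewrite (le_trans (h2 i z))// addrAC lerDr addr_ge0.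
- by rewrite (le_trans (h3 (i, j) z))// lerDr addr_ge0.
Qed.

Let stationary_Dt (psi : smf) : (forall t x, psi (t, x) = psi (0, x)) -> Dt psi = 0.
Proof.
move=> psi0; apply: smf_DP => -[t x] _; rewrite smf0E.
apply: (is_derive_transport _ (is_derive_cst (psi (0, x)) (t, x) (1, 0))) => h.
 rewrite (_ : h *: (1, 0) + (t, x) = (h * 1 + t, h *: 0 + x)); last by [].
by rewrite scaler0 add0r psi0.
Qed.

(** Difference of the weak and the classical continuity equations; the initial terms cancel. A
    stationary test function leaves no time derivative, so the flux gap alone drives [rho - r], as
    [interpolation] requires. *)
Let gap_flux tau (psi : smf) : 0 < tau < T -> continuity_balance r rho J tau ->
  (forall t x, psi (t, x) = psi (0, x)) ->
  \int[torus]_x ((rho (tau, x) - r (tau, x)) * psi (0, x)) =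
  \int[itv_measure 0 tau]_t \int[torus]_x
    (\sum_i (J i (t, x) - r (t, x) * U i (t, x)) * Dx i psi (t, x)).
Proof.
move=> /andP[t0 tT] cb psi0; have tauT : 0 <= tau <= T by rewrite !ltW.
have Dt0 := stationary_Dt psi0.
have b1 : bmf (fun z : X4 => \sum_i J i z * Dx i psi z) by bmf_tac; exact: b_smf.
have b2 : bmf (fun z : X4 => \sum_i r z * U i z * Dx i psi z) by bmf_tac; exact: b_smf.
have e1 := cb psi.
have e2 : \int[torus]_x (r (tau, x) * psi (tau, x)) - \int[torus]_x (r (0, x) * psi (0, x)) =
    \int[itv_measure 0 tau]_t \int[torus]_x (\sum_i r (t, x) * U i (t, x) * Dx i psi (t, x)).
  have := smf_int_dt (r * psi) tauT.
  move=> E; transitivity (\int[torus]_x (r * psi) (tau, x) - \int[torus]_x (r * psi) (0, x)).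
    by [].
  rewrite E; apply: eq_Rintegral => t _.
  have := grad_pair_divergence (bs psi t) (fun i => bs (Dx i psi) t) (grad_pair_smf psi t)
    (erefl (divergence (fun i => r * U i))).
  have c1 : bmf (fun x : X3 => \sum_i Dx i psi (t, x) * (r * U i) (t, x)) by bmf_tac; exact: bs.
  have c2 : bmf (fun x : X3 => psi (t, x) * divergence (fun i => r * U i) (t, x)) by bmf_tac; exact: bs.
  rewrite (bmf_RintegralD torus c1 c2) => /eqP; rewrite addr_eq0 => /eqP c.
  transitivity (\int[torus]_x \sum_i Dx i psi (t, x) * (r * U i) (t, x)); last first.
    by apply: eq_Rintegral => x _; apply: eq_bigr => i _; rewrite smfME mulrC.
  rewrite c -(bmf_RintegralN torus c2); apply: eq_Rintegral => x _.
  have -> : divergence (fun i => r * U i) = - Dt r.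
    by apply/eqP; rewrite -addr_eq0 addrC; apply/eqP.
  by rewrite smf_DM Dt0 mulr0 addr0 smfME smfNE mulrN opprK mulrC.
have e1' : \int[torus]_x (rho (tau, x) * psi (tau, x)) - \int[torus]_x (r (0, x) * psi (0, x)) =
    \int[itv_measure 0 tau]_t \int[torus]_x (\sum_i J i (t, x) * Dx i psi (t, x)).
  rewrite e1; apply: eq_Rintegral => t _; apply: eq_Rintegral => x _.
  by rewrite Dt0 smf0E mulr0 add0r.
transitivity (\int[torus]_x (rho (tau, x) * psi (tau, x)) - \int[torus]_x (r (tau, x) * psi (tau, x))).
  rewrite -(bmf_RintegralB torus (bmfM (bt tau b_rho) (bs psi tau)) (bmfM (bs r tau) (bs psi tau))).
  by apply: eq_Rintegral => x _; rewrite mulrBl (psi0 tau x).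
transitivity (\int[itv_measure 0 tau]_t \int[torus]_x (\sum_i J i (t, x) * Dx i psi (t, x))
  - \int[itv_measure 0 tau]_t \int[torus]_x (\sum_i r (t, x) * U i (t, x) * Dx i psi (t, x))).
  by rewrite -e1' -e2 opprB addrA subrK.
rewrite -(bmf_RintegralB _ (bmf_fubini1 (itv_measure 0 tau) torus b1)
  (bmf_fubini1 (itv_measure 0 tau) torus b2)); apply: eq_Rintegral => t _.
rewrite -(bmf_RintegralB torus (bt t b1) (bt t b2)); apply: eq_Rintegral => x _.
by rewrite -sumrB; apply: eq_bigr => i _; rewrite mulrBl.
Qed.

Let gap_estimate : exists C : R, forall tau, 0 < tau < T -> good_time tau ->
  \int[torus]_x gap (tau, x) <= C * \int[itv_measure 0 tau]_t \int[torus]_x gap (t, x).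
Proof.
have [B [B0 hB]] := coefficient_bound.
have [ddp [cddp dddp]] := pd_derive2 pd.
have [Cp [Cp0 hCp]] := pos_taylor1 b a0 (pd_derive pd) dddp cddp.
have cdF : pos_continuous (fun s => dp s / s).
  move=> s s0; apply: cvgM; first exact: (pd_continuous pd).
  by apply: cvgV; [rewrite gt_eqF|exact: cvg_id].
have [CP [CP0 hCP]] := pos_taylor1 b a0 (pd_potential pd) (pd_potential' pd) cdF.
(* [C1] is the constant of [rel_density_bound], [C2] that of [flux_gap_bound], [Cp] and [CP] are
   Taylor constants of the pressure and its potential, and [dl] is the value demanded by
   [absorb]. *)
pose C1 := 12 * B + 3 * B * Cp + 2 * K * B; pose C2 := 4 * b + 6 * B ^+ 2.
pose dl := K / (2 * (CP + 1) * T).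
exists (2 * (C1 + (CP + 1) * ((2 * dl)^-1 * C2))) => tau tau_in [ok cb mb eb].
have [t0 tT] := andP tau_in.
have slices : {ae itv_measure 0 T, forall t : R, slice_ok Tp m rho Dr G t}.
  by apply: ae_mono good_times => t [].
have H := relative_energy_balance a0 ab pd r_ab continuity poisson Phi_mean velocity
  b_rho b_J b_Dr b_G rho_ab slices tau_in ok cb mb eb.
rewrite -(II_iter tau b_gap).
have T0 : 0 < T by [].
have CP1 : 0 < CP + 1 by rewrite ltr_wpDl.
have dl0 : 0 < dl by rewrite divr_gt0// !mulr_gt0.
have gapE : \int[torus]_x gap (tau, x) =
    \int[torus]_x relE (tau, x) + \int[torus]_x (rho (tau, x) - r (tau, x)) ^+ 2.
  exact: (bmf_RintegralD torus (bt tau b_relE) (bt tau b_sq)).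
rewrite gapE; apply: (absorb K0 T0 CP0 (erefl dl)).
- by apply: Rintegral_ge0 => x _; exact: relE_ge0.
- by apply: Rintegral_ge0 => x _; exact: sqr_ge0.
- have b_rel := bmf_rel_density K b_rho (b_smf r)
    (bmf_pos_continuous a0 (pd_continuous pd) (b_smf r).1 r_ab)
    (bmf_pos_continuous a0 (pos_derive_continuous (pd_derive pd)) b_rho.1 rho_ab)
    (bmf_pos_continuous a0 (pos_derive_continuous (pd_derive pd)) (b_smf r).1 r_ab)
    b_J b_Dr b_G (fun i => b_smf (U i)) (fun i => b_smf (Dx i r)) (fun i => b_smf (Dx i Phi))
    (fun i => b_smf (Dx i (divergence U))) (fun i j => b_smf (Dx i (U j))) a0 rho_ge.
  have cP := pos_derive_continuous (pd_potential pd).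
  have cF := pos_derive_continuous (pd_potential' pd).
  have b_pi : bmf (fun z : X4 => P (rho z) - P (r z) - F (r z) * (rho z - r z)).
    have b1 := bmf_pos_continuous a0 cP b_rho.1 rho_ab.
    have b2 := bmf_pos_continuous a0 cP (b_smf r).1 r_ab.
    have b3 := bmf_pos_continuous a0 cF (b_smf r).1 r_ab.
    by bmf_tac; exact: b_smf.
  have h1 : - II tau (fun z => rel_density K (rho z) (r z) (dp (r z)) (p (rho z)) (p (r z))
      (fun i => J i z) (fun i => Dr i z) (fun i => G i z) (fun i => U i z)
      (fun i => Dx i r z) (fun i => Dx i Phi z) (fun i => Dx i (divergence U) z)
      (fun i j => Dx i (U j) z)) <= C1 * II tau gap.
    rewrite -(bmf_RintegralN _ b_rel) -(bmf_RintegralZ _ C1 b_gap).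
    apply: (bmf_le_Rintegral _ (bmfN b_rel) (bmfM (bmf_cst _ C1) b_gap)) => z.
    have [h2 h3 h4] := hB z.
    exact: (rel_density_bound _ _ _ _ _ K0 (rho_gt0 z) Cp0 h4 h2 h3 (hCp _ _ (r_ab z) (rho_ab z))).
  have b_pi' : bmf (fun x : X3 => P (rho (tau, x)) - P (r (tau, x))
      - F (r (tau, x)) * (rho (tau, x) - r (tau, x))) := bt tau b_pi.
  have b_sq' : bmf (fun x : X3 => (rho (tau, x) - r (tau, x)) ^+ 2) := bt tau b_sq.
  have h2 : - (\int[torus]_x (P (rho (tau, x)) - P (r (tau, x))
      - F (r (tau, x)) * (rho (tau, x) - r (tau, x)))) <=
      CP * \int[torus]_x (rho (tau, x) - r (tau, x)) ^+ 2.
    rewrite -(bmf_RintegralN torus b_pi') -(bmf_RintegralZ torus CP b_sq').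
    apply: (bmf_le_Rintegral _ (bmfN b_pi') (bmfM (bmf_cst _ CP) b_sq')) => x.
    have := hCP _ _ (r_ab (tau, x)) (rho_ab (tau, x)); rewrite ler_norml => /andP[+ _].
    by rewrite lerNl.
  move: H h1 h2; move: (\int[torus]_x (P _ - _ - _)) (II tau _) => q1 q2.
  by move: (C1 * _) (CP * _) (\int[torus]_x _) => q3 q4 q5; lra.
- have bf : bmf (fun x : X3 => rho (tau, x) - r (tau, x)) := bmfB (bt tau b_rho) (bs r tau).
  have bg i : bmf (fun x : X3 => Dr i (tau, x) - Dx i r (tau, x)).
    exact: bmfB (bt tau (b_Dr i)) (bs (Dx i r) tau).
  have bj i : bmf (fun z : X4 => J i z - r z * U i z).
    exact: bmfB (b_J i) (bmfM (b_smf r) (b_smf (U i))).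
  have fg i (phi : smf) : \int[torus]_x ((rho (tau, x) - r (tau, x)) * Dx i phi (tau, x)) =
      - \int[torus]_x ((Dr i (tau, x) - Dx i r (tau, x)) * phi (tau, x)).
    have e1 := slice_gradient ok i phi; have e2 := grad_pair_smf r tau i phi.
    transitivity (\int[torus]_x (rho (tau, x) * Dx i phi (tau, x))
        - \int[torus]_x (r (tau, x) * Dx i phi (tau, x))).
      rewrite -(bmf_RintegralB torus (bmfM (bt tau b_rho) (bs _ tau)) (bmfM (bs r tau) (bs _ tau))).
      by apply: eq_Rintegral => x _; rewrite mulrBl.
    rewrite e1 e2 -opprD; congr (- _).
    rewrite -(bmf_RintegralB torus (bmfM (bt tau (b_Dr i)) (bs phi tau)) (bmfM (bs (Dx i r) tau) (bs phi tau))).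
    by apply: eq_Rintegral => x _; rewrite mulrBl.
  have I := interpolation bf bg bj dl0 (ltW t0) fg (fun psi => gap_flux (psi := psi) tau_in cb).
  have dli : 0 <= (2 * dl)^-1 by rewrite invr_ge0; apply: mulr_ge0 => //; exact: ltW.
  have dl2 : 0 <= dl / 2 by apply: divr_ge0 => //; exact: ltW.
  apply: (le_trans I); apply: lerD.
    have bS : bmf (fun z : X4 => \sum_i (J i z - r z * U i z) ^+ 2).
      by apply: bmf_sum => i; apply: bmfX; exact: bj.
    apply: (ler_wpM2l dli).
    have -> : \int[itv_measure 0 tau]_t \int[torus]_x
        (\sum_i (J i (t, x) - r (t, x) * U i (t, x)) ^+ 2) =
        II tau (fun z => \sum_i (J i z - r z * U i z) ^+ 2) := esym (II_iter tau bS).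
    rewrite -(bmf_RintegralZ _ C2 b_gap).
    apply: (bmf_le_Rintegral _ bS (bmfM (bmf_cst _ C2) b_gap)) => z.
    have [h2 _ _] := hB z.
    by apply: (flux_gap_bound _ _ _ _ _ _ (ltW K0) (rho_gt0 z) _ B0 h2); case/andP: (rho_ab z).
  have bS : bmf (fun x : X3 => \sum_i (Dr i (tau, x) - Dx i r (tau, x)) ^+ 2).
    by apply: bmf_sum => i; apply: bmfX; exact: bg.
  have S0 : 0 <= \int[torus]_x \sum_i (Dr i (tau, x) - Dx i r (tau, x)) ^+ 2.
    by apply: Rintegral_ge0 => x _; apply: sumr_ge0 => i _; exact: sqr_ge0.
  apply: (@le_trans _ _ (dl / 2 * T * \int[torus]_x \sum_i (Dr i (tau, x) - Dx i r (tau, x)) ^+ 2)).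
    by apply: (ler_wpM2r S0); apply: (ler_wpM2l dl2); exact: ltW.
  apply: (ler_wpM2l (mulr_ge0 dl2 (ltW T0))).
  have b_relE' : bmf (fun x : X3 => relE (tau, x)) := bt tau b_relE.
  rewrite -(bmf_RintegralZ torus (2 / K) b_relE').
  apply: (bmf_le_Rintegral _ bS (bmfM (bmf_cst _ (2 / K)) b_relE')) => x.
  exact: gradient_gap_bound.
Qed.

Theorem stability : {ae itv_measure 0 T, forall t : R,
  {ae torus, forall x, rho (t, x) = r (t, x) /\ forall i, J i (t, x) = r (t, x) * U i (t, x)}}.
Proof.
have [C HC] := gap_estimate.
have by_ : bmf (fun t : X1 => \int[torus]_x gap (t, x)).
  exact: (bmf_fubini1 (itv_measure 0 T) torus b_gap).
have y0 t : 0 <= \int[torus]_x gap (t, x) by apply: Rintegral_ge0 => x _; exact: gap_ge0.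
have T0 : 0 < T by [].
have yC : {ae itv_measure 0 T, forall t : R, \int[torus]_x gap (t, x) <=
    C * \int[itv_measure 0 t]_s \int[torus]_x gap (s, x)}.
  by apply: ae_mono2 (ae_itv_measure 0 T) good_times => t; exact: HC.
apply: ae_mono (gronwall T0 by_ y0 yC) => t gt.
have g0 : \int[torus]_x gap (t, x) <= 0 by rewrite gt.
apply: ae_mono (bmf_Rintegral_eq0 (bt t b_gap) (fun x => gap_ge0 (t, x)) g0) => x.
exact: gap_eq0.
Qed.

End Stability.

(** * From the weak and classical formulations to the stability estimate *)

Section LebesgueSpaces.
Context {R : realType} d (X : measurableType d) (mu : {finite_measure set X -> \bar R}).
Implicit Types f g : X -> R.

Lemma Lfun_measurable q f : f \in Lfun mu q -> measurable_fun setT f.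
Proof. by rewrite inE => /andP[/[!inE]/=]. Qed.

Lemma bmf_Lfun1 f : bmf f -> f \in Lfun mu 1%E.
Proof. by move=> bf; apply/Lfun1_integrable; exact: bmf_integrable. Qed.

Lemma bmf_Lfun2 f : bmf f -> f \in Lfun mu 2%:E.
Proof.
move=> bf; rewrite inE; apply/andP; split; rewrite inE/=; first by case: bf.
rewrite /finite_norm unlock poweR_lty//.
under eq_integral => x _ do rewrite /= powR_mulrn// real_normK ?num_real//.
by rewrite (bmf_integralE mu (bmfX 2 bf)) ltry.
Qed.

Lemma Lfun2_Lfun1 f : f \in Lfun mu 2%:E -> f \in Lfun mu 1%E.
Proof. by apply: Lfun_subset12; exact: fin_num_measure. Qed.

Lemma Lfun_oo_bounded f : f \in Lfun mu +oo%E ->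
  measurable_fun setT f /\ exists M : R, {ae mu, forall x, `|f x| <= M}.
Proof.
move=> Lf; split; first exact: Lfun_measurable Lf.
move: Lf; rewrite inE => /andP[_]; rewrite inE/= /finite_norm unlock.
case: ifPn => [_|]; first exact: ess_sup_inf.ess_supr_bounded.
(* The essential supremum is only meaningful for a measure of positive mass; for the zero measure
   every bound holds almost everywhere. *)
rewrite lt0e measure_ge0 andbT negbK => /eqP mu0 _; exists 0.
by exists setT; split => //; exact: measurableT.
Qed.

Lemma bmf_mul_integrable f g : mu.-integrable setT (EFin \o f) -> bmf g ->
  mu.-integrable setT (EFin \o (fun x => f x * g x)).
Proof.
move=> If [mg [C gC]]; apply: (@le_integrable _ _ _ mu setT measurableT _ (fun x => C%:E * (f x)%:E)%E).
- by apply/measurable_EFinP/measurable_funM => //; case/integrableP: If => /measurable_EFinP.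
- move=> x _ /=; rewrite lee_fin normrM normrM mulrC ler_wpM2r//.
  exact: le_trans (gC x) (ler_norm _).
- by apply: integrableZl.
Qed.

(* Testing f with its own truncation. *)
Lemma integrable_eq0 f : mu.-integrable setT (EFin \o f) ->
  (forall psi, psi \in Lfun mu 2%:E -> \int[mu]_x (f x * psi x) = 0) ->
  {ae mu, forall x, f x = 0}.
Proof.
move=> If f0; have mf : measurable_fun setT f by case/integrableP: If => /measurable_EFinP.
pose psi x := f x / (1 + `|f x|).
have den x : 0 < 1 + `|f x| by rewrite ltr_wpDr.
have bpsi : bmf psi.
  split; last by exists 1 => x; rewrite normrM normfV (gtr0_norm (den x)) ler_pdivrMr// mul1r lerDr.
  have -> : psi = (fun r : R => r / (1 + `|r|)) \o f by [].
  apply: measurableT_comp => //; apply: continuous_measurable_fun => r.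
  apply: cvgM; first exact: cvg_id.
  apply: cvgV; first by rewrite gt_eqF// ltr_wpDr.
  by apply: cvgD; [exact: cvg_cst|apply: cvg_norm; exact: cvg_id].
have p0 x : 0 <= f x * psi x.
  by rewrite /psi mulrA -expr2 divr_ge0 ?sqr_ge0// ltW.
have I0 := f0 _ (bmf_Lfun2 bpsi).
have Ifp := bmf_mul_integrable If bpsi.
have : (\int[mu]_(x in setT) `|(f x * psi x)%:E| = 0)%E.
  under eq_integral do rewrite /= ger0_norm//.
  rewrite -[LHS]fineK; first by congr EFin; exact: I0.
  exact: (integrable_fin_num measurableT Ifp).
have mp : measurable_fun setT (EFin \o (fun x => f x * psi x)) by case/integrableP: Ifp.
move/(ae_eq_integral_abs mu measurableT mp) => [N [mN N0 sN]].
exists N; split => // x /= fx; apply: sN => /= fx0; apply: fx.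
have /eqP := EFin_inj (fx0 I); rewrite mulf_eq0 => /orP[/eqP//|].
by rewrite mulf_eq0 invr_eq0 (gt_eqF (den x)) orbF => /eqP.
Qed.

End LebesgueSpaces.

Section AeProductIter.
Context {R : realType} d1 d2 (X1 : measurableType d1) (X2 : measurableType d2).
Variables (m1 : {finite_measure set X1 -> \bar R}) (m2 : {finite_measure set X2 -> \bar R}).

(** Fubini for the indicator of a null set: almost every slice has zero integral, hence is null. *)
Lemma ae_prod_iter (P : X1 * X2 -> Prop) : {ae (m1 \x m2)%E, forall z, P z} ->
  {ae m1, forall x, {ae m2, forall y, P (x, y)}}.
Proof.
move=> [A [mA A0 PA]].
have bA : bmf (\1_A : X1 * X2 -> R) by exact: bmf_indic.
have bA1 := bmf_fubini1 m1 m2 bA.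
have I0 : \int[m1]_x \int[m2]_y (\1_A (x, y) : R) = 0.
  rewrite -(bmf_Rintegral_prod m1 m2 bA) /Rintegral integral_indic// setIT.
  by rewrite [X in fine X]A0.
have h : {ae m1, forall x, \int[m2]_y (\1_A (x, y) : R) = 0}.
  apply: (bmf_Rintegral_eq0 bA1); last by rewrite I0.
  by move=> x; apply: Rintegral_ge0 => y _; rewrite indicE.
apply: ae_mono h => x hx.
have : {ae m2, forall y, (\1_A (x, y) : R) = 0}.
  apply: (bmf_Rintegral_eq0 (bmf_slice x bA)); last by rewrite hx.
  by move=> y; rewrite indicE.
apply: ae_mono => y; rewrite indicE => /eqP; rewrite pnatr_eq0 eqb0 => /negP nA.
by apply: contrapT => nP; apply: nA; apply/mem_set; exact: PA.
Qed.
End AeProductIter.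

Section Clamping.
Context {R : realType} d (X : measurableType d).

Definition truncate (a b s : R) : R := Num.max a (Num.min s b).

Lemma truncate_in a b s : a <= b -> a <= truncate a b s <= b.
Proof. by move=> ab; rewrite /truncate le_max lexx/= ge_max ab ge_min lexx orbT. Qed.

Lemma truncate_id a b s : a <= s <= b -> truncate a b s = s.
Proof. by move=> /andP[as_ sb]; rewrite /truncate min_l// max_r. Qed.

Lemma bmf_truncate a b (f : X -> R) : a <= b -> measurable_fun setT f ->
  bmf (fun x => truncate a b (f x)).
Proof.
move=> ab mf; apply: (@bmf_comp _ _ _ (truncate a b) f (`|a| + `|b|)) => //.
- have -> : truncate a b = (fun=> a) \max ((fun s => s) \min (fun=> b)) by [].
  move=> s; apply: continuous_max; first exact: cvg_cst.
  by apply: continuous_min; [exact: cvg_id|exact: cvg_cst].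
- move=> x; have /andP[h1 h2] := truncate_in (f x) ab.
  rewrite ler_norml (le_trans h2) ?andbT; last by rewrite (le_trans (ler_norm b))// lerDr.
  by rewrite (le_trans _ h1)// lerNl (le_trans (ler_norm _))// normrN lerDl.
Qed.
End Clamping.

Section SmoothBridge.
Context {R : realType}.
Variable Tp : {posnum R}.
Local Notation T := (Tp%:num).
Notation smf := (smf Tp).
Notation D := (@smf_D _ Tp).
Notation R3 := (R * R * R)%type.
Notation torus := (@torus_measure R).

Lemma derive_smf (u : R * R3 -> R) (w : smf) v (z : R * R3) :
  (forall y : R * R3, 0 < y.1 < T -> u y = w y) -> 0 < z.1 < T -> 'D_v u z = D v w z.
Proof.
move=> uw zT; rewrite -(smf_derive v w zT); apply: near_eq_derive.
by apply: filterS (interior_slab_nbhs zT) => y; exact: uw.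
Qed.

Lemma derive_smf_comp (f df : R -> R) (u : R * R3 -> R) (w : smf) v (z : R * R3) :
  (forall y : R * R3, 0 < y.1 < T -> u y = w y) -> 0 < z.1 < T ->
  is_derive (w z) (1 : R) f (df (w z)) ->
  'D_v (fun y => f (u y)) z = df (w z) * D v w z.
Proof.
move=> uw zT dfw.
have -> : 'D_v (fun y => f (u y)) z = 'D_v (fun y => f (w y)) z.
  apply: near_eq_derive; apply: filterS (interior_slab_nbhs zT) => y yT.
  by rewrite uw.
have dw : is_derive (0 : R) (1 : R) (fun s => w (s *: v + z)) (D v w z).
  apply: (is_derive_transport _ (smf_is_derive v w zT)) => h.
  by rewrite addr0 -[h *: 1]/(h * 1) mulr1.
have dfw' : is_derive (w (0 *: v + z)) (1 : R) f (df (w z)) by rewrite scale0r add0r.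
have dc := @is_derive1_comp R f (fun s => w (s *: v + z)) 0 _ _ dfw' dw.
have : is_derive z v (fun y => f (w y)) (df (w z) * D v w z).
  apply: (is_derive_transport _ dc) => h /=.
  by rewrite addr0 -[h *: 1]/(h * 1) mulr1.
by move=> [_ ->].
Qed.

(* A smooth function on the torus, seen as constant in time. *)
Lemma smooth_torus_spacetime (psi : R3 -> R) : smooth_torus psi ->
  smooth_spacetime T (fun z => psi z.2).
Proof.
move=> [spsi ppsi]; split => [k|i t x _]; last exact: ppsi.
have {ppsi spsi} : Ck setT k psi by exact: spsi.
have cont (g : R3 -> R) : {within setT, continuous g} ->
    {within slab T, continuous (fun z : R * R3 => g z.2)}.
  move=> cg; apply: continuous_subspaceT => z.
  have cg' : continuous g by move=> x; move: (cg x); rewrite /continuous_at nbhs_subspaceT.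
  by apply: (@continuous_comp _ _ _ snd g); [exact: cvg_snd|exact: cg'].
elim: k psi => [|k IHk] psi [cpsi dpsi]; first by split => //; exact: cont.
split; first exact: cont.
move=> v; have [g [Cg dg]] := dpsi v.2; exists (fun z => g z.2); split; first exact: IHk.
move=> z _; have iz : setT^° z.2 by rewrite interiorT.
apply: (is_derive_transport _ (dg z.2 iz)) => h; by [].
Qed.

Definition torus_smf (psi : R3 -> R) (spsi : smooth_torus psi) : smf :=
  mk_smf (smooth_torus_spacetime spsi).

Lemma torus_smfE psi (spsi : smooth_torus psi) z : torus_smf spsi z = psi z.2.
Proof. by []. Qed.

Lemma torus_smf_D psi (spsi : smooth_torus psi) v t x : 0 < t < T ->
  D (0, v) (torus_smf spsi) (t, x) = 'D_v psi x.
Proof.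
move=> tT; have := smf_is_derive (0, v) (torus_smf spsi) (z := (t, x)) tT.
move=> /(@is_derive_transport _ _ _ _ (torus_smf spsi) psi _ _ x v) h.
by have [|_ ->] := h.
Qed.

(** Endpoint times are included because the gradient and the potential of the initial data are
    tested at time 0. *)
Lemma torus_smf_D_closed psi (spsi : smooth_torus psi) v t x :
  D (0, v) (torus_smf spsi) (t, x) = 'D_v psi x.
Proof.
apply: (@interior_times_dense _ Tp (fun t => D (0, v) (torus_smf spsi) (t, x)) (fun=> 'D_v psi x)).
- move=> s; apply: (@continuous_comp _ _ _ (fun s => (s, x)) (D (0, v) (torus_smf spsi))).
    by apply: (@cvg_pair _ _ _ _ (nbhs s) (nbhs x)); [exact: cvg_id|exact: cvg_cst].
  exact: smf_continuous.
- by move=> s; exact: cvg_cst.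
- by move=> s; rewrite smf_clamp.
- by [].
- by move=> s sT; exact: torus_smf_D.
Qed.

End SmoothBridge.

(** * The classical solution in terms of density and velocity *)

Section ClassicalSolution.
Context {R : realType}.
Variable Tp : {posnum R}.
Local Notation T := (Tp%:num).
Notation smf := (smf Tp).
Notation Dx i := (@smf_D _ Tp (0, Defs.basis i)).
Notation Dt := (@smf_D _ Tp (1, 0)).
Notation R3 := (R * R * R)%type.
Notation torus := (@torus_measure R).
Variables (K : R) (p dp F : R -> R) (pd : pressure_data p dp F).
Variables (rho0 : R3 -> R) (J0 : R3 -> 'rV[R]_3).
Variables (rho : R * R3 -> R) (J : R * R3 -> 'rV[R]_3) (V : R * R3 -> R).
Hypothesis sol : classical_solution_with (fun=> K) p T rho0 J0 rho J V.

Let r : smf := mk_smf (cs_rho_smooth sol).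
Let M i : smf := mk_smf (cs_J_smooth sol i).
Let Phi : smf := mk_smf (cs_V_smooth sol).

Let rE z : slab T z -> r z = rho z. Proof. exact: mk_smfE. Qed.
Let ME i z : slab T z -> M i z = J z 0 i. Proof. by move=> zT; rewrite mk_smfE. Qed.
Let PhiE z : slab T z -> Phi z = V z. Proof. exact: mk_smfE. Qed.

Let r_gt0 z : 0 < r z.
Proof. by apply: (cs_rho_gt0 sol); exact: clampt_in. Qed.
Let r_neq0 z : slab T z -> r z != 0. Proof. by rewrite gt_eqF. Qed.
Let rV : smf := smf_inv r_neq0.
Let U i : smf := M i * rV.

Let rVE z : rV z = (r z)^-1. Proof. by []. Qed.
Let rU i : r * U i = M i.
Proof.
apply: smf_eq => z; rewrite smfME (smfME (M i) rV) rVE mulrCA mulfV ?mulr1// gt_eqF//.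
Qed.

Let interior_rE z : 0 < z.1 < T -> rho z = r z. Proof. by move=> /slabW /rE ->. Qed.
Let interior_ME i z : 0 < z.1 < T -> J z 0 i = M i z. Proof. by move=> /slabW /ME ->. Qed.
Let interior_PhiE z : 0 < z.1 < T -> V z = Phi z. Proof. by move=> /slabW /PhiE ->. Qed.

(** The inverse of the density is again smooth and periodic, hence bounded. *)
Let lower_bound : exists2 c, 0 < c & forall z, c <= r z.
Proof.
have [C rC] := smf_bounded rV.
have C0 : 0 < C by rewrite (lt_le_trans _ (rC (0, 0)))// normr_gt0 rVE invr_eq0 gt_eqF.
exists C^-1 => [|z]; first by rewrite invr_gt0.
have := rC z; rewrite rVE ger0_norm ?invr_ge0 ?(ltW (r_gt0 z))// => h.
by rewrite -[r z]invrK lef_pV2 ?posrE ?invr_gt0.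
Qed.

Let continuity : Dt r + \sum_i Dx i (r * U i) = 0.
Proof.
apply: smf_ext => t x tT; rewrite smfDE smf_sumE smf0E.
apply: etrans (cs_continuity sol x tT); congr (_ + _); first by rewrite /dt (derive_smf _ interior_rE).
by apply: eq_bigr => i _; rewrite rU /dx (derive_smf _ (interior_ME i)).
Qed.

Let laplE (u : R * R3 -> R) (w : smf) z : (forall y : R * R3, 0 < y.1 < T -> u y = w y) ->
  0 < z.1 < T -> laplx u z = laplacian w z.
Proof.
move=> uw zT; rewrite /laplx /laplacian smf_sumE; apply: eq_bigr => i _; rewrite /dx.
by apply: derive_smf => // y yT; exact: derive_smf.
Qed.

Let poisson : \sum_i Dx i (Dx i Phi) = r - smf_cst Tp (mean rho0).
Proof.
apply: smf_ext => t x tT; transitivity (laplacian Phi (t, x)); first by [].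
rewrite -(laplE (z := (t, x)) interior_PhiE tT) (cs_poisson sol x tT).
by rewrite interior_rE.
Qed.

Let Phi_mean t : \int[torus]_x Phi (t, x) = 0.
Proof. by rewrite -[RHS](cs_V_mean sol (clampt_in _ t)). Qed.

Let velocity i t x : 0 < t < T ->
  Dt (U i) (t, x) + \sum_j U j (t, x) * Dx j (U i) (t, x) + U i (t, x)
  + dp (r (t, x)) / r (t, x) * Dx i r (t, x) - K * Dx i (laplacian r) (t, x)
  - Dx i Phi (t, x) = 0.
Proof.
move=> tT; have zT : 0 < (t, x).1 < T by [].
have := cs_momentum sol i x tT.
rewrite /dt (derive_smf _ (interior_ME i) zT).
have e1 j : dx j (fun z => J z 0 i * J z 0 j / rho z) (t, x) = Dx j (M i * U j) (t, x).
  apply: derive_smf => // y yT; rewrite smfME (smfME (M j) rV) rVE.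
  by rewrite !interior_ME// interior_rE// mulrA.
under eq_bigr do rewrite e1.
rewrite /dx (derive_smf_comp _ interior_rE zT (pd_derive pd (r_gt0 (t, x)))).
rewrite (derive_smf _ interior_PhiE zT) interior_ME// interior_rE//.
have e2 : 'D_(0, Defs.basis i) (fun z => K * laplx rho z + 2^-1 * derive1 (fun=> K) (rho z)
    * dot (gradx rho z) (gradx rho z)) (t, x) = K * Dx i (laplacian r) (t, x).
  transitivity (Dx i (smf_cst Tp K * laplacian r) (t, x)); last by rewrite smf_DZ.
  apply: derive_smf => // y yT; rewrite derive1_cst mulr0 mul0r addr0.
  by rewrite (laplE interior_rE yT).
rewrite e2 => E.
have c0 : (Dt r + \sum_j Dx j (r * U j)) (t, x) = 0 by rewrite continuity.
(* The conservative left side is [U i] times the continuity equation plus [r] times the material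
   derivative of [U i]. The former vanishes and [r] can be divided out. *)
have e3 : Dt (M i) + \sum_j Dx j (M i * U j) =
   U i * (Dt r + \sum_j Dx j (r * U j)) + r * (Dt (U i) + \sum_j U j * Dx j (U i)).
  rewrite -(rU i) smf_DM !mulrDr !mulr_sumr.
  rewrite [U i * Dt r]mulrC [RHS]addrACA -big_split/=; congr (_ + _).
  apply: eq_bigr => j _.
  by rewrite !smf_DM; ring.
have {}e3 : Dt (M i) (t, x) + \sum_j Dx j (M i * U j) (t, x) =
    r (t, x) * (Dt (U i) (t, x) + \sum_j U j (t, x) * Dx j (U i) (t, x)).
  have := congr1 (fun u : smf => u (t, x)) e3; rewrite continuity mulr0 add0r.
  rewrite smfDE smf_sumE smfME smfDE smf_sumE => ->.
  by congr (_ * (_ + _)); apply: eq_bigr => j _; rewrite smfME.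
have Mi : M i (t, x) = r (t, x) * U i (t, x) by rewrite -(rU i) smfME.
rewrite e3 Mi in E.
have r0 : r (t, x) != 0 by rewrite gt_eqF.
apply: (mulfI r0); rewrite mulr0; move: E r0.
move: (Dx i r (t, x)) (Dx i (laplacian r) (t, x)) (Dx i Phi (t, x)) => G H L.
move: (\sum_j _) (Dt (U i) (t, x)) (U i (t, x)) (dp (r (t, x))) => A B C E.
move: (r (t, x)) => r' e r'0.
have -> : r' * (B + A + C + E / r' * G - K * H - L) =
    (r' * (B + A) + E * G) - (- (r' * C) + r' * (K * H) + r' * L) by field.
by rewrite e subrr.
Qed.

Lemma classical_solution_smf : exists (r Phi : smf) (U : 'I_3 -> smf),
  [/\ forall z, slab T z -> r z = rho z /\ forall i, r z * U i z = J z 0 i,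
      exists2 c, 0 < c & forall z, c <= r z,
      [/\ Dt r + \sum_i Dx i (r * U i) = 0,
          \sum_i Dx i (Dx i Phi) = r - smf_cst Tp (mean rho0) &
          forall t, \int[torus]_x Phi (t, x) = 0] &
      forall i t x, 0 < t < T ->
        Dt (U i) (t, x) + \sum_j U j (t, x) * Dx j (U i) (t, x) + U i (t, x)
        + dp (r (t, x)) / r (t, x) * Dx i r (t, x) - K * Dx i (laplacian r) (t, x)
        - Dx i Phi (t, x) = 0].
Proof.
exists r, Phi, U; split; [|exact: lower_bound| |exact: velocity].
  move=> z zT; split; first exact: rE.
  by move=> i; rewrite -[RHS](ME i zT) -(rU i) smfME.
by split; [exact: continuity|exact: poisson|exact: Phi_mean].
Qed.

End ClassicalSolution.

Lemma sum3_sqr_dot (R : realType) (u : 'rV[R]_3) : dot u u = \sum_i u 0 i ^+ 2.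
Proof. by apply: eq_bigr => i _; rewrite expr2. Qed.

Lemma dot_grad_sqrt (R : realType) (r : R) (g : 'rV[R]_3) : 0 < r ->
  4 * r * dot (grad_sqrt r g) (grad_sqrt r g) = \sum_i g 0 i ^+ 2.
Proof.
move=> r0; rewrite /dot mulr_sumr; apply: eq_bigr => i _; rewrite !mxE.
have q0 : Num.sqrt r != 0 by rewrite gt_eqF// sqrtr_gt0.
by rewrite -{1}(sqr_sqrtr (ltW r0)); field.
Qed.

Lemma derive1_chi_cst (R : realType) (K r : R) : derive1 (chi (fun=> K)) r = K.
Proof.
rewrite /chi derive1E; have h : is_derive r (1 : R) (fun s => s * K) (r *: 0 + K *: 1).
  exact: (is_deriveM (is_derive_id r 1) (is_derive_cst K r 1)).
have [_ ->] := h.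
by rewrite scaler0 add0r -[_ *: _]/(K * 1) mulr1.
Qed.

(** * The balance laws of the weak solution, for bounded representatives *)

Section WeakSolution.
Context {R : realType}.
Variable Tp : {posnum R}.
Local Notation T := (Tp%:num).
Notation smf := (smf Tp).
Notation D := (@smf_D _ Tp).
Notation Dx i := (@smf_D _ Tp (0, Defs.basis i)).
Notation Dt := (@smf_D _ Tp (1, 0)).
Notation R3 := (R * R * R)%type.
Notation X1 := (measurableTypeR R).
Notation X3 := (X1 * X1 * X1)%type.
Notation X4 := (X1 * X3)%type.
Notation torus := (@torus_measure R).
Notation II tau f := (\int[spacetime_measure tau]_z f z).
Variables (a b K : R) (p : R -> R).
Hypothesis a0 : 0 < a.
Notation P := (pressure_potential p).
Variables (rho0 : R3 -> R) (J0 : R3 -> 'rV[R]_3).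
Variables (rho : R * R3 -> R) (J Drho : R * R3 -> 'rV[R]_3) (V : R * R3 -> R)
  (DV : R * R3 -> 'rV[R]_3).
Hypothesis sol : bounded_energy_weak_solution (fun=> K) p T rho0 J0 rho J Drho V DV.

Variables (rho' : X4 -> R) (J' D' G' : 'I_3 -> X4 -> R).
Hypotheses (b_rho : bmf rho') (b_J : forall i, bmf (J' i)) (b_D : forall i, bmf (D' i))
  (b_G : forall i, bmf (G' i)) (rho_ab : forall z, a <= rho' z <= b).

Definition agree (t : R) : Prop := {ae torus, forall x,
  [/\ rho (t, x) = rho' (t, x), forall i, J (t, x) 0 i = J' i (t, x),
      forall i, Drho (t, x) 0 i = D' i (t, x) & forall i, DV (t, x) 0 i = G' i (t, x)]}.
Hypothesis agrees : {ae itv_measure 0 T, forall t : R, agree t}.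

Variables (r Phi : smf) (U : 'I_3 -> smf).
Hypothesis poisson : \sum_i Dx i (Dx i Phi) = r - smf_cst Tp (mean rho0).
Hypothesis Phi_mean : forall t, \int[torus]_x Phi (t, x) = 0.
Hypothesis initial : {ae torus, forall x, [/\ rho (0, x) = r (0, x), rho0 x = r (0, x),
  forall i, J (0, x) 0 i = r (0, x) * U i (0, x) & forall i, J0 x 0 i = r (0, x) * U i (0, x)]}.
Hypothesis r_ge : forall z, a <= r z.
Hypothesis b_Pr : bmf (fun z : X4 => P (r z)).
Hypothesis b_Prho : bmf (fun z : X4 => P (rho' z)).
Hypothesis b_prho : bmf (fun z : X4 => p (rho' z)).

Let bs (u : smf) t : bmf (fun x : X3 => u (t, x)) := smf_bmf_slice u t.
Let bt (f : X4 -> R) t : bmf f -> bmf (fun x => f (t, x)).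
Proof. by move=> bf; exact: (bmf_slice t bf). Qed.
Let rho_gt0 z : 0 < rho' z. Proof. by case/andP: (rho_ab z) => /(lt_le_trans a0). Qed.
Let r_gt0 z : 0 < r z. Proof. exact: lt_le_trans (r_ge z). Qed.
Let b_rhoV : bmf (fun z => (rho' z)^-1).
Proof. by apply: (bmfV a0 b_rho) => z; case/andP: (rho_ab z). Qed.

Lemma slice_ok_weak t : 0 < t < T -> agree t ->
  weak_gradient (fun x => rho (t, x)) (fun x => Drho (t, x)) ->
  slice_ok Tp (mean rho0) rho' D' G' t.
Proof.
move=> tT ag [_ _ wg].
have tT' : 0 <= t <= T by case/andP: tT => /ltW -> /ltW ->.
have [V2 _ [V1 _ wV] _ wP] := bews_V sol tT'.
split.
- move=> i phi; have h := wg _ (smf_slice phi tT) i.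
  transitivity (\int[torus]_x (rho (t, x) * 'D_(Defs.basis i) (fun x => phi (t, x)) x)).
    apply: Rintegral_ae; apply: ae_mono ag => x [-> _ _ _].
    by rewrite smf_slice_derive.
  rewrite h; congr (- _); apply: Rintegral_ae; apply: ae_mono ag => x [_ _ h1 _].
  by rewrite h1.
- move=> phi; have h := wP _ (smf_slice phi tT).
  transitivity (\int[torus]_x (\sum_i DV (t, x) 0 i * 'D_(Defs.basis i) (fun x => phi (t, x)) x)).
    apply: Rintegral_ae; apply: ae_mono ag => x [_ _ _ h1]; apply: eq_bigr => i _.
    by rewrite h1 smf_slice_derive.
  by rewrite h; congr (- _); apply: Rintegral_ae; apply: ae_mono ag => x [-> _ _ _].
(* [G] agrees with the weak gradient of [V]: integration by parts, one component at a time, turns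
   the integral into minus that of [V] times [div N]. *)
- move=> N dN.
  have IV : torus.-integrable setT (EFin \o (fun x => V (t, x))) by apply/Lfun1_integrable.
  have b1 i : bmf (fun x => G' i (t, x) * N i (t, x)) := bmfM (bt t (b_G i)) (bs (N i) t).
  have I1 i : torus.-integrable setT (EFin \o (fun x => V (t, x) * Dx i (N i) (t, x))).
    exact: (bmf_mul_integrable IV (bs (Dx i (N i)) t)).
  rewrite bmf_Rintegral_sum//.
  transitivity (\sum_i - \int[torus]_x (V (t, x) * Dx i (N i) (t, x))).
    apply: eq_bigr => i _; have h := wV _ (smf_slice (N i) tT) i.
    have -> : \int[torus]_x (V (t, x) * Dx i (N i) (t, x)) =
        \int[torus]_x (V (t, x) * 'D_(Defs.basis i) (fun x => N i (t, x)) x).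
      by apply: eq_Rintegral => x _; rewrite smf_slice_derive.
    rewrite h opprK; apply: Rintegral_ae; apply: ae_mono ag => x [_ _ _ h1].
    by rewrite h1.
  rewrite sumrN (_ : \sum_i _ = 0) ?oppr0//.
  have I2 : torus.-integrable setT (EFin \o (fun x => V (t, x) * Dx 1 (N 1) (t, x)
      + V (t, x) * Dx 2 (N 2) (t, x))) by exact: (integrableD measurableT (I1 1) (I1 2)).
  rewrite sum3 -(RintegralD _ (I1 1) (I1 2))// -(RintegralD _ (I1 0) I2)//.
  apply: Rintegral_eq0_fun => x.
  have := congr1 (fun u : smf => u (t, x)) dN; rewrite divergenceE sum3 smf0E => E.
  by rewrite -!mulrDr E mulr0.
Qed.

Lemma iterated_II tau (f : R * R3 -> R) (f' : X4 -> R) : bmf f' ->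
  {ae itv_measure 0 tau, forall s : R, {ae torus, forall x, f (s, x) = f' (s, x)}} ->
  \int[lebesgue_measure]_(t in `[0, tau]) \int[torus]_x f (t, x) = II tau f'.
Proof.
move=> bf ff; rewrite -Rintegral_itv_measure (II_iter _ bf).
by apply: Rintegral_ae; apply: ae_mono ff => s; exact: Rintegral_ae.
Qed.

Let agrees_to tau : 0 < tau < T ->
  {ae itv_measure 0 tau, forall s : R, 0 < s < T /\ agree s}.
Proof.
move=> /andP[t0 tT]; apply: ae_mono2 (ae_itv_measure 0 tau) (ae_itv_measureS (ltW tT) agrees).
by move=> s /andP[s0 st] ag; split => //; rewrite s0 (lt_trans st).
Qed.

Lemma continuity_balance_weak tau : 0 < tau < T -> agree tau ->
  continuity_balance r rho' J' tau.
Proof.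
move=> tau_in ag phi; have [t0 tT] := andP tau_in.
have := bews_continuity sol (lexx 0) t0 (ltW tT) (smf_smooth phi).
have bf : bmf (fun z : X4 => rho' z * Dt phi z + \sum_i J' i z * Dx i phi z).
  by bmf_tac; exact: smf_bmf.
rewrite (iterated_II (f := fun z => rho z * dt phi z + dot (J z) (gradx phi z)) bf); last first.
  apply: ae_mono (agrees_to tau_in) => s [sT ags]; apply: ae_mono ags => x [-> h _ _].
  rewrite /dt smf_derive//; congr (_ + _); apply: eq_bigr => i _.
  by rewrite h mxE /dx smf_derive.
have -> : \int[torus]_x (rho (tau, x) * phi (tau, x)) = \int[torus]_x (rho' (tau, x) * phi (tau, x)).
  by apply: Rintegral_ae; apply: ae_mono ag => x [-> _ _ _].
have -> : \int[torus]_x (rho (0, x) * phi (0, x)) = \int[torus]_x (r (0, x) * phi (0, x)).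
  by apply: Rintegral_ae; apply: ae_mono initial => x [-> _ _ _].
rewrite -(II_iter tau bf).
by move=> /eqP; rewrite addrC subr_eq0 => /eqP ->.
Qed.

Let Uvec (z : R * R3) : 'rV[R]_3 := \row_i U i z.
Let UvecE i : (fun z => Uvec z 0 i) = U i. Proof. by apply/funext => z; rewrite mxE. Qed.

Let Uvec_derive v i z : 0 < z.1 < T -> 'D_v (fun y => Uvec y 0 i) z = D v (U i) z.
Proof. by move=> zT; rewrite UvecE smf_derive. Qed.

Let Uvec_div z : 0 < z.1 < T -> divx Uvec z = divergence U z.
Proof. by move=> zT; rewrite divergenceE; apply: eq_bigr => i _; exact: Uvec_derive. Qed.

(** Product rule for the gradient of [K rho div U], the field [H] that the weak momentum equation
    asks for when tested with [U]. *)
Let Hvec (z : R * R3) : 'rV[R]_3 :=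
  \row_i (K * (D' i z * divergence U z + rho' z * Dx i (divergence U) z)).

Let b_H i : bmf (fun z : X4 => K * (D' i z * divergence U z + rho' z * Dx i (divergence U) z)).
Proof. by bmf_tac; exact: smf_bmf. Qed.

Let Hvec_gradient s : 0 < s < T -> agree s ->
  weak_gradient (fun x => rho (s, x)) (fun x => Drho (s, x)) ->
  weak_gradient (fun x => chi (fun=> K) (rho (s, x)) * divx Uvec (s, x)) (fun x => Hvec (s, x)).
Proof.
move=> sT ag wg; have [r1 _ _] := wg.
have chiE : (fun x => chi (fun=> K) (rho (s, x)) * divx Uvec (s, x)) =
    (fun x => rho (s, x) * (K * divergence U (s, x))).
  by apply/funext => x; rewrite /chi Uvec_div// mulrA.
split.
- rewrite chiE; apply/Lfun1_integrable; apply: bmf_mul_integrable; first exact/Lfun1_integrable.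
  exact: (bmfM (bmf_cst _ K) (bs _ s)).
- move=> i; have -> : (fun x => Hvec (s, x) 0 i) = (fun x => K * (D' i (s, x) * divergence U (s, x)
      + rho' (s, x) * Dx i (divergence U) (s, x))) by apply/funext => x; rewrite mxE.
  exact: (bmf_Lfun1 torus (bt s (b_H i))).
move=> psi spsi i; pose q := torus_smf Tp spsi.
have ok := slice_ok_weak sT ag wg.
have h := slice_gradient ok i (divergence U * q).
have b1 : bmf (fun x => rho' (s, x) * (divergence U * q) (s, x)) := bmfM (bt s b_rho) (bs _ s).
have b2 : bmf (fun x => rho' (s, x) * (Dx i (divergence U) * q) (s, x)) := bmfM (bt s b_rho) (bs _ s).
have b3 : bmf (fun x => rho' (s, x) * (divergence U * Dx i q) (s, x)) := bmfM (bt s b_rho) (bs _ s).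
have b4 : bmf (fun x => D' i (s, x) * (divergence U * q) (s, x)) := bmfM (bt s (b_D i)) (bs _ s).
have {}h : \int[torus]_x (rho' (s, x) * (divergence U * Dx i q) (s, x)) =
    - \int[torus]_x (D' i (s, x) * (divergence U * q) (s, x)
        + rho' (s, x) * (Dx i (divergence U) * q) (s, x)).
  rewrite (bmf_RintegralD torus b4 b2) opprD -h.
  rewrite -(bmf_RintegralB torus (bmfM (bt s b_rho) (bs (Dx i (divergence U * q)) s)) b2).
  by apply: eq_Rintegral => x _; rewrite smf_DM smfDE -mulrBr addrAC subrr add0r.
transitivity (\int[torus]_x (K * (rho' (s, x) * (divergence U * Dx i q) (s, x)))).
  apply: Rintegral_ae; apply: ae_mono ag => x [-> _ _ _].
  by rewrite /chi Uvec_div// smfME torus_smf_D_closed; ring.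
rewrite (bmf_RintegralZ torus K b3) h mulrN -(bmf_RintegralZ torus K (bmfD b4 b2)).
congr (- _); apply: eq_Rintegral => x _; rewrite mxE !smfME torus_smfE.
by ring.
Qed.

Notation mom z := (mom_density K (rho' z) (p (rho' z)) (fun i => J' i z) (fun i => D' i z)
  (fun i => G' i z) (fun i => U i z) (fun i => Dx i (divergence U) z) (fun i => Dt (U i) z)
  (fun i j => Dx i (U j) z)).

Lemma momentum_balance_weak tau : 0 < tau < T -> agree tau ->
  momentum_balance K p r U rho' J' D' G' tau.
Proof.
move=> tau_in ag; have [t0 tT] := andP tau_in.
have sU : smooth_spacetime_vec T Uvec by move=> i; rewrite UvecE; exact: smf_smooth.
have HL : Lvec (spacetime_measure T) 1%E Hvec.
  move=> i; have -> : (fun z => Hvec z 0 i) = (fun z => K * (D' i z * divergence U z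
      + rho' z * Dx i (divergence U) z)) by apply/funext => z; rewrite mxE.
  exact: bmf_Lfun1 (b_H i).
have Hg : {ae itv_measure 0 T, forall s : R, weak_gradient
    (fun x => chi (fun=> K) (rho (s, x)) * divx Uvec (s, x)) (fun x => Hvec (s, x))}.
  apply: (ae_mono2 _ (ae_itv_measure 0 T) (ae_mono2 (fun s x y => conj x y) agrees (bews_Drho sol))).
  by move=> s sT [ags wg]; exact: Hvec_gradient.
have := bews_momentum sol (lexx 0) t0 (ltW tT) sU HL Hg.
(* [f1], [f2], [f3] are bounded representatives of the three integrands. In [f2], [4 rho] times the
   tensor square of the gradient of [sqrt rho] has become the tensor square of the gradient of
   [rho]. *)
pose f1 z := \sum_i J' i z * Dt (U i) z + \sum_i \sum_j J' i z * J' j z / rho' z * Dx j (U i) z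
  + p (rho' z) * divergence U z.
pose f2 z := - (\sum_i D' i z * (K * (D' i z * divergence U z + rho' z * Dx i (divergence U) z)))
  + 2^-1 * K * (\sum_i D' i z ^+ 2) * divergence U z
  - K * \sum_i \sum_j D' i z * D' j z * Dx j (U i) z.
pose f3 z := \sum_i J' i z * U i z - rho' z * \sum_i G' i z * U i z.
have b1 : bmf (f1 : X4 -> R) by rewrite /f1; bmf_tac; exact: smf_bmf.
have b2 : bmf (f2 : X4 -> R) by rewrite /f2; bmf_tac; exact: smf_bmf.
have b3 : bmf (f3 : X4 -> R) by rewrite /f3; bmf_tac; exact: smf_bmf.
rewrite (iterated_II (f := fun z => \sum_i J z 0 i * dt (fun y => Uvec y 0 i) z
         + \sum_i \sum_j J z 0 i * J z 0 j / rho z * dx j (fun y => Uvec y 0 i) z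
         + p (rho z) * divx Uvec z) b1); last first.
  apply: ae_mono (agrees_to tau_in) => s [sT ags]; apply: ae_mono ags => x [-> h _ _].
  rewrite /f1 Uvec_div//; congr (_ + _ + _).
    by apply: eq_bigr => i _; rewrite h /dt Uvec_derive.
  by apply: eq_bigr => i _; apply: eq_bigr => j _; rewrite !h /dx Uvec_derive.
rewrite (iterated_II (f := fun z => let s := grad_sqrt (rho z) (Drho z) in
         - dot (Drho z) (Hvec z)
         + 2^-1 * derive1 (chi (fun=> K)) (rho z) * dot (Drho z) (Drho z) * divx Uvec z
         - 4 * chi (fun=> K) (rho z) *
             \sum_i \sum_j s 0 i * s 0 j * dx j (fun y => Uvec y 0 i) z) b2); last first.
  apply: ae_mono (agrees_to tau_in) => s [sT ags]; apply: ae_mono ags => x [-> _ h _].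
  rewrite /f2 Uvec_div// derive1_chi_cst sum3_sqr_dot; congr (- _ + _ - _).
  - by apply: eq_bigr => i _; rewrite h mxE.
  - by congr (_ * _ * _); apply: eq_bigr => i _; rewrite h.
  rewrite !mulr_sumr; apply: eq_bigr => i _; rewrite !mulr_sumr; apply: eq_bigr => j _.
  rewrite /dx Uvec_derive// /chi !mxE !h.
  have r0 := rho_gt0 (s, x); have q0 : Num.sqrt (rho' (s, x)) != 0 by rewrite gt_eqF// sqrtr_gt0.
  by rewrite -{1}(sqr_sqrtr (ltW r0)); field.
rewrite (iterated_II (f := fun z => dot (J z) (Uvec z) - rho z * dot (DV z) (Uvec z)) b3); last first.
  apply: ae_mono (agrees_to tau_in) => s [sT ags]; apply: ae_mono ags => x [-> h _ h'].
  by congr (_ - _ * _); apply: eq_bigr => i _; rewrite ?h ?h' mxE.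
have -> : \int[torus]_x dot (J (tau, x)) (Uvec (tau, x)) = \int[torus]_x (\sum_i J' i (tau, x) * U i (tau, x)).
  apply: Rintegral_ae; apply: ae_mono ag => x [_ h _ _]; apply: eq_bigr => i _.
  by rewrite h mxE.
have -> : \int[torus]_x dot (J (0, x)) (Uvec (0, x)) =
    \int[torus]_x (\sum_i r (0, x) * U i (0, x) * U i (0, x)).
  apply: Rintegral_ae; apply: ae_mono initial => x [_ _ h _]; apply: eq_bigr => i _.
  by rewrite h mxE.
rewrite /momentum_balance.
have -> : II tau (fun z => mom z) = II tau f1 - II tau f2 - II tau f3.
  rewrite -(bmf_RintegralB _ b1 b2) -(bmf_RintegralB _ (bmfB b1 b2) b3).
  apply: eq_Rintegral => z _; rewrite /mom_density /f1 /f2 /f3 -divergenceE.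
  have -> : \sum_i D' i z * (K * (D' i z * divergence U z + rho' z * Dx i (divergence U) z)) =
      K * ((\sum_i D' i z ^+ 2) * divergence U z + rho' z * \sum_i D' i z * Dx i (divergence U) z).
    by rewrite !sum3; ring.
  by field.
by move: (\int[torus]_x _ - _) (II tau f1) (II tau f2) (II tau f3) => A B C E; lra.
Qed.

Notation ener z := (energy_density K (rho' z) (fun i => J' i z) (fun i => D' i z)
  (fun i => G' i z) (P (rho' z))).
Notation ener_strong z := (energy_density K (r z) (fun i => r z * U i z) (fun i => Dx i r z)
  (fun i => Dx i Phi z) (P (r z))).

Lemma energyE (s : R) (g j w : 'rV[R]_3) : 0 < s ->
  energy (fun=> K) p s g j w =
  energy_density K s (fun i => j 0 i) (fun i => g 0 i) (fun i => w 0 i) (P s).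
Proof.
move=> s0; rewrite /energy /energy_density !sum3_sqr_dot -(dot_grad_sqrt g s0) !sum3_sqr_dot /chi.
by field; rewrite gt_eqF.
Qed.

Lemma energy_density_ext (s e : R) (j j' g g' w w' : 'I_3 -> R) :
  j =1 j' -> g =1 g' -> w =1 w' -> energy_density K s j g w e = energy_density K s j' g' w' e.
Proof. by move=> /funext -> /funext -> /funext ->. Qed.

Hypothesis dissipation : forall (Drho0 : R3 -> 'rV[R]_3) (V0 : R3 -> R) (DV0 : R3 -> 'rV[R]_3),
  weak_gradient rho0 Drho0 -> poisson_potential (mean rho0) rho0 V0 DV0 ->
  {ae itv_measure 0 T, forall tau : R,
    (\int[torus]_x
       (energy (fun=> K) p (rho (tau, x)) (Drho (tau, x)) (J (tau, x)) (DV (tau, x)))%:E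
     + \int[lebesgue_measure]_(t in `[0%R, tau]) \int[torus]_x
         (dot (J (t, x)) (J (t, x)) / rho (t, x))%:E
     <= \int[torus]_x (energy (fun=> K) p (rho0 x) (Drho0 x) (J0 x) (DV0 x))%:E)%E}.

(** The dissipation inequality is stated for any gradient and potential of the initial data; those
    of the classical solution at time 0 qualify, and the initial energy becomes the classical
    one. *)
Let initial_gradient : weak_gradient rho0 (fun x => \row_i Dx i r (0, x)).
Proof.
split; first exact: Lfun2_Lfun1 (bews_rho0_L2 sol).
  move=> i; have -> : (fun x => (\row_i Dx i r (0, x)) 0 i) = (fun x => Dx i r (0, x)).
    by apply/funext => x; rewrite mxE.
  exact: (bmf_Lfun1 torus (bs _ 0)).
move=> psi spsi i; have h := grad_pair_smf r 0 i (torus_smf Tp spsi).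
transitivity (\int[torus]_x (r (0, x) * Dx i (torus_smf Tp spsi) (0, x))).
  apply: Rintegral_ae; apply: ae_mono initial => x [_ -> _ _].
  by rewrite torus_smf_D_closed.
by rewrite h; congr (- _); apply: eq_Rintegral => x _; rewrite mxE torus_smfE.
Qed.

Let initial_potential : poisson_potential (mean rho0) rho0 (fun x => Phi (0, x))
  (fun x => \row_i Dx i Phi (0, x)).
Proof.
have rowE i : (fun x => (\row_i Dx i Phi (0, x)) 0 i) = (fun x => Dx i Phi (0, x)).
  by apply/funext => x; rewrite mxE.
split.
- exact: (bmf_Lfun2 torus (bs Phi 0)).
- by move=> i; rewrite rowE; exact: (bmf_Lfun2 torus (bs _ 0)).
- split; first exact: (bmf_Lfun1 torus (bs Phi 0)).
    by move=> i; rewrite rowE; exact: (bmf_Lfun1 torus (bs _ 0)).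
  move=> psi spsi i; have h := grad_pair_smf Phi 0 i (torus_smf Tp spsi).
  transitivity (\int[torus]_x (Phi (0, x) * Dx i (torus_smf Tp spsi) (0, x))).
    by apply: eq_Rintegral => x _; rewrite torus_smf_D_closed.
  by rewrite h; congr (- _); apply: eq_Rintegral => x _; rewrite mxE torus_smfE.
- exact: Phi_mean.
move=> psi spsi; pose q := torus_smf Tp spsi.
have h := grad_pair_divergence (bs q 0) (fun i => bs (Dx i q) 0) (grad_pair_smf q 0)
  (poisson : divergence (fun i => Dx i Phi) = _).
have b1 : bmf (fun x => \sum_i Dx i q (0, x) * Dx i Phi (0, x)) by bmf_tac; exact: bs.
have b2 : bmf (fun x => q (0, x) * (r - smf_cst Tp (mean rho0)) (0, x)) by bmf_tac; exact: bs.
move: h; rewrite (bmf_RintegralD torus b1 b2) => /eqP; rewrite addr_eq0 => /eqP h.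
transitivity (\int[torus]_x (\sum_i Dx i q (0, x) * Dx i Phi (0, x))).
  apply: eq_Rintegral => x _; apply: eq_bigr => i _.
  by rewrite mxE torus_smf_D_closed mulrC.
rewrite h; congr (- _); apply: Rintegral_ae; apply: ae_mono initial => x [_ -> _ _].
by rewrite smfBE torus_smfE mulrC.
Qed.

Lemma energy_balance_weak :
  {ae itv_measure 0 T, forall tau : R, energy_balance K p r Phi U rho' J' D' G' tau}.
Proof.
apply: (ae_mono2 _ (ae_itv_measure 0 T) (ae_mono2 (fun s x y => conj x y) agrees
  (dissipation initial_gradient initial_potential))).
move=> tau tau_in [ag]; have [t0 tT] := andP tau_in.
have b1 : bmf (fun x : X3 => ener (tau, x)).
  have bE : bmf (fun z : X4 => ener z) by rewrite /energy_density; bmf_tac.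
  exact: (bt tau bE).
have b2 : bmf (fun x : X3 => ener_strong (0, x)).
  have b_rV : bmf (fun z : X4 => (r z)^-1) := bmfV a0 (smf_bmf r) r_ge.
  have bE : bmf (fun z : X4 => ener_strong z) by rewrite /energy_density; bmf_tac; exact: smf_bmf.
  exact: (bt 0 bE).
have b3 : bmf (fun z : X4 => (\sum_i J' i z ^+ 2) / rho' z) by bmf_tac.
have -> : (\int[torus]_x (energy (fun=> K) p (rho (tau, x)) (Drho (tau, x)) (J (tau, x))
    (DV (tau, x)))%:E = (\int[torus]_x ener (tau, x))%:E)%E.
  rewrite -(bmf_integralE torus b1); apply: integral_ae; apply: ae_mono ag => x [h1 h2 h3 h4].
  by rewrite h1 energyE//; congr EFin; exact: energy_density_ext.
have -> : (\int[torus]_x (energy (fun=> K) p (rho0 x) (\row_i Dx i r (0, x)) (J0 x)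
    (\row_i Dx i Phi (0, x)))%:E = (\int[torus]_x ener_strong (0, x))%:E)%E.
  rewrite -(bmf_integralE torus b2); apply: integral_ae; apply: ae_mono initial => x [_ h1 _ h2].
  rewrite h1 energyE//; congr EFin; apply: energy_density_ext => // i; by rewrite mxE.
have -> : (\int[lebesgue_measure]_(t in `[0%R, tau]) \int[torus]_x
    (dot (J (t, x)) (J (t, x)) / rho (t, x))%:E =
    (II tau (fun z => (\sum_i J' i z ^+ 2) / rho' z))%:E)%E.
  rewrite (II_iter _ b3) -integral_itv_measure.
  rewrite -(bmf_integralE _ (bmf_fubini1 (itv_measure 0 tau) torus b3)).
  apply: integral_ae; apply: ae_mono (agrees_to tau_in) => s [_ ags].
  rewrite -(bmf_integralE torus (bt s b3)); apply: integral_ae; apply: ae_mono ags => x [-> h _ _].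
  rewrite sum3_sqr_dot; congr ((_ / _)%:E); apply: eq_bigr => i _; by rewrite h.
by rewrite -EFinD lee_fin.
Qed.

End WeakSolution.

Lemma ae_itv_dense (R : realType) (T c d : R) (Q : R -> Prop) : 0 <= c -> c < d -> d <= T ->
  {ae itv_measure 0 T, forall t : R, Q t} -> exists2 s, c < s < d & Q s.
Proof.
move=> c0 cd dT [N [mN N0 QN]]; apply: contrapT => nQ.
have sub : `]c, d[%classic `<=` N.
  move=> s /=; rewrite in_itv/= => scd; apply: QN => /= Qs; apply: nQ.
  by exists s.
have : (itv_measure 0 T (`]c, d[%classic : set (measurableTypeR R)) <= itv_measure 0 T N)%E.
  by apply: le_measure; rewrite ?inE//; exact: measurable_itv.
rewrite N0 /itv_measure /mfrestr /mrestr setIidl.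
  by rewrite lebesgue_measure_itv/= lte_fin cd -EFinD lee_fin subr_le0 leNgt cd.
move=> s /=; rewrite !in_itv/= => /andP[cs sd].
by rewrite (le_lt_trans c0 cs) (lt_le_trans sd dT).
Qed.

(** A nonzero value would persist on a subinterval, which has positive measure and so contains a
    time where [g] vanishes. *)
Lemma within_continuous_ae0 (R : realType) (T : R) (g : R -> R) : 0 < T ->
  {within `[0, T], continuous g} -> {ae itv_measure 0 T, forall t : R, g t = 0} ->
  forall t, 0 <= t <= T -> g t = 0.
Proof.
move=> T0 /subspace_continuousP cg g0 t tT; apply/eqP; apply: contrapT => /negP gt0.
have gtp : 0 < `|g t| by rewrite normr_gt0.
have := cg t; rewrite /= in_itv/= => /(_ tT).
move=> /cvgrPdist_lt/(_ _ gtp); rewrite /= near_withinE => /nbhs_ballP[e /= e0 he].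
have [t0 tT'] := andP tT.
pose c := Num.max 0 (t - e); pose d := Num.min T (t + e).
have [||||s /andP[cs sd] gs] := @ae_itv_dense R T c d (fun s => g s = 0).
- by rewrite le_max lexx.
- by rewrite /c /d lt_min !gt_max T0 /=; apply/and3P; split; lra.
- by rewrite ge_min lexx.
- exact: g0.
move: cs sd; rewrite gt_max lt_min => /andP[s0 ts] /andP[sT st].
have h : ball t e s -> s \in `[0, T] -> `|g t - g s| < `|g t| := he s.
have : `|g t - g s| < `|g t|.
  apply: h; last by rewrite in_itv/= !ltW.
  by rewrite /ball/= ltr_distl; apply/andP; split; lra.
by rewrite gs subr0 ltxx.
Qed.

Section WeakContinuity.
Context {R : realType}.
Variable Tp : {posnum R}.
Local Notation T := (Tp%:num).
Notation smf := (smf Tp).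
Notation R3 := (R * R * R)%type.
Notation X1 := (measurableTypeR R).
Notation X3 := (X1 * X1 * X1)%type.
Notation torus := (@torus_measure R).

(** For each L^2 test function the pairing with [u - w] is continuous in time and zero at almost
    every time, hence zero at every time; [integrable_eq0] concludes at fixed time. *)
Lemma Cweak_eq (u : R * R3 -> R) (w : smf) : Cweak T u ->
  {ae itv_measure 0 T, forall t : R, {ae torus, forall x, u (t, x) = w (t, x)}} ->
  forall t, 0 <= t <= T -> {ae torus, forall x, u (t, x) = w (t, x)}.
Proof.
move=> [uL uc] uw t tT.
have Iu : torus.-integrable setT (EFin \o (fun x => u (t, x))).
  by apply/Lfun1_integrable; apply: Lfun2_Lfun1; exact: uL.
have bw s : bmf (fun x : X3 => w (s, x)) := smf_bmf_slice w s.
have Iw : torus.-integrable setT (EFin \o (fun x => w (t, x))) := bmf_integrable torus (bw t).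
have Iuw : torus.-integrable setT (EFin \o (fun x => u (t, x) - w (t, x))).
  exact: (integrableB measurableT Iu Iw).
suff : {ae torus, forall x, u (t, x) - w (t, x) = 0}.
  by apply: ae_mono => x /eqP; rewrite subr_eq0 => /eqP.
apply: (integrable_eq0 Iuw) => psi Lpsi.
have Ipsi : torus.-integrable setT (EFin \o psi).
  by apply/Lfun1_integrable; exact: Lfun2_Lfun1 Lpsi.
have I1 : torus.-integrable setT (EFin \o (fun x => u (t, x) * psi x)).
  by apply/Lfun1_integrable; exact: (Lfun2_mul_Lfun1 (uL t tT) Lpsi).
have I2 : torus.-integrable setT (EFin \o (fun x => w (t, x) * psi x)).
  apply: (eq_integrable measurableT (EFin \o (fun x => psi x * w (t, x)))).
    by move=> x _; rewrite /= mulrC.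
  exact: (bmf_mul_integrable Ipsi (bw t)).
transitivity (\int[torus]_x (u (t, x) * psi x) - \int[torus]_x (w (t, x) * psi x)).
  rewrite -(RintegralB _ I1 I2)//; apply: eq_Rintegral => x _; exact: mulrBl.
have T0 : 0 < T by [].
apply: (within_continuous_ae0 (g := fun s => \int[torus]_x (u (s, x) * psi x)
   - \int[torus]_x (w (s, x) * psi x)) T0 _ _ tT).
  have cw : {within `[0, T], continuous (fun s => \int[torus]_x (w (s, x) * psi x))}.
    by apply: continuous_subspaceT; exact: int_mul_continuous.
  by move=> s; apply: cvgB; [exact: (uc psi Lpsi s)|exact: cw].
apply: ae_mono uw => s us; apply/eqP; rewrite subr_eq0; apply/eqP.
by apply: Rintegral_ae; apply: ae_mono us => x ->.
Qed.

End WeakContinuity.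

Section BoundedRepresentatives.
Context {R : realType}.
Variable Tp : {posnum R}.
Local Notation T := (Tp%:num).
Notation R3 := (R * R * R)%type.
Notation X1 := (measurableTypeR R).
Notation X3 := (X1 * X1 * X1)%type.
Notation X4 := (X1 * X3)%type.
Notation torus := (@torus_measure R).

Lemma ae_forall3 d (X : measurableType d) (mu : {measure set X -> \bar R})
    (Q : 'I_3 -> X -> Prop) : (forall i, {ae mu, forall x, Q i x}) ->
  {ae mu, forall x, forall i, Q i x}.
Proof.
move=> h; apply: (ae_mono2 _ (h 0) (ae_mono2 (fun x y z => conj y z) (h 1) (h 2))) => x q0 [q1 q2].
case=> -[|[|[|//]]] i3.
- by rewrite (_ : Ordinal i3 = 0) //; exact: val_inj.
- by rewrite (_ : Ordinal i3 = 1) //; exact: val_inj.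
- by rewrite (_ : Ordinal i3 = 2) //; exact: val_inj.
Qed.

Lemma Lvec_oo_bounded d (X : measurableType d) (mu : {finite_measure set X -> \bar R})
    (w : X -> 'rV[R]_3) : Lvec mu +oo%E w ->
  (forall i, measurable_fun setT (fun x => w x 0 i)) /\
  exists M : R, 0 <= M /\ {ae mu, forall x, forall i, `|w x 0 i| <= M}.
Proof.
move=> Lw; split; first by move=> i; case: (Lfun_oo_bounded (Lw i)).
have {}Lw i : exists M : R, {ae mu, forall x, `|w x 0 i| <= M}.
  by case: (Lfun_oo_bounded (Lw i)).
pose M i := projT1 (cid (Lw i)); exists (\sum_i `|M i|); split; first exact: sumr_ge0.
apply: ae_forall3 => i; apply: ae_mono (projT2 (cid (Lw i))) => x h.
by apply: (le_trans h); rewrite (bigD1 i)//= -[leLHS]addr0 lerD ?ler_norm ?sumr_ge0.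
Qed.

Variables (a b K : R) (p dp F : R -> R).
Hypotheses (a0 : 0 < a) (ab : a < b) (K0 : 0 < K) (pd : pressure_data p dp F).
Variables (rho0 : R3 -> R) (J0 : R3 -> 'rV[R]_3).
Variables (rho : R * R3 -> R) (J Drho : R * R3 -> 'rV[R]_3) (V : R * R3 -> R)
  (DV : R * R3 -> 'rV[R]_3).
Hypothesis sol : bounded_energy_weak_solution (fun=> K) p T rho0 J0 rho J Drho V DV.
Hypothesis rho_ab : {ae itv_measure 0 T, forall t : R, {ae torus, forall x, a <= rho (t, x) <= b}}.

(** The definition contains no direct bound on [DV]. It follows from the pointwise energy bound: the
    other terms are nonnegative, except the pressure potential, which is bounded while the density
    stays in [[a, b]]. The form of the constant comes from [(n - 1) ^ 2 >= 0], which turns a bound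
    on [n ^ 2] into one on [n]. *)
Lemma potential_gradient_bounded : exists M : R, 0 <= M /\
  {ae itv_measure 0 T, forall t : R, {ae torus, forall x, forall i, `|DV (t, x) 0 i| <= M}}.
Proof.
have [C PC] := pos_continuous_bounded b a0 (pos_derive_continuous (pd_potential pd)).
have [E EE] := bews_energy sol.
exists (1 + 2 * (`|E| + `|C|)); split; first by rewrite addr_ge0// mulr_ge0// addr_ge0.
apply: (ae_mono2 _ rho_ab EE) => t h1 h2; apply: (ae_mono2 _ h1 h2) => x rx ex i.
have r0 : 0 < rho (t, x) by case/andP: rx => /(lt_le_trans a0).
have Px := PC _ rx.
have dot_ge0 (u : 'rV[R]_3) : 0 <= dot u u.
  by rewrite sum3_sqr_dot sumr_ge0// => j _; exact: sqr_ge0.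
have e1 : 0 <= 2^-1 * (dot (J (t, x)) (J (t, x)) / rho (t, x)).
  by rewrite mulr_ge0// divr_ge0// ltW.
have e2 : 0 <= 2 * chi (fun=> K) (rho (t, x)) *
    dot (grad_sqrt (rho (t, x)) (Drho (t, x))) (grad_sqrt (rho (t, x)) (Drho (t, x))).
  by rewrite mulr_ge0// mulr_ge0// /chi mulr_ge0// ltW.
have e3 : (DV (t, x) 0 i) ^+ 2 <= dot (DV (t, x)) (DV (t, x)).
  by rewrite sum3_sqr_dot (bigD1 i)//= lerDl sumr_ge0// => j _; exact: sqr_ge0.
have e4 : (DV (t, x) 0 i) ^+ 2 <= 2 * (`|E| + `|C|).
  move: ex; rewrite /energy; have := ler_norm E; have := ler_norm C.
  by move: Px; rewrite ler_norml => /andP[Px _] *; lra.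
have e5 : 0 <= (`|DV (t, x) 0 i| - 1) ^+ 2 by exact: sqr_ge0.
have {}e4 : `|DV (t, x) 0 i| ^+ 2 <= 2 * (`|E| + `|C|) by rewrite real_normK ?num_real.
move: e5 e4; rewrite !expr2; have := normr_ge0 (DV (t, x) 0 i).
by move: (`|DV (t, x) 0 i|) => n n0; nra.
Qed.

(** Truncation at the essential bounds alters the functions, at almost every time, on null sets
    only, and gives bounds valid everywhere. *)
Lemma bounded_representatives : exists (rho' : X4 -> R) (J' D' G' : 'I_3 -> X4 -> R),
  [/\ [/\ bmf rho', forall i, bmf (J' i), forall i, bmf (D' i) & forall i, bmf (G' i)],
      forall z, a <= rho' z <= b &
      {ae itv_measure 0 T, forall t : R, agree rho J Drho DV rho' J' D' G' t}].
Proof.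
have [mr _] := Lfun_oo_bounded (bews_rho_Loo sol).
have [mJ [MJ [MJ0 hJ]]] := Lvec_oo_bounded (bews_J_Loo sol).
have [mD [MD [MD0 hD]]] := Lvec_oo_bounded (bews_Drho_Loo sol).
have [MG [MG0 hG]] := potential_gradient_bounded.
have NN (M : R) : 0 <= M -> - M <= M by lra.
exists (fun z => truncate a b (rho z)), (fun i z => truncate (- MJ) MJ (J z 0 i)),
  (fun i z => truncate (- MD) MD (Drho z 0 i)), (fun i z => truncate (- MG) MG (DV z 0 i)).
split.
- split.
  + exact: (bmf_truncate (ltW ab) mr).
  + by move=> i; exact: (bmf_truncate (NN _ MJ0) (mJ i)).
  + by move=> i; exact: (bmf_truncate (NN _ MD0) (mD i)).
  + by move=> i; exact: (bmf_truncate (NN _ MG0) (bews_DV_measurable sol i)).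
- by move=> z; exact: truncate_in (ltW ab).
have hJ' := ae_prod_iter hJ; have hD' := ae_prod_iter hD.
apply: (ae_mono2 _ (ae_mono2 (fun t x y => conj x y) hJ' hD')
  (ae_mono2 (fun t x y => conj x y) rho_ab hG)) => t [h1 h2] [h3 h4].
apply: (ae_mono2 _ (ae_mono2 (fun t x y => conj x y) h1 h2)
  (ae_mono2 (fun t x y => conj x y) h3 h4)) => x [q1 q2] [q3 q4].
by split=> [|i|i|i]; rewrite truncate_id// -ler_norml.
Qed.

End BoundedRepresentatives.

Lemma lt_1D_norm3 (R : realDomainType) (a c m s : R) :
  [|| s <= a, s <= c | s <= m] -> s < 1 + `|a| + `|c| + `|m|.
Proof.
have := (ler_norm a, ler_norm c, ler_norm m, normr_ge0 a, normr_ge0 c, normr_ge0 m).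
by move=> -[[[[[? ?] ?] ?] ?] ?] /or3P[] ?; lra.
Qed.

Theorem theorem5p1 (R : realType) (T Kbar : R) (p : R -> R)
  (rho0 : R * R * R -> R) (J0 : R * R * R -> 'rV[R]_3)
  (rho : R * (R * R * R) -> R) (J : R * (R * R * R) -> 'rV[R]_3)
  (rhot : R * (R * R * R) -> R) (Jt : R * (R * R * R) -> 'rV[R]_3)
  (rholow : R)
  (T_gt0 : 0 < T) (Kbar_gt0 : 0 < Kbar)
  (p_regular : pressure_regular p) (p0 : p 0 = 0)
  (weak : dissipative_weak_solution (fun=> Kbar) p T rho0 J0 rho J)
  (rholow_gt0 : 0 < rholow)
  (rho_ge : {ae spacetime_measure T, forall z, rholow <= rho z})
  (strong : classical_solution (fun=> Kbar) p T rho0 J0 rhot Jt) :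
  forall t : R, 0 <= t <= T ->
    {ae torus_measure, forall x, rho (t, x) = rhot (t, x) /\ J (t, x) = Jt (t, x)}.
Proof.
pose Tp := PosNum T_gt0.
have [dp [F pd]] := pressure_regular_data p_regular.
have [Drho [V [DV [sol dissipation]]]] := weak.
have [Vt ssol] := strong.
have [r [Phi [U [E [c c0 rc] [continuity poisson Phi_mean] velocity]]]] :=
  @classical_solution_smf R Tp _ _ _ _ pd _ _ _ _ _ ssol.
have [C rC] := smf_bounded r.
have [_ [M rhoM]] := Lfun_oo_bounded (bews_rho_Loo sol).
(* One interval away from zero contains the values of both densities, so the pressure functions are
   evaluated where they are regular; the summand 1 in [b] ensures [a < b]. *)
pose a := Num.min rholow c; pose b := 1 + `|a| + `|C| + `|M|.
have a0 : 0 < a by rewrite lt_min rholow_gt0.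
have ab : a < b by apply: lt_1D_norm3; rewrite lexx.
have r_ab z : a <= r z <= b.
  rewrite ge_min rc orbT ltW//; apply: lt_1D_norm3.
  by rewrite (le_trans (ler_norm _) (rC z)) orbT.
have r_ge z : a <= r z by case/andP: (r_ab z).
have rho_ab : {ae itv_measure 0 T, forall t : R, {ae torus_measure, forall x, a <= rho (t, x) <= b}}.
  apply: (ae_mono2 _ (ae_prod_iter rho_ge) (ae_prod_iter rhoM)) => t h1 h2.
  apply: (ae_mono2 _ h1 h2) => x q1 q2; rewrite ge_min q1 /= ltW//; apply: lt_1D_norm3.
  by rewrite (le_trans (ler_norm _) q2) !orbT.
have [rho' [J' [D' [G' [[b_rho b_J b_D b_G] rho'_ab agrees]]]]] :=
  @bounded_representatives R Tp a b Kbar p dp F a0 ab Kbar_gt0 pd rho0 J0 rho J Drho V DV sol rho_ab.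
have b_r : bmf r := smf_bmf r.
have b_Pr : bmf (fun z => pressure_potential p (r z)).
  exact: (bmf_pos_continuous a0 (pos_derive_continuous (pd_potential pd)) b_r.1 r_ab).
have b_Prho : bmf (fun z => pressure_potential p (rho' z)).
  exact: (bmf_pos_continuous a0 (pos_derive_continuous (pd_potential pd)) b_rho.1 rho'_ab).
have b_prho : bmf (fun z => p (rho' z)).
  exact: (bmf_pos_continuous a0 (pos_derive_continuous (pd_derive pd)) b_rho.1 rho'_ab).
have slab_in t x : 0 <= t <= T -> slab T (t, x) by [].
have T00 : 0 <= (0 : R) <= T by rewrite lexx ltW.
have initial : {ae torus_measure, forall x, [/\ rho (0, x) = r (0, x), rho0 x = r (0, x),
    forall i, J (0, x) 0 i = r (0, x) * U i (0, x) & forall i, J0 x 0 i = r (0, x) * U i (0, x)]}.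
  apply: (ae_mono2 _ (ae_mono2 (fun t x y => conj x y) (bews_rho0 sol) (bews_J0 sol))
    (ae_mono2 (fun t x y => conj x y) (cs_rho0 ssol) (cs_J0 ssol))) => x [q1 q2] [q3 q4].
  have [e1 e2] := E _ (slab_in 0 x T00).
  by split=> [||i|i]; rewrite ?e2 ?e1 ?q1 ?q2 ?q3 ?q4.
have good_times : {ae itv_measure 0 T, forall t : R,
    good_time Kbar (mean rho0) p r Phi U rho' J' D' G' t}.
  have en := @energy_balance_weak R Tp a b Kbar p a0 rho0 J0 rho J Drho V DV sol rho' J' D' G'
    b_rho b_J b_D b_G rho'_ab agrees r Phi U poisson Phi_mean initial r_ge b_Pr b_Prho dissipation.
  apply: (ae_mono2 _ (ae_mono2 (fun t x y => conj x y) (ae_itv_measure 0 T) agrees)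
    (ae_mono2 (fun t x y => conj x y) (bews_Drho sol) en)) => t [tT ag] [wg et].
  split; last exact: et.
  - exact: (@slice_ok_weak R Tp _ _ _ _ _ _ _ _ _ sol _ _ _ _ b_G _ tT ag wg).
  - exact: (@continuity_balance_weak R Tp _ _ _ _ _ _ _ _ _ sol _ _ _ _ b_rho b_J agrees
      _ _ initial _ tT ag).
  - exact: (@momentum_balance_weak R Tp _ _ _ _ a0 _ _ _ _ _ _ _ sol _ _ _ _ b_rho b_J b_D b_G
      rho'_ab agrees _ _ initial b_prho _ tT ag).
have st := @stability R Tp a b Kbar (mean rho0) p dp F a0 ab Kbar_gt0 pd r Phi U r_ab continuity
  poisson Phi_mean velocity rho' J' D' G' b_rho b_J b_D b_G rho'_ab good_times.
have eq_rho : {ae itv_measure 0 T, forall t : R, {ae torus_measure, forall x, rho (t, x) = r (t, x)}}.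
  apply: (ae_mono2 _ agrees st) => t ag h; apply: (ae_mono2 _ ag h).
  by move=> x [-> _ _ _] [].
have eq_J i : {ae itv_measure 0 T, forall t : R,
    {ae torus_measure, forall x, J (t, x) 0 i = (r * U i) (t, x)}}.
  apply: (ae_mono2 _ agrees st) => t ag h; apply: (ae_mono2 _ ag h).
  by move=> x [_ -> _ _] [_ ->]; rewrite smfME.
(* So far the equalities hold at almost every time; weak continuity of [rho] and [J] extends them to
   every time, endpoints included. *)
move=> t tT.
have h1 := @Cweak_eq R Tp rho r (bews_rho_Cweak sol) eq_rho t tT.
have h2 : {ae torus_measure, forall x, forall i, J (t, x) 0 i = (r * U i) (t, x)}.
  by apply: ae_forall3 => i; exact: (@Cweak_eq R Tp _ _ (bews_J_Cweak sol i) (eq_J i) t tT).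
apply: (ae_mono2 _ h1 h2) => x e1 e2; have [q1 q2] := E _ (slab_in t x tT).
split; first by rewrite e1.
by apply/rowP => i; rewrite e2 smfME.
Qed.
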